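(* Let $V(f)\subset\mathbb{P}^r$ be a general P-hypersurface of type $(r,t,n)$ and degree $d$, with core $\Pi$. Set $\mu=[d/n]$ (integer part). Then: (i) $V(f)$ has multiplicity $d-\mu$ at the general point of its core $\Pi$; (ii) the general $(t+1)$-dimensional subspace $\Pi'$ through $\Pi$ cuts out on $V(f)$, off $\Pi$, a cone of degree at most $\mu$, consisting of $\mu$ subspaces of dimension $t$ which all pass through a subspace $\Gamma$ of $\Pi'$ of dimension $t-1$; (iii) as $\Pi'$ varies, the corresponding $\Gamma$ describes a unirational family of dimension $\chi\le\min\{t-1,r-t-1\}$; (iv) if $\mu>r-t-2$, then $V(f)$ is a cone if and only if the forms $M_0,\dots,M_t$ are linearly dependent over $k$. This in turn happens as soon as either $t=1$, or $n=1,2$; (v) $V(f)$ is irreducible.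
   Context: $k$ is an algebraically closed field of characteristic $0$. Let $r\ge2$ and $1\le t\le r-2$ be integers. Let $M_0,\dots,M_t\in k[x_{t+1},\dots,x_r]$ be forms of the same degree $n-1$ which are algebraically dependent over $k$. Set $Q=M_0x_0+\dots+M_tx_t$, a form of degree $n$. Let $d>n$, $\mu=[d/n]$, and let $P_k(x_{t+1},\dots,x_r)$, $k=0,\dots,\mu$, be forms of degree $d-kn$. The form $f=\sum_{k=0}^{\mu}Q^kP_k(x_{t+1},\dots,x_r)$ of degree $d$, or any form obtained from it by a linear change of variables, is called a P-polynomial (Permutti polynomial) of type $(r,t,n)$, and $V(f)\subset\mathbb{P}^r$ is called a P-hypersurface of type $(r,t,n)$, with core the $t$-dimensional subspace $\Pi$ of equations $x_{t+1}=\dots=x_r=0$ (in the coordinates of the construction). It is called general if the defining data are chosen sufficiently generally (subject to the algebraic dependence of $M_0,\dots,M_t$). *)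

(* Defs.v *)
From HB Require Import structures.
From mathcomp Require Import all_boot all_order all_algebra.
From mathcomp Require Import mpoly.

Set Implicit Arguments.
Unset Strict Implicit.
Unset Printing Implicit Defensive.

Import GRing.Theory.
Local Open Scope ring_scope.

Section Genericity.
Variables (k : fieldType) (T J : Type) (x : J -> T -> k).

(* Zariski topology on T defined by a (possibly infinite) family x of
   k-valued coordinate functions; a polynomial function involves only finitely
   many of them. *)
Definition polyfun (h : T -> k) : Prop :=
  exists (s : nat) (c : 'I_s -> J) (p : {mpoly k[s]}),
    forall D, h D = p.@[fun l => x (c l) D].

Definition zopen (U : T -> Prop) : Prop :=
  exists S : (T -> k) -> Prop,
    (forall h, S h -> polyfun h) /\
    (forall D, U D <-> exists2 h, S h & h D != 0).

(* U meets X in a dense relatively open subset; when X is reducible, U thus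
   meets every irreducible component of X. *)
Definition dense_open_in (X U : T -> Prop) : Prop :=
  zopen U /\
  forall W, zopen W -> (exists D, X D /\ W D) -> exists D, [/\ X D, W D & U D].

Definition generically_in (X P : T -> Prop) : Prop :=
  exists U, dense_open_in X U /\ forall D, X D -> U D -> P D.

End Genericity.

(* Points of P^(m-1) are nonzero row vectors up to scaling, linear subspaces of
   projective dimension e are {vspace 'rV[k]_m} of dimension e+1, and closed
   subsets are represented by their affine cones. *)
Section Projective.
Variables (k : fieldType) (m : nat).
Implicit Types (f g : {mpoly k[m]}) (v w p : 'rV[k]_m).
Implicit Types (X Z : 'rV[k]_m -> Prop).

Definition xcoord (i : 'I_m) (v : 'rV[k]_m) : k := v 0 i.

Definition zeros f (w : 'rV[k]_m) : Prop := f.@[w 0] = 0.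

Definition proj_closed (Z : 'rV[k]_m -> Prop) : Prop :=
  exists S : {mpoly k[m]} -> Prop,
    (forall f, S f -> exists e, f \is e.-homog) /\
    (forall w, Z w <-> forall f, S f -> zeros f w).

Definition irreducible_set (X : 'rV[k]_m -> Prop) : Prop :=
  (exists2 w, w != 0 & X w) /\
  forall Z1 Z2, proj_closed Z1 -> proj_closed Z2 ->
    (forall w, w != 0 -> X w -> Z1 w \/ Z2 w) ->
    (forall w, w != 0 -> X w -> Z1 w) \/ (forall w, w != 0 -> X w -> Z2 w).

Definition irreducible_form f : Prop :=
  [/\ f != 0, f \isn't a GRing.unit &
      forall g h : {mpoly k[m]},
        f = g * h -> g \is a GRing.unit \/ h \is a GRing.unit].

(* v is a point of X, and X contains every line joining v to a point of X. *)
Definition vertex (X : 'rV[k]_m -> Prop) v : Prop :=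
  [/\ v != 0, X v & forall w, X w -> forall a b : k, X (a *: v + b *: w)].

Definition is_cone (X : 'rV[k]_m -> Prop) : Prop := exists v, vertex X v.

(* The multiplicity is the order at the origin of the Taylor expansion
   f (p + X). For a form f and p != 0 this is also the order of any
   dehomogenization of f at the corresponding affine point. *)
Definition multiplicity f p (e : nat) : Prop :=
  let fp := f \mPo [tuple 'X_i + (p 0 i)%:MP | i < m] in
  (forall mon, mon \in msupp fp -> (e <= mdeg mon)%N) /\
  (exists2 mon, mon \in msupp fp & mdeg mon = e).

(* Pi' cuts out on V(f), off its hyperplane Pi, the hypersurface V(g) of Pi',
   i.e. the divisor cut out by f on Pi' is a Pi + V(g), where s is an equation
   of Pi in Pi' and Pi is not a component of V(g). *)
Definition cuts_off f (Pi' Pi : {vspace 'rV[k]_m}) g : Prop :=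
  exists (s : {mpoly k[m]}) (a : nat),
    [/\ s \is 1.-homog,
        (forall w, w \in Pi' -> (zeros s w <-> w \in Pi)),
        (forall w, w \in Pi' -> f.@[w 0] = s.@[w 0] ^+ a * g.@[w 0]) &
        (exists2 w, w \in Pi & g.@[w 0] != 0)].

Definition cuts_cone_off f (Pi' Pi : {vspace 'rV[k]_m}) (t mu : nat)
    (Gam : {vspace 'rV[k]_m}) : Prop :=
  exists (g : {mpoly k[m]}) (e : nat) (Lam : 'I_mu -> {vspace 'rV[k]_m}),
    let C w := w \in Pi' /\ zeros g w in
    [/\ [/\ cuts_off f Pi' Pi g, g \is e.-homog, (e <= mu)%N & is_cone C],
        [/\ injective Lam,
            forall w, C w <-> exists j, w \in Lam j &
            forall j, \dim (Lam j) = t.+1 /\ (Gam <= Lam j)%VS] &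
        (Gam <= Pi')%VS /\ \dim Gam = t].

End Projective.

(* Families F of q-dimensional vector subspaces of k^m, as subsets of the
   Grassmannian in its Pluecker embedding. The Pluecker coordinates of the row
   space of B are the q x q minors of B; indexing them by all maps
   'I_q -> 'I_m only adds repetitions up to sign and zeros. *)
Section Families.
Variables (k : fieldType) (q m : nat).
Implicit Type F : {vspace 'rV[k]_m} -> Prop.

Definition rowspan (B : 'M[k]_(q, m)) : {vspace 'rV[k]_m} :=
  <<[seq row i B | i <- enum 'I_q]>>%VS.

(* G, in the Pluecker coordinates selected by c, vanishes on F. *)
Definition vanishes_on F (s : nat) (c : 'I_s -> 'I_q -> 'I_m)
    (G : {mpoly k[s]}) : Prop :=
  forall B : 'M[k]_(q, m), row_free B -> F (rowspan B) ->
    G.@[fun l => \det (colsub (c l) B)] = 0.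

Definition same_closure F1 F2 : Prop :=
  forall s (c : 'I_s -> 'I_q -> 'I_m) (G : {mpoly k[s]}) e, G \is e.-homog ->
    (vanishes_on F1 c G <-> vanishes_on F2 c G).

(* The image of the rational map from affine a-space to the Grassmannian given
   by B. Every such rational map arises in this way, by clearing denominators
   in an affine chart of the Grassmannian. *)
Definition param_family (a : nat) (B : 'M[{mpoly k[a]}]_(q, m))
    (Gam : {vspace 'rV[k]_m}) : Prop :=
  exists x : 'I_a -> k,
    let Bx := map_mx (fun p : {mpoly k[a]} => p.@[x]) B in
    row_free Bx /\ Gam = rowspan Bx.

(* The closure of F is dominated by an affine space. *)
Definition unirational_family F : Prop :=
  exists (a : nat) (B : 'M[{mpoly k[a]}]_(q, m)),
    (exists Gam, param_family B Gam) /\ same_closure F (param_family B).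

Definition pluecker_independent F (s : nat) (c : 'I_s -> 'I_q -> 'I_m) : Prop :=
  forall (G : {mpoly k[s]}) e, G \is e.-homog -> vanishes_on F c G -> G = 0.

(* The dimension of the closure of F is the transcendence degree of its
   homogeneous coordinate ring, minus one; a transcendence basis can be chosen
   among the Pluecker coordinates, which generate that ring. *)
Definition family_dim F (chi : nat) : Prop :=
  (exists c : 'I_chi.+1 -> 'I_q -> 'I_m, pluecker_independent F c) /\
  ~ (exists c : 'I_chi.+2 -> 'I_q -> 'I_m, pluecker_independent F c).

End Families.

Section Permutti.
Variables (k : fieldType) (r t mu : nat).

(* p lies in the subring k[x_(t+1), ..., x_r] of k[x_0, ..., x_r]. *)
Definition outer_vars (p : {mpoly k[r.+1]}) : Prop :=
  forall mon, mon \in msupp p -> forall i : 'I_r.+1, (i <= t)%N -> mon i = 0%N.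

Definition alg_dependent (s : nat) (M : 'I_s -> {mpoly k[r.+1]}) : Prop :=
  exists2 G : {mpoly k[s]}, G != 0 & G \mPo [tuple M i | i < s] = 0.

Definition lin_dependent (s : nat) (M : 'I_s -> {mpoly k[r.+1]}) : Prop :=
  exists2 c : 'I_s -> k,
    (exists i, c i != 0) & \sum_(i < s) c i *: M i = 0.

Record pdata := PData {
  coreM : 'I_t.+1 -> {mpoly k[r.+1]};
  coefP : 'I_mu.+1 -> {mpoly k[r.+1]}
}.

Definition pdata_wf (n d : nat) (D : pdata) : Prop :=
  [/\ forall i, coreM D i \is (n - 1).-homog /\ outer_vars (coreM D i),
      alg_dependent (coreM D) &
      forall l : 'I_mu.+1,
        coefP D l \is (d - l * n).-homog /\ outer_vars (coefP D l)].

(* The coefficients of the forms M_i and P_l, as coordinates on the space of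
   defining data. *)
Definition pdata_coef (j : ('I_t.+1 + 'I_mu.+1) * 'X_{1..r.+1}) (D : pdata) : k :=
  match j.1 with
  | inl i => (coreM D i)@_(j.2)
  | inr l => (coefP D l)@_(j.2)
  end.

Definition Qform (D : pdata) : {mpoly k[r.+1]} :=
  \sum_(i < t.+1) coreM D i * 'X_(inord i).

Definition permutti (D : pdata) : {mpoly k[r.+1]} :=
  \sum_(l < mu.+1) Qform D ^+ l * coefP D l.

(* (lin_change A f) (w) = f (w *m A). *)
Definition lin_change (A : 'M[k]_r.+1) (f : {mpoly k[r.+1]}) : {mpoly k[r.+1]} :=
  f \mPo [tuple \sum_(j < r.+1) A j i *: 'X_j | i < r.+1].

(* The subspace of equations x_j = 0, j > t, where x = w *m A are the
   coordinates of the construction. *)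
Definition core (A : 'M[k]_r.+1) : {vspace 'rV[k]_r.+1} :=
  (\bigcap_(j < r.+1 | (t < j)%N) lker (linfun (mulmxr (col j A))))%VS.

End Permutti.

(* Main.v *)
(* Irreducibility, hence (v), is proved on one good affine plane: there the
   equation satisfies Ruppert's criterion (a linear system of differential
   equations attached to it has only the trivial solution) and is separable on
   a line, so a factorization of f = permutti D would give a nontrivial
   solution. Both conditions are open, and for given M_i with M_0 nonzero the
   P_l can be chosen so that the plane section is z^mu N^mu + s^d - tau, with N
   the restriction of M_0 to a line, which satisfies them.

   On the span of Pi and a point y (in the coordinates of the construction) f
   restricts to s^(d - mu) g, where g = sum P_l(y) s^(mu - l) L^l and L is the
   linear form sum M_i(y) x_i. This gives (i), and splitting the binary form g
   in (s, L) gives (ii), with Gamma = Pi cap {L = 0}. So Gamma has the basis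
   M_0 e_j - M_j e_0, which parametrizes the family rationally. Its Pluecker
   coordinates are, up to a power of M_0, linear in the M_i, which satisfy a
   relation; they are also forms of one degree in r - t variables. This bounds
   their transcendence degree by t and by r - t.

   If V(f) is a cone with vertex v, the derivative of f along v vanishes, by
   the Nullstellensatz for the irreducible form f. For generic P_l the partial
   derivatives of f are independent unless the M_i are linearly dependent. *)

Require Import Defs.
From HB Require Import structures.
From mathcomp Require Import all_boot all_order all_algebra.
From mathcomp Require Import perm separable mpoly.
From mathcomp Require Import ring zify.
From Stdlib Require Import Classical.

Set Implicit Arguments.
Unset Strict Implicit.
Unset Printing Implicit Defensive.

Import GRing.Theory.
Local Open Scope ring_scope.

(** * Polynomials determined by their values *)

(** Because of the relation imposed on the M_i, the space of data may be reducible, so genericity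
    cannot be read off one example: a good member must be found inside every nonempty open piece.
    The relation does not involve the P_l, so the line joining two choices of the P_l over the same
    M_i consists of admissible data, and nonempty open conditions on a line meet. Hence every sample
    is built for given M_i, if necessary after a deformation that makes M_0 nonzero and keeps a
    relation. The main conditions become open by being phrased as the trivial kernel of a linear
    system with coefficients polynomial in the data; this is why irreducibility goes through a
    linear criterion and separability through a Sylvester-type system. Factoriality of the
    polynomial ring makes an irreducible form prime, and the Nullstellensatz for a hypersurface then
    follows from a Bezout relation in the last variable. *)

Section Muni.
Variables (n : nat) (R : comNzRingType).
Local Notation widen := (widen_ord (leqnSn n)).

Lemma muni_widen (i : 'I_n) : muni ('X_(widen i) : {mpoly R[n.+1]}) = ('X_i)%:P.
Proof.
rewrite /muni mmapX mmap1U; case: splitP => [j eq|j].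
  by congr ('X__)%:P; apply/val_inj; rewrite /= -eq.
by rewrite ord1 /= addn0 => /eqP; rewrite ltn_eqF.
Qed.

Lemma muni_max : muni ('X_ord_max : {mpoly R[n.+1]}) = 'X.
Proof.
rewrite /muni mmapX mmap1U; case: splitP => //; case=> j lt_jn /eqP /=.
by have := lt_jn; rewrite ltn_neqAle eq_sym => /andP[/negbTE->].
Qed.

Definition of_muni (P : {poly {mpoly R[n]}}) : {mpoly R[n.+1]} :=
  (map_poly (@mwiden n R) P).['X_ord_max].

Lemma of_muniD P Q : of_muni (P + Q) = of_muni P + of_muni Q.
Proof. by rewrite /of_muni rmorphD hornerD. Qed.

Lemma of_muniM P Q : of_muni (P * Q) = of_muni P * of_muni Q.
Proof. by rewrite /of_muni rmorphM hornerM. Qed.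

Lemma of_muniC c : of_muni c%:P = mwiden c.
Proof. by rewrite /of_muni map_polyC hornerC. Qed.

Lemma of_muniX : of_muni 'X = 'X_ord_max.
Proof. by rewrite /of_muni map_polyX hornerX. Qed.

(** Lets identities between ring morphisms be checked on constants and variables, without handling
    monomials. *)
Lemma mpoly_ringind (m : nat) (P : {mpoly R[m]} -> Prop) :
  (forall c, P c%:MP) -> (forall i, P 'X_i) ->
  (forall p q, P p -> P q -> P (p + q)) ->
  (forall p q, P p -> P q -> P (p * q)) -> forall p, P p.
Proof.
move=> PC PX PD PM p; rewrite [p]mpolyE.
apply: (big_ind P) => [||mm _]; [by rewrite -mpolyC0|exact: PD|].
rewrite -mul_mpolyC; apply: (PM) => //; rewrite mpolyXE_id.
apply: (big_ind P) => [||i _]; [by rewrite -mpolyC1|exact: PM|].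
elim: (mm i) => [|e IHe]; first by rewrite expr0 -mpolyC1.
by rewrite exprS; apply: PM.
Qed.

Lemma mwidenXU (i : 'I_n) : mwiden 'X_i = 'X_(widen i) :> {mpoly R[n.+1]}.
Proof. by rewrite mwidenX mnmwiden1. Qed.

Lemma muniK : cancel (@muni n R) of_muni.
Proof.
elim/mpoly_ringind => [c|i|p q Hp Hq|p q Hp Hq].
- by rewrite muniC of_muniC mwidenC.
- case: (unliftP ord_max i) => [j ->|->]; last by rewrite muni_max of_muniX.
  have -> : lift ord_max j = widen j by apply/val_inj; exact: lift_max.
  by rewrite muni_widen of_muniC mwidenXU.
- by rewrite muniD of_muniD; congr (_ + _).
- by rewrite muniM of_muniM; congr (_ * _).
Qed.

Lemma muni_mwiden (p : {mpoly R[n]}) : muni (mwiden p) = p%:P.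
Proof.
elim/mpoly_ringind: p => [c|i|p q Hp Hq|p q Hp Hq].
- by rewrite mwidenC muniC.
- by rewrite mwidenXU muni_widen.
- by rewrite mwidenD muniD polyCD; congr (_ + _).
- by rewrite mwidenM muniM polyCM; congr (_ * _).
Qed.

Lemma of_muniK : cancel of_muni (@muni n R).
Proof.
elim/poly_ind => [|P c IH].
  by rewrite /of_muni rmorph0 horner0 muni0.
by rewrite of_muniD of_muniM of_muniX of_muniC muniD muniM IH muni_max muni_mwiden.
Qed.

Lemma meval_muni (p : {mpoly R[n.+1]}) (v : 'I_n.+1 -> R) :
  p.@[v] = (map_poly (meval (v \o widen)) (muni p)).[v ord_max].
Proof.
elim/mpoly_ringind: p => [c|i|p q Hp Hq|p q Hp Hq].
- by rewrite muniC map_polyC hornerC /= !mevalC.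
- case: (unliftP ord_max i) => [j ->|->].
    have -> : lift ord_max j = widen j by apply/val_inj; exact: lift_max.
    by rewrite muni_widen map_polyC hornerC /= !mevalXU.
  by rewrite muni_max map_polyX hornerX mevalXU.
- rewrite mevalD muniD (rmorphD (map_poly _)) hornerD.
  by congr (_ + _); [exact: Hp|exact: Hq].
- rewrite mevalM muniM (rmorphM (map_poly _)) hornerM.
  by congr (_ * _); [exact: Hp|exact: Hq].
Qed.

End Muni.

Section Char0.
Variable k : fieldType.
Hypothesis char0 : [pchar k] =i pred0.

Lemma natr_inj0 : injective (fun i : nat => i%:R : k).
Proof.
move=> i j /= eq_ij; wlog le_ij : i j eq_ij / (i <= j)%N.
  by move=> H; case/orP: (leq_total i j) => /H-> //.
apply/eqP; rewrite eqn_leq le_ij /= -subn_eq0; apply/eqP/eqP.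
by rewrite -((pcharf0P k).1 char0) natrB // eq_ij subrr.
Qed.

Lemma poly_grid0 (p : {poly k}) N : (size p <= N)%N ->
  (forall i, (i < N)%N -> p.[i%:R] = 0) -> p = 0.
Proof.
move=> sz H; apply: (@roots_geq_poly_eq0 _ p [seq i%:R | i <- iota 0 N]).
- by apply/allP => x /mapP[i]; rewrite mem_iota => /andP[_ Hi] ->; apply/rootP/H.
- by rewrite map_inj_uniq ?iota_uniq //; exact: natr_inj0.
- by rewrite size_map size_iota.
Qed.

Lemma poly_ext0 (p : {poly k}) : (forall x, p.[x] = 0) -> p = 0.
Proof. by move=> H; apply: (@poly_grid0 _ (size p)). Qed.

Lemma poly_ext (p q : {poly k}) : (forall x, p.[x] = q.[x]) -> p = q.
Proof.
move=> H; apply/eqP; rewrite -subr_eq0; apply/eqP/poly_ext0 => x.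
by rewrite hornerD hornerN H subrr.
Qed.

Lemma mpoly_ext0 n (p : {mpoly k[n]}) : (forall v, p.@[v] = 0) -> p = 0.
Proof.
elim: n p => [|n IH] p H.
  have := H (fun=> 0); rewrite [p]nvar0_mpolyC mevalC => ->.
  by rewrite mpolyC0.
rewrite -[p]muniK; suff -> : muni p = 0 by rewrite /of_muni rmorph0 horner0.
apply/polyP => i; rewrite coef0; apply: IH => v.
suff E : map_poly (meval v) (muni p) = 0.
  by have := congr1 (fun q : {poly k} => q`_i) E; rewrite coef_map coef0.
apply: poly_ext0 => x.
pose v' (j : 'I_n.+1) := if unlift ord_max j is Some j' then v j' else x.
have := H v'; rewrite meval_muni {2}/v' unlift_none => <-; congr (_.[_]).
apply: eq_map_poly => q; apply: meval_eq => j /=; rewrite /v'.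
have -> : widen_ord (leqnSn n) j = lift ord_max j.
  by apply/val_inj; exact/esym/lift_max.
by rewrite liftK.
Qed.

Lemma mpoly_ext n (p q : {mpoly k[n]}) : (forall v, p.@[v] = q.@[v]) -> p = q.
Proof.
move=> H; apply/eqP; rewrite -subr_eq0; apply/eqP/mpoly_ext0 => v.
by rewrite mevalB H subrr.
Qed.

Lemma mpoly_neq0P n (p : {mpoly k[n]}) : p != 0 -> exists v, p.@[v] != 0.
Proof.
move=> pn0; apply: NNPP => H; case/negP: pn0; apply/eqP/mpoly_ext0 => v.
by apply: NNPP => Hv; apply: H; exists v; apply/eqP.
Qed.

End Char0.

(** * Factoriality of polynomial rings *)

Section Factorial.
Variable R : idomainType.

Definition divides (p a : R) := exists q, a = p * q.

Definition prime_elt (p : R) :=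
  [/\ p != 0, p \isn't a GRing.unit &
      forall a b, divides p (a * b) -> divides p a \/ divides p b].

Definition irreducible_elt (f : R) :=
  [/\ f != 0, f \isn't a GRing.unit &
      forall g h, f = g * h -> g \is a GRing.unit \/ h \is a GRing.unit].

(** Asking for prime factors rather than irreducible ones carries the uniqueness of the
    factorization along. *)
Definition factors (x : R) := exists (u : R) (s : seq R),
  [/\ u \is a GRing.unit, forall p, p \in s -> prime_elt p & x = u * \prod_(p <- s) p].

Definition factorial_ring := forall x : R, x != 0 -> factors x.

Lemma divides_refl p : divides p p.
Proof. by exists 1; rewrite mulr1. Qed.

Lemma divides_mulr p a b : divides p a -> divides p (a * b).
Proof. by case=> q ->; exists (q * b); rewrite mulrA. Qed.

Lemma divides_mull p a b : divides p b -> divides p (a * b).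
Proof. by move=> H; rewrite mulrC; apply: divides_mulr. Qed.

Lemma prime_eltMu p u : prime_elt p -> u \is a GRing.unit -> prime_elt (p * u).
Proof.
move=> [p0 pu pP] uu; split=> [||a b].
- by rewrite mulf_neq0 //; apply: contraTneq uu => ->; rewrite unitr0.
- by rewrite unitrM negb_and pu.
have H c : divides (p * u) c <-> divides p c.
  split=> [[q ->]|[q ->]]; first by exists (u * q); rewrite mulrA.
  by exists (u^-1 * q); rewrite mulrA mulrK.
by rewrite !H; apply: pP.
Qed.

Lemma factors_mul x y : factors x -> factors y -> factors (x * y).
Proof.
move=> [u [s [uu sP ->]]] [v [t [vu tP ->]]]; exists (u * v), (s ++ t); split.
- by rewrite unitrM uu.
- by move=> p; rewrite mem_cat => /orP[/sP|/tP].
- by rewrite big_cat /= mulrACA.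
Qed.

Lemma factors_prime p : prime_elt p -> factors p.
Proof.
move=> pP; exists 1, [:: p]; split; rewrite ?unitr1 ?big_seq1 ?mul1r //.
by move=> q; rewrite inE => /eqP->.
Qed.

Lemma factors_unit u : u \is a GRing.unit -> factors u.
Proof. by move=> uu; exists u, [::]; rewrite big_nil mulr1. Qed.

Lemma irreducible_prime f : factorial_ring -> irreducible_elt f -> prime_elt f.
Proof.
move=> HR [f0 fu fI]; have [u [[|p s] [uu sP Ef]]] := HR f f0.
  by move: fu; rewrite Ef big_nil mulr1 uu.
have pP : prime_elt p by apply: sP; rewrite mem_head.
have E : f = p * (u * \prod_(q <- s) q) by rewrite Ef big_cons mulrCA.
case: (fI _ _ E) => [pu|?]; first by case: pP; rewrite pu.
by rewrite E; apply: prime_eltMu.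
Qed.

Lemma prime_divides_prod p (s : seq R) :
  prime_elt p -> divides p (\prod_(q <- s) q) -> exists2 q, q \in s & divides p q.
Proof.
move=> [p0 pu pP]; elim: s => [|q s IH].
  by rewrite big_nil => -[q Eq]; case/negP: pu; apply/unitrPr; exists q.
rewrite big_cons => /pP[pq|/IH[q' q's pq']]; first by exists q; rewrite ?mem_head.
by exists q'; rewrite // inE q's orbT.
Qed.

End Factorial.

Section PrimeBezout.
Variable R : idomainType.
Implicit Types F H : {poly R}.

(** Pseudo-division gives c F = s g and c' H = s' g for g = [gcdp F H]. By primality F divides s,
    which makes g constant by degrees, or it divides g, hence c' H, hence H. So g is constant, and
    its Bezout relation is the desired one. *)
Lemma prime_bezout F H :
  (forall a b, divides F (a * b) -> divides F a \/ divides F b) -> (1 < size F)%N ->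
  ~ divides F H -> exists x y (c : R), c != 0 /\ x * F + y * H = c%:P.
Proof.
move=> FP sF ndivH; have F0 : F != 0 by rewrite -size_poly_gt0 ltnW.
have ndivc (c : R) : c != 0 -> ~ divides F c%:P.
  move=> c0 [q E]; have q0 : q != 0.
    by apply: contraNneq c0 => q0; move/eqP: E; rewrite q0 mulr0 polyC_eq0.
  have := congr1 (fun p : {poly R} => size p) E; rewrite size_mul // size_polyC c0.
  by move: sF q0; rewrite -size_poly_gt0; move: (size F) (size q) => x y; lia.
have /Pdiv.WeakIdomain.dvdpP[[c s] /= c0 Ec] := dvdp_gcdl F H.
have /Pdiv.WeakIdomain.dvdpP[[c' s'] /= c'0 Ec'] := dvdp_gcdr F H.
have g0 : gcdp F H != 0 by rewrite gcdp_eq0 negb_and F0.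
have [[u1 u2] /= /Pdiv.CommonIdomain.eqpP[[d1 d2] /= /andP[d10 d20] Ed]] :=
    Pdiv.CommonIdomain.Bezoutp F H.
set g := gcdp F H in Ec Ec' Ed g0 *.
have s0 : s != 0.
  apply: contraNneq F0 => E; move/eqP: Ec; rewrite E mul0r -mul_polyC mulf_eq0 polyC_eq0.
  by rewrite (negPf c0).
have sg : size g = 1%N.
  have [|[q Eq]|[q Eq]] := FP s g.
  - by exists c%:P; rewrite -Ec -mul_polyC mulrC.
  - have q0 : q != 0 by apply: contraNneq s0 => E; rewrite Eq E mulr0.
    have := congr1 (fun p : {poly R} => size p) Ec.
    rewrite -mul_polyC size_mul ?polyC_eq0 // size_polyC c0 size_mul // Eq size_mul //.
    by move: sF q0 g0; rewrite -!size_poly_gt0; move: (size F) (size q) (size g) => x y z; lia.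
  - have [|/ndivc|//] := FP c'%:P H; last by case.
    by exists (s' * q); rewrite mul_polyC Ec' Eq mulrCA.
have /eqP/size_poly1P[y y0 Ey] := sg.
exists (d1%:P * u1), (d1%:P * u2), (d2 * y); split; first exact: mulf_neq0.
by rewrite polyCM -Ey (mul_polyC d2) -Ed -mul_polyC; ring.
Qed.

End PrimeBezout.

Section FactorialPoly.
Variable R : idomainType.
Hypothesis HR : factorial_ring R.
Local Notation RX := {poly R}.

Lemma divides_polyC (p : R) (f : RX) : divides p%:P f <-> forall i, divides p f`_i.
Proof.
split=> [[q ->] i|H].
  by rewrite coefCM; exists q`_i.
have [c cP] : exists c : nat -> R, forall i, (i < size f)%N -> f`_i = p * c i.
  elim: (size f) => [|n [c cP]]; first by exists (fun=> 0).
  have [q Eq] := H n; exists (fun i => if i == n then q else c i) => i.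
  by rewrite ltnS leq_eqVlt; case: eqP => [->|_] //= /cP.
exists (\poly_(i < size f) c i); apply/polyP => i.
rewrite coefCM coef_poly; case: ltnP => [/cP//|Hi].
by rewrite mulr0 nth_default.
Qed.

(** Gauss: if i and j are the first indices at which p fails to divide a and b, the coefficient of
    index i + j of a b is a_i b_j modulo p. *)
Lemma prime_elt_polyC (p : R) : prime_elt p -> prime_elt (p%:P : RX).
Proof.
move=> [p0 pu pP]; split=> [||a b Hab].
- by rewrite polyC_eq0.
- by rewrite poly_unitE coefC eqxx (negPf pu) andbF.
have [Ha|Ha] := classic (forall i, divides p a`_i); first by left; apply/divides_polyC.
have [Hb|Hb] := classic (forall i, divides p b`_i); first by right; apply/divides_polyC.
have minP (f : RX) : ~ (forall i, divides p f`_i) ->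
    exists i, ~ divides p f`_i /\ forall j, (j < i)%N -> divides p f`_j.
  move=> H; apply: NNPP => H'; apply: H => i.
  elim/ltn_ind: i => i IH; apply: NNPP => Hi; apply: H'; exists i; split=> //.
have [i [Hi Hi']] := minP _ Ha; have [j [Hj Hj']] := minP _ Hb.
have: divides p (a * b)`_(i + j) by move/divides_polyC: Hab.
rewrite coefM (bigD1 (inord i)) //= inordK ?ltnS ?leq_addr // addKn.
set S := \sum_(_ < _ | _) _ => -[q Eq].
have [q' Eq'] : divides p S.
  apply: (big_ind (divides p)) => [|_ _ [x ->] [y ->]|l Hl].
  - by exists 0; rewrite mulr0.
  - by exists (x + y); rewrite mulrDr.
  - have [lt_li|le_il] := ltnP l i; first by apply: divides_mulr; apply: Hi'.
    apply: divides_mull; apply: Hj'.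
    have lt_il : (i < l)%N.
      rewrite ltn_neqAle le_il andbT; apply: contraNneq Hl => E.
      by apply/eqP/val_inj; rewrite /= inordK -?E // ltnS leq_addr.
    by have := ltn_ord l; lia.
have /pP[] // : divides p (a`_i * b`_j).
by exists (q - q'); rewrite mulrBr -Eq -Eq' addrK.
Qed.

Lemma polyZI (c : R) : c != 0 -> injective ( *:%R c : RX -> RX).
Proof. by move=> c0 x y; rewrite -!mul_polyC; apply: mulfI; rewrite polyC_eq0. Qed.

(** The prime factors of c are cancelled one by one: each stays prime as a constant polynomial, so
    it divides p or q, and removing it does not change degrees. *)
Lemma gauss_split (c : R) (f p q : RX) : c != 0 -> p != 0 -> q != 0 -> c *: f = p * q ->
  exists p' q' : RX, [/\ f = p' * q', size p' = size p & size q' = size q].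
Proof.
move=> c0; have [u [s [uu sP Ec]]] := HR c0; rewrite {c c0}Ec.
elim: s sP f p q => [|c s IH] sP f p q p0 q0 Ef.
  exists (u^-1 *: p), q; rewrite -scalerAl -Ef scalerA big_nil mulr1 mulVr // scale1r.
  by split=> //; rewrite size_scale //; apply: contraTneq uu => E; rewrite -unitrV E unitr0.
have cP := sP _ (mem_head _ _); have [c0 _ _] := cP.
have {}IH := IH (fun x xs => sP x (mem_behead (s := c :: s) xs)).
have {}Ef : c *: ((u * \prod_(q <- s) q) *: f) = p * q.
  by rewrite -Ef scalerA big_cons mulrCA.
have [_ _ cP'] := prime_elt_polyC cP.
have cI : injective ( *:%R c : RX -> RX) by exact: polyZI.
have sz x y : x = c%:P * y -> (size x = size y) * ((x != 0) = (y != 0)).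
  by move->; rewrite mul_polyC size_scale // -mul_polyC mulf_eq0 polyC_eq0 (negPf c0).
case: (cP' p q) => [|[p' Ep]|[q' Eq]].
- by rewrite -Ef -mul_polyC; apply: divides_mulr; apply: divides_refl.
- have [||p1 [q1 [E1 S1 S2]]] := IH f p' q _ q0.
  + by rewrite -(sz _ _ Ep).
  + by apply: cI; rewrite Ef Ep mul_polyC scalerAl.
  by exists p1, q1; rewrite (sz _ _ Ep).
- have [||p1 [q1 [E1 S1 S2]]] := IH f p q' p0.
  + by rewrite -(sz _ _ Eq).
  + by apply: cI; rewrite Ef Eq mul_polyC scalerAr.
  by exists p1, q1; rewrite (sz _ _ Eq).
Qed.

Definition primitive_poly (f : RX) := forall p : R, prime_elt p -> ~ divides p%:P f.

(** Same cancellation as in [gauss_split]; a prime factor of c cannot divide the primitive f, so it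
    is always taken from q. *)
Lemma gauss_divides (c : R) (f h q : RX) :
  primitive_poly f -> c != 0 -> c *: h = f * q -> divides f h.
Proof.
move=> fP c0; have [u [s [uu sP Ec]]] := HR c0; rewrite {c c0}Ec.
elim: s sP h q => [|c s IH] sP h q Eh.
  exists (u^-1 *: q); rewrite -scalerAr -Eh scalerA big_nil mulr1 mulVr //.
  by rewrite scale1r.
have cP := sP _ (mem_head _ _); have [c0 _ _] := cP.
have {}IH := IH (fun x xs => sP x (mem_behead (s := c :: s) xs)).
have {}Eh : c *: ((u * \prod_(q <- s) q) *: h) = f * q.
  by rewrite -Eh scalerA big_cons mulrCA.
have [_ _ cP'] := prime_elt_polyC cP.
case: (cP' f q) => [|Hf|[q' Eq]].
- by rewrite -Eh -mul_polyC; apply: divides_mulr; apply: divides_refl.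
- by case: (fP _ cP).
apply: (IH h q'); apply: (polyZI c0); rewrite Eh Eq mul_polyC -scalerAr //.
Qed.

(** By [gauss_split] the pseudo-gcd of f and a yields a true factorization of f of the same degrees.
    Irreducibility makes one factor constant: either the cofactor, and then f divides a, or the gcd,
    and then its Bezout relation multiplied by b shows that f divides b. *)
Lemma primitive_irreducible_prime (f : RX) :
  primitive_poly f -> irreducible_elt f -> (1 < size f)%N -> prime_elt f.
Proof.
move=> fP [f0 fu fI] sf; split=> // a b [g Eab].
have [->|a0] := eqVneq a 0; first by left; exists 0; rewrite mulr0.
have /Pdiv.WeakIdomain.dvdpP[[c s] /= c0 Ec] := dvdp_gcdl f a.
have /Pdiv.WeakIdomain.dvdpP[[c' v] /= c'0 Ec'] := dvdp_gcdr f a.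
have pi0 : gcdp f a != 0 by rewrite gcdp_eq0 negb_and f0.
have s0 : s != 0.
  by apply: contraTneq f0 => E; rewrite E mul0r in Ec; move/eqP: Ec;
     rewrite -mul_polyC mulf_eq0 polyC_eq0 (negPf c0) /= => ->.
have [s' [p' [Ef Ss Sp]]] := gauss_split c0 s0 pi0 Ec.
case: (fI _ _ Ef); rewrite poly_unitE => /andP[/size_poly1P[x x0 Ex] _].
- have /eqP/size_poly1P[y y0 Ey] : size s = 1%N by rewrite -Ss Ex size_polyC x0.
  left; apply: (gauss_divides (c := y * c') (q := c *: v) fP); first exact: mulf_neq0.
  by rewrite -scalerA Ec' -[y *: _]mul_polyC mulrCA -Ey -Ec -!mul_polyC; ring.
- have /eqP/size_poly1P[y y0 Ey] : size (gcdp f a) = 1%N by rewrite -Sp Ex size_polyC x0.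
  have [[u1 u2] /= /Pdiv.CommonIdomain.eqpP[[d1 d2] /= /andP[d10 d20] Ed]] :=
    Pdiv.CommonIdomain.Bezoutp f a.
  right; apply: (gauss_divides (c := d2 * y) (q := d1 *: (u1 * b + u2 * g)) fP).
    exact: mulf_neq0.
  rewrite -[_ *: b]mul_polyC polyCM -Ey mul_polyC -Ed -!mul_polyC.
  transitivity (d1%:P * (u1 * f * b + u2 * (a * b))); first by ring.
  by rewrite Eab; ring.
Qed.

Lemma prime_factor (c : R) : c != 0 -> c \isn't a GRing.unit ->
  exists2 p, prime_elt p & divides p c.
Proof.
move=> c0 cu; have [u [[|p s] [uu sP Ec]]] := HR c0.
  by case/negP: cu; rewrite Ec big_nil mulr1.
exists p; first exact: sP (mem_head _ _).
by rewrite Ec big_cons mulrCA; apply/divides_mulr/divides_refl.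
Qed.

(** Induction on the size of f, and inside it on the number of prime factors of the leading
    coefficient. The inner induction extracts constant primes until f is primitive. *)
Lemma factorial_poly : factorial_ring {poly R}.
Proof.
move=> f; have [n le_n] := ubnP (size f); elim: n => // n IHn in f le_n *.
move=> f0; have lf0 : lead_coef f != 0 by rewrite lead_coef_eq0.
have [u [s [uu sP Elf]]] := HR lf0.
have [l le_l] := ubnP (size s).
elim: l => // l IHl in f s u le_l uu sP Elf le_n f0 lf0 *.
have [Hprim|Hprim] := classic (primitive_poly f); last first.
  have [p [pP [f' Ef]]] : exists p : R, prime_elt p /\ divides p%:P f.
    by apply: NNPP => H; apply: Hprim => p pP pf; apply: H; exists p.
  have [p0 pu pP'] := pP.
  have Elf' : lead_coef f = p * lead_coef f' by rewrite Ef mul_polyC lead_coefZ.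
  have : divides p (u * \prod_(q <- s) q) by rewrite -Elf Elf'; exists (lead_coef f').
  case/pP' => [[q Eq]|]; first by case/negP: pu; move: uu; rewrite Eq unitrM => /andP[].
  case/(prime_divides_prod pP) => q qs [e Eq].
  (* q is prime and p is not a unit, so p and q are associated; dividing f by p removes q from the
     factors of the leading coefficient. *)
  have eu : e \is a GRing.unit.
    have [q0 qu qP] := sP _ qs.
    case: (qP p e) => [|[x Ex]|[x Ex]]; first by rewrite -Eq; apply: divides_refl.
      have : q * (1 - x * e) = 0 by rewrite mulrBr mulr1 mulrA -Ex -Eq subrr.
      move/eqP; rewrite mulf_eq0 (negPf q0) subr_eq0 /= => /eqP E1.
      by apply/unitrP; exists x; rewrite [e * x]mulrC -E1.
    have : q * (1 - x * p) = 0.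
      by rewrite mulrBr mulr1 mulrA -Ex mulrC -Eq subrr.
    move/eqP; rewrite mulf_eq0 (negPf q0) subr_eq0 /= => /eqP E1.
    by case/negP: pu; apply/unitrP; exists x; rewrite [p * x]mulrC -E1.
  rewrite Ef; apply: factors_mul; first exact/factors_prime/prime_elt_polyC.
  have f'0 : f' != 0 by apply: contraNneq f0 => E; rewrite Ef E mulr0.
  apply: (IHl f' (rem q s) (u * e)) => //.
  - by rewrite size_rem //; case: (s) qs le_l.
  - by rewrite unitrM uu.
  - by move=> x xs; apply: sP; apply: mem_rem xs.
  - apply: (mulfI p0); rewrite -Elf' Elf (perm_big _ (perm_to_rem qs)) big_cons Eq /=.
    by ring.
  - by move: le_n; rewrite Ef mul_polyC size_scale.
  - by rewrite lead_coef_eq0.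
have [fu|fu] := boolP (f \is a GRing.unit); first exact: factors_unit.
(* A nonunit constant factor would contain a prime dividing f, against primitivity. So both factors
   of a proper factorization have positive degree, hence smaller size than f. *)
have nonc a b : f = a * b -> a \isn't a GRing.unit -> (1 < size a)%N.
  move=> E au; rewrite ltnNge; apply/negP => /size1_polyC Ea.
  have c0 : a`_0 != 0 by apply: contraNneq f0 => E0; rewrite E Ea E0 mul0r.
  have [|p pP [q Eq]] := prime_factor c0.
    by move: au; rewrite Ea poly_unitE size_polyC c0 coefC.
  apply: (Hprim p pP); rewrite E Ea Eq polyCM -mulrA.
  exact/divides_mulr/divides_refl.
have sf : (1 < size f)%N by apply: (nonc f 1); rewrite ?mulr1.
have [fI|] := classic (forall g h, f = g * h -> g \is a GRing.unit \/ h \is a GRing.unit).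
  by apply: factors_prime; apply: primitive_irreducible_prime.
move=> H; have [g [h [Ef gu hu]]] :
    exists g h : RX, [/\ f = g * h, g \isn't a GRing.unit & h \isn't a GRing.unit].
  apply: NNPP => H'; apply: H => g h Ef; apply: NNPP => H''; apply: H'; exists g, h.
  by split=> //; apply/negP => X; apply: H''; [left|right].
have sg := nonc _ _ Ef gu; have sh : (1 < size h)%N by apply: (nonc _ g) => //; rewrite mulrC.
have g0 : g != 0 by rewrite -size_poly_gt0 ltnW.
have h0 : h != 0 by rewrite -size_poly_gt0 ltnW.
have szf := size_mul g0 h0; rewrite -Ef in szf.
by rewrite Ef; apply: factors_mul; apply: IHn => //; lia.
Qed.

End FactorialPoly.

Section FactorialMPoly.

Lemma factorial_transport (R S : idomainType) (F : {rmorphism R -> S}) (G : S -> R) :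
  cancel F G -> cancel G F -> factorial_ring S -> factorial_ring R.
Proof.
move=> FK GK HS x x0.
have Finj : injective F := can_inj FK.
have unitF y : (F y \is a GRing.unit) = (y \is a GRing.unit).
  apply/idP/idP => [|/(rmorph_unit F)//]; move=> /unitrP[z [z1 z2]].
  by apply/unitrP; exists (G z); split; apply: Finj; rewrite rmorphM rmorph1 GK.
have F0 y : (F y == 0) = (y == 0) by rewrite -(inj_eq Finj) rmorph0.
have divF p a : divides (F p) (F a) <-> divides p a.
  split=> [[q E]|[q ->]]; last by exists (F q); rewrite rmorphM.
  by exists (G q); apply: Finj; rewrite rmorphM GK.
have [|u [s [uu sP Ex]]] := HS (F x); first by rewrite F0.
exists (G u), (map G s); split.
- by rewrite -unitF GK.
- move=> _ /mapP[p /sP[p0 pu pP] ->]; split; rewrite -?F0 -?unitF ?GK //.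
  by move=> a b; rewrite -!divF !GK rmorphM; apply: pP.
- by apply: Finj; rewrite rmorphM GK Ex big_map rmorph_prod; congr (_ * _);
    apply: eq_bigr => i _; rewrite GK.
Qed.

Lemma factorial_mpoly (k : fieldType) n : factorial_ring {mpoly k[n]}.
Proof.
elim: n => [|n IH].
  move=> x x0; apply: factors_unit; rewrite [x]nvar0_mpolyC.
  by apply: rmorph_unit; rewrite unitfE; apply: contraNneq x0 => E;
     rewrite [x]nvar0_mpolyC E mpolyC0.
exact: (factorial_transport (@muniK n k) (@of_muniK n k) (factorial_poly IH)).
Qed.

End FactorialMPoly.

(** * Genericity *)

Section Polyfun.
Variables (k : fieldType) (T J : Type) (x : J -> T -> k).
Implicit Types h : T -> k.

Lemma polyfun_const a : polyfun x (fun=> a).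
Proof.
have f : 'I_0 -> J by case.
exists 0, f, a%:MP.
by move=> D; rewrite mevalC.
Qed.

Lemma polyfun_coord j : polyfun x (x j).
Proof. by exists 1, (fun=> j), 'X_ord0 => D; rewrite mevalXU. Qed.

Lemma polyfun_pair h1 h2 : polyfun x h1 -> polyfun x h2 ->
  exists s (c : 'I_s -> J) (p1 p2 : {mpoly k[s]}),
    (forall D, h1 D = p1.@[fun l => x (c l) D]) /\ (forall D, h2 D = p2.@[fun l => x (c l) D]).
Proof.
move=> [s1 [c1 [p1 H1]]] [s2 [c2 [p2 H2]]].
exists (s1 + s2)%N, (fun l => match split l with inl a => c1 a | inr b => c2 b end).
exists (p1 \mPo [tuple 'X_(lshift s2 i) | i < s1]), (p2 \mPo [tuple 'X_(rshift s1 i) | i < s2]).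
split=> D; rewrite comp_mpoly_meval ?H1 ?H2; apply: meval_eq => i;
  rewrite tnth_mktuple mevalXU; case: splitP => j /= E.
- by congr (x (c1 _) D); apply/val_inj.
- by have := ltn_ord i; lia.
- by have := ltn_ord j; lia.
- by congr (x (c2 _) D); apply/val_inj; rewrite /=; lia.
Qed.

Lemma polyfun_add h1 h2 : polyfun x h1 -> polyfun x h2 -> polyfun x (fun D => h1 D + h2 D).
Proof.
move=> H1 H2; have [s [c [p1 [p2 [E1 E2]]]]] := polyfun_pair H1 H2.
by exists s, c, (p1 + p2) => D; rewrite mevalD E1 E2.
Qed.

Lemma polyfun_mul h1 h2 : polyfun x h1 -> polyfun x h2 -> polyfun x (fun D => h1 D * h2 D).
Proof.
move=> H1 H2; have [s [c [p1 [p2 [E1 E2]]]]] := polyfun_pair H1 H2.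
by exists s, c, (p1 * p2) => D; rewrite mevalM E1 E2.
Qed.

Lemma polyfun_ext h1 h2 : (forall D, h1 D = h2 D) -> polyfun x h1 -> polyfun x h2.
Proof. by move=> E [s [c [p H]]]; exists s, c, p => D; rewrite -E. Qed.

(** Agreement is asked on X only, because degree bounds such as those in [polyfunm] hold only
    there. *)
Definition polyfun_on (X : T -> Prop) h :=
  exists2 h', polyfun x h' & forall D, X D -> h D = h' D.

Variable X : T -> Prop.

Lemma polyfun_onW h : polyfun x h -> polyfun_on X h.
Proof. by exists h. Qed.

Lemma polyfun_on_ext h1 h2 :
  (forall D, X D -> h1 D = h2 D) -> polyfun_on X h1 -> polyfun_on X h2.
Proof. by move=> E [h H E']; exists h => // D XD; rewrite -E // E'. Qed.

Lemma polyfun_on_const a : polyfun_on X (fun=> a).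
Proof. exact/polyfun_onW/polyfun_const. Qed.

Lemma polyfun_on_add h1 h2 :
  polyfun_on X h1 -> polyfun_on X h2 -> polyfun_on X (fun D => h1 D + h2 D).
Proof.
move=> [g1 G1 E1] [g2 G2 E2]; exists (fun D => g1 D + g2 D); first exact: polyfun_add.
by move=> D XD; rewrite E1 ?E2.
Qed.

Lemma polyfun_on_mul h1 h2 :
  polyfun_on X h1 -> polyfun_on X h2 -> polyfun_on X (fun D => h1 D * h2 D).
Proof.
move=> [g1 G1 E1] [g2 G2 E2]; exists (fun D => g1 D * g2 D); first exact: polyfun_mul.
by move=> D XD; rewrite E1 ?E2.
Qed.

Lemma polyfun_on_sum (I : Type) (r : seq I) (P : pred I) (F : I -> T -> k) :
  (forall i, polyfun_on X (F i)) -> polyfun_on X (fun D => \sum_(i <- r | P i) F i D).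
Proof.
move=> H; elim: r => [|i r IH].
  by apply: polyfun_on_ext (polyfun_on_const 0) => D _; rewrite big_nil.
have [Pi|Pi] := boolP (P i).
  by apply: polyfun_on_ext (polyfun_on_add (H i) IH) => D _; rewrite big_cons Pi.
by apply: polyfun_on_ext IH => D _; rewrite big_cons (negPf Pi).
Qed.

Lemma polyfun_on_det n (A : T -> 'M[k]_n) :
  (forall i j, polyfun_on X (fun D => A D i j)) -> polyfun_on X (fun D => \det (A D)).
Proof.
move=> H; rewrite /determinant; apply: polyfun_on_sum => s.
apply: polyfun_on_mul; first exact: polyfun_on_const.
elim: (index_enum _) => [|i r IH].
  by apply: polyfun_on_ext (polyfun_on_const 1) => D _; rewrite big_nil.
  by apply: polyfun_on_ext (polyfun_on_mul (H i (s i)) IH) => D _; rewrite big_cons.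
Qed.

Lemma zopen_polyfun (W : T -> Prop) D0 : zopen x W -> W D0 ->
  exists h, [/\ polyfun x h, h D0 != 0 & forall D, h D != 0 -> W D].
Proof.
move=> [S [HS WS]] /WS[h Sh h0]; exists h; split=> // [|D hD]; first exact: HS.
by apply/WS; exists h.
Qed.

Lemma zopen_neq0 h : polyfun x h -> zopen x (fun D => h D != 0).
Proof.
move=> H; exists (fun g => g = h); split=> [g ->//|D].
by split=> [hD|[g -> //]]; exists h.
Qed.

Lemma zopenI U V : zopen x U -> zopen x V -> zopen x (fun D => U D /\ V D).
Proof.
move=> [S [HS US]] [S' [HS' VS']].
exists (fun h => exists g g', [/\ S g, S' g' & forall D, h D = g D * g' D]); split.
  move=> h [g [g' [Sg S'g' E]]]; apply: (@polyfun_ext (fun D => g D * g' D)) => //.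
  by apply: polyfun_mul; [apply: HS|apply: HS'].
move=> D; split=> [[/US[g Sg gD] /VS'[g' S'g' g'D]]|].
  by exists (fun D => g D * g' D); [exists g, g'|rewrite mulf_neq0].
move=> [h [g [g' [Sg S'g' E]]]]; rewrite E mulf_eq0 negb_or => /andP[gD g'D].
by split; [apply/US; exists g|apply/VS'; exists g'].
Qed.

(* The witness is the interior of [Good] relative to X. *)
Lemma generically_intro (Good : T -> Prop) :
  (forall D0 W, X D0 -> zopen x W -> W D0 -> exists D1, [/\ X D1, W D1 &
     exists h, [/\ polyfun x h, h D1 != 0 & forall D, X D -> h D != 0 -> Good D]]) ->
  generically_in x X Good.
Proof.
move=> H; pose S h := polyfun x h /\ forall D, X D -> h D != 0 -> Good D.
exists (fun D => exists2 h, S h & h D != 0); split; last first.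
  by move=> D XD [h [_ hG] hD]; apply: hG.
split; first by exists S; split=> [h []|].
move=> W HW [D0 [XD0 WD0]]; have [D1 [X1 W1 [h [ph hD1 hG]]]] := H D0 W XD0 HW WD0.
by exists D1; split=> //; exists h.
Qed.

Lemma generically_and P Q :
  generically_in x X P -> generically_in x X Q -> generically_in x X (fun D => P D /\ Q D).
Proof.
move=> [U [[oU dU] UP]] [V [[oV dV] VQ]]; exists (fun D => U D /\ V D); split.
  split=> [|W oW XW]; first exact: zopenI.
  have [D1 [X1 W1 U1]] := dU W oW XW.
  have [||D [XD [WD UD] VD]] := dV (fun D => W D /\ U D); first exact: zopenI.
    by exists D1.
  by exists D.
by move=> D XD [UD VD]; split; [apply: UP|apply: VQ].
Qed.

Lemma generically_impl (P Q : T -> Prop) : (forall D, X D -> P D -> Q D) ->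
  generically_in x X P -> generically_in x X Q.
Proof. by move=> PQ [U [dU UP]]; exists U; split=> // D XD /(UP _ XD)/(PQ _ XD). Qed.

Lemma polyfun_line (L : k -> T) :
  (forall j, exists p : {poly k}, forall c, x j (L c) = p.[c]) ->
  forall h, polyfun x h -> exists p : {poly k}, forall c, h (L c) = p.[c].
Proof.
move=> HL h [s [c [q Hh]]].
have [p Hp] := fin_all_exists (fun l => HL (c l)).
exists (mmap polyC p q) => a; rewrite Hh.
elim/mpoly_ringind: q {Hh} => [b|i|q1 q2 H1 H2|q1 q2 H1 H2].
- by rewrite mevalC mmapC hornerC.
- by rewrite mevalXU mmapX mmap1U Hp.
- by rewrite mevalD mmapD hornerD H1 H2.
- by rewrite mevalM rmorphM hornerM H1 H2.
Qed.

(** Both functions restrict to nonzero polynomials on the line, and so does their product. This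
    takes the place of irreducibility of the space of data. *)
Lemma line_meets (L : k -> T) h h' (c c' : k) : [pchar k] =i pred0 ->
  (forall j, exists p : {poly k}, forall c, x j (L c) = p.[c]) ->
  polyfun x h -> polyfun x h' -> h (L c) != 0 -> h' (L c') != 0 ->
  exists e, h (L e) != 0 /\ h' (L e) != 0.
Proof.
move=> char0 HL /(polyfun_line HL)[p Hp] /(polyfun_line HL)[q Hq] Hc Hc'.
have pq0 : p * q != 0.
  rewrite mulf_neq0 //; first by apply: contraNneq Hc => E; rewrite Hp E horner0.
  by apply: contraNneq Hc' => E; rewrite Hq E horner0.
apply: NNPP => H; case/negP: pq0; apply/eqP/(poly_ext0 char0) => e.
apply: NNPP => /eqP; rewrite hornerM mulf_eq0 negb_or => /andP[pe qe].
by apply: H; exists e; rewrite Hp Hq.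
Qed.

End Polyfun.

(** * Triviality of a kernel as an open condition *)

Section TrivialKernel.
Variables (k : fieldType) (T J : Type) (x : J -> T -> k) (X : T -> Prop).

(** Independent functionals are added one at a time: as long as there are fewer than q, some nonzero
    vector is killed by all of them, and a member of the family that does not kill it is independent
    of the previous ones. *)
Lemma functional_basis q (Theta : Type) (b : Theta -> 'rV[k]_q) :
  (forall xi : 'cV_q, (forall th, b th *m xi = 0) -> xi = 0) ->
  exists th : 'I_q -> Theta, \matrix_i b (th i) \in unitmx.
Proof.
move=> H; have key j : (j <= q)%N ->
    exists2 M : 'M[k]_(j, q), row_free M & forall i, exists th, row i M = b th; last first.
  have [M fM rM] := key q (leqnn q).
  have [th Hth] := fin_all_exists rM; exists th; rewrite -row_free_unit.
  suff -> : \matrix_i b (th i) = M by [].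
  by apply/row_matrixP => i; rewrite rowK Hth.
elim: j => [|j IH] lt_jq.
  by exists 0 => [|[]//]; rewrite -row_leq_rank.
have [M fM rM] := IH (ltnW lt_jq).
have [xi [Mxi xi0]] : exists xi : 'cV_q, M *m xi = 0 /\ xi != 0.
  have : cokermx M != 0 by rewrite -mxrank_eq0 mxrank_coker (eqP fM) subn_eq0 -ltnNge.
  move=> c0; have [i ci] : exists i, col i (cokermx M) != 0.
    apply: NNPP => Hn; case/negP: c0; apply/eqP/matrixP => a i.
    have : col i (cokermx M) = 0 by apply: NNPP => /eqP ?; apply: Hn; exists i.
    by move=> /colP/(_ a); rewrite !mxE.
  by exists (col i (cokermx M)); rewrite colE mulmxA mulmx_coker mul0mx -colE.
have [th Hth] : exists th, b th *m xi != 0.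
  by apply: NNPP => Hn; case/eqP: xi0; apply: H => th; apply: NNPP => /eqP ?; apply: Hn; exists th.
rewrite -addn1; exists (col_mx M (b th)); last first.
  move=> i; case: (splitP i) => l El.
    have [t Ht] := rM l; exists t; have -> : i = lshift 1 l by apply/val_inj.
    by rewrite rowKu.
  exists th; rewrite (ord1 l) addn0 in El; have -> : i = rshift j 0 by apply/val_inj; rewrite /= El addn0.
  by rewrite rowKd; apply/rowP => a; rewrite mxE.
apply: inj_row_free => v; rewrite -[v]hsubmxK mul_row_col => Hv.
have v2 : rsubmx v = 0.
  have := congr1 (mulmx^~ xi) Hv; rewrite /= mulmxDl -!mulmxA Mxi mulmx0 add0r mul0mx.
  rewrite [b th *m xi]mx11_scalar mul_mx_scalar => /eqP; rewrite scaler_eq0 => /orP[/eqP E|/eqP//].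
  by move: Hth; rewrite [_ *m _]mx11_scalar E raddf0 eqxx.
move: Hv; rewrite v2 mul0mx addr0 => /(congr1 (mulmx^~ (pinvmx M))) /=.
by rewrite mul0mx mulmxKp // => ->; rewrite row_mx0.
Qed.

(** The family of equations may be infinite, but as many of them as there are unknowns already have
    trivial kernel at [D0]; their determinant is the open condition. *)
Lemma open_trivial_kernel (I : finType) (Theta : Type) (b : Theta -> T -> I -> k) D0 :
  (forall th i, polyfun_on x X (fun D => b th D i)) -> X D0 ->
  (forall xi : I -> k, (forall th, \sum_i b th D0 i * xi i = 0) -> forall i, xi i = 0) ->
  exists h, [/\ polyfun x h, h D0 != 0 & forall D, X D -> h D != 0 ->
    forall xi : I -> k, (forall th, \sum_i b th D i * xi i = 0) -> forall i, xi i = 0].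
Proof.
move=> Hb XD0 H0.
pose q := #|I|; pose B D th : 'rV[k]_q := \row_i b th D (enum_val i).
have BE D th (xi : 'cV_q) : B D th *m xi = 0 <-> \sum_i b th D i * xi (enum_rank i) 0 = 0.
  have E : (B D th *m xi) 0 0 = \sum_i b th D i * xi (enum_rank i) 0.
    rewrite mxE (reindex (@enum_rank I)) /=; last by apply: onW_bij; apply: enum_rank_bij.
    by apply: eq_bigr => i _; rewrite mxE enum_rankK.
  split=> [E0|E0]; first by rewrite -E E0 mxE.
  by apply/matrixP => a c; rewrite !ord1 E E0 mxE.
have [|th Hth] := @functional_basis q Theta (B D0).
  move=> xi Hxi; apply/colP => i; rewrite mxE -[i]enum_valK.
  by apply: (H0 (fun j => xi (enum_rank j) 0)) => th; apply/BE.
have [h ph Eh] : polyfun_on x X (fun D => \det (\matrix_i B D (th i))).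
  apply: polyfun_on_det => i j.
  by apply: polyfun_on_ext (Hb (th i) (enum_val j)) => D _; rewrite !mxE.
exists h; split=> // [|D XD]; first by rewrite -Eh // -unitfE -unitmxE.
rewrite -Eh // -unitfE -unitmxE => uD xi Hxi.
pose v : 'cV_q := \col_i xi (enum_val i).
suff v0 : v = 0 by move=> i; move/colP/(_ (enum_rank i)): v0; rewrite !mxE enum_rankK.
apply: (can_inj (mulKmx uD)); rewrite mulmx0; apply/row_matrixP => i.
rewrite row_mul rowK row0; apply/BE; rewrite -[RHS](Hxi (th i)).
by apply: eq_bigr => j _; rewrite mxE enum_rankK.
Qed.

End TrivialKernel.

(** * Ruppert's irreducibility criterion *)

Section Ruppert.
Variable k : fieldType.
Hypothesis char0 : [pchar k] =i pred0.

Lemma natr_eq0 n : (n%:R == 0 :> k) = (n == 0%N).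
Proof. exact: ((pcharf0P k).1 char0). Qed.

Lemma coefM_top (R : nzRingType) (p q : {poly R}) a b :
  (size p <= a.+1)%N -> (size q <= b.+1)%N -> (p * q)`_(a + b) = p`_a * q`_b.
Proof.
move=> sp sq; rewrite coefM (bigD1 (inord a)) //= inordK ?ltnS ?leq_addr // addKn.
rewrite big1 ?addr0 // => i Hi; have [lt_ia|] := ltnP i a.
  rewrite [q`_ _]nth_default ?mulr0 //.
  by apply: leq_trans sq _; lia.
rewrite leq_eqVlt => /orP[/eqP E|lt_ai]; last by rewrite nth_default ?mul0r //; exact: leq_trans sp _.
by case/eqP: Hi; apply: val_inj; rewrite /= inordK -?E // ltnS leq_addr.
Qed.

Lemma size_polyBle (p q : {poly k}) : (size (p - q)%R <= maxn (size p) (size q))%N.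
Proof. by apply: leq_trans (size_polyD _ _) _; rewrite size_polyN. Qed.

Lemma deriv0_size (p : {poly k}) : p^`() = 0 -> (size p <= 1)%N.
Proof.
move=> E; apply/leq_sizeP => -[//|j] _; have := congr1 (fun q : {poly k} => q`_j) E.
by rewrite coef_deriv coef0 => /eqP; rewrite -mulr_natr mulf_eq0 natr_eq0 orbF => /eqP.
Qed.

(** The leading coefficients of p u' and p' u differ by the factors deg u and deg p, so in
    characteristic 0 the degrees agree. *)
Lemma wronskian0_size (p u : {poly k}) : p != 0 -> u != 0 -> p * u^`() = p^`() * u ->
  size u = size p.
Proof.
move=> p0 u0 E; have sp0 : (0 < size p)%N by rewrite size_poly_gt0.
have su0 : (0 < size u)%N by rewrite size_poly_gt0.
have [su|su] := leqP (size u) 1.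
  have /size1_polyC Eu := su; move: E; rewrite {1}Eu derivC mulr0 => /esym/eqP.
  by rewrite mulf_eq0 (negPf u0) orbF => /eqP/deriv0_size; lia.
have [sp|sp] := leqP (size p) 1.
  have /size1_polyC Ep := sp; move: E; rewrite {2}Ep derivC mul0r => /eqP.
  by rewrite mulf_eq0 (negPf p0) => /eqP/deriv0_size; lia.
pose a := (size p).-2; pose b := (size u).-2.
have Ea : size p = a.+2 by rewrite /a; lia.
have Eb : size u = b.+2 by rewrite /b; lia.
have Hd (q : {poly k}) c : size q = c.+2 -> (size q^`() <= c.+1)%N.
  by move=> Eq; rewrite -ltnS -Eq lt_size_deriv // -size_poly_gt0 Eq.
have := congr1 (fun q : {poly k} => q`_(a.+1 + b)) E.
rewrite (@coefM_top _ p _ a.+1 b) ?Hd //; last by rewrite Ea.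
rewrite addSnnS.
rewrite (@coefM_top _ _ u a b.+1) ?Hd //; last by rewrite Eb.
rewrite !coef_deriv.
have la : p`_a.+1 != 0 by have := p0; rewrite -lead_coef_eq0 lead_coefE Ea.
have lb : u`_b.+1 != 0 by have := u0; rewrite -lead_coef_eq0 lead_coefE Eb.
rewrite -[u`_ _ *+ _]mulr_natr -[p`_ _ *+ _]mulr_natr mulrA mulrAC => /(mulIf lb).
by move/(mulfI la)/(natr_inj0 char0); rewrite Ea Eb => <-.
Qed.

Lemma wronskian0_colinear (p u : {poly k}) : p != 0 -> p * u^`() = p^`() * u ->
  exists c, u = c *: p.
Proof.
move=> p0 E; have [->|u0] := eqVneq u 0; first by exists 0; rewrite scale0r.
have Es := wronskian0_size p0 u0 E.
pose c := lead_coef u / lead_coef p; exists c; apply/eqP; rewrite -subr_eq0.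
(* u - c p solves the same equation, so if nonzero it has the size of p; but c cancels the leading
   terms. *)
apply: contraTT isT => v0; suff : (size (u - c *: p)%R < size u)%N.
  rewrite Es (wronskian0_size p0 v0) ?ltnn // derivB derivZ.
  by rewrite mulrBr mulrBr E -!mul_polyC; ring.
have lp : lead_coef p != 0 by rewrite lead_coef_eq0.
have lu : lead_coef u != 0 by rewrite lead_coef_eq0.
have c0 : c != 0 by rewrite mulf_neq0 ?invr_eq0.
have su0 : (0 < size u)%N by rewrite size_poly_gt0.
rewrite -(prednK su0) ltnS; apply/leq_sizeP => j; rewrite leq_eqVlt => /orP[/eqP<-|lt_j].
  rewrite coefB coefZ {2}Es -!lead_coefE.
  by rewrite /c mulfVK // subrr.
have su : (size u <= j)%N by apply: leq_trans (leqSpred _) lt_j.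
by rewrite coefB coefZ !nth_default ?mulr0 ?subr0 -?Es.
Qed.

(** Eliminating w leaves mu u'/u = (mu - i - 1) q'/q + (i + 1) p'/p. At rho, a simple root of q and
    not a root of p, the order o of a nonzero u would satisfy mu o = mu - i - 1, a number strictly
    between 0 and mu. *)
Lemma ruppert_low (p q u w : {poly k}) mu i rho : (i.+1 < mu)%N ->
  p.[rho] != 0 -> root q rho -> q^`().[rho] != 0 ->
  q * (u^`() - i.+1%:R * w) = q^`() * u ->
  p * (u^`() - i.+1%:R * w) = p^`() * u - mu%:R * p * w -> u = 0 /\ w = 0.
Proof.
move=> lt_i prho qrho q'rho E1 E2.
have p0 : p != 0 by apply: contraNneq prho => ->; rewrite horner0.
have q0 : q != 0 by apply: contraNneq q'rho => ->; rewrite derivC horner0.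
have mu0 : (mu%:R : {poly k}) != 0 by rewrite -polyC_natr polyC_eq0 natr_eq0; lia.
have D : mu%:R * p * q * u^`() = ((mu - i.+1)%:R * p * q^`() + i.+1%:R * q * p^`()) * u.
  rewrite natrB; last lia.
  set t := u^`() - i.+1%:R * w in E1 E2.
  have Ew : mu%:R * p * w = p^`() * u - p * t by rewrite E2; ring.
  have -> : u^`() = t + i.+1%:R * w by rewrite /t; ring.
  transitivity (mu%:R * p * (q * t) + i.+1%:R * q * (mu%:R * p * w)); first by ring.
  rewrite Ew.
  transitivity (mu%:R * p * (q * t) + i.+1%:R * (q * p^`() * u - p * (q * t))); first by ring.
  by rewrite E1; ring.
suff u0 : u = 0.
  split=> //; move: E2; rewrite u0 deriv0 sub0r mulr0 sub0r => E2.
  have : (mu - i.+1)%:R * p * w = 0.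
    rewrite natrB; last lia.
    transitivity (p * - (i.+1%:R * w) - - (mu%:R * p * w)); first by ring.
    by rewrite E2 subrr.
  move/eqP; rewrite !mulf_eq0 (negPf p0) -polyC_natr polyC_eq0 natr_eq0 subn_eq0.
  by rewrite leqNgt lt_i => /eqP.
apply: contraTeq isT => u0.
have [o [u1]] := multiplicity_XsubC u rho; rewrite u0 /= => u1rho Eu.
have /factor_theorem[q1 Eq] := qrho.
have [y Ey] : exists y : {poly k}, y = 'X - rho%:P by exists ('X - rho%:P).
rewrite -Ey in Eu Eq.
have y0 : y != 0 by rewrite Ey polyXsubC_eq0.
have dy : y^`() = 1 by rewrite Ey derivB derivX derivC subr0.
have yrho : y.[rho] = 0 by rewrite Ey !hornerE subrr.
have q1rho : q1.[rho] != 0.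
  by move: q'rho; rewrite Eq derivM -?Ey dy mulr1 hornerD hornerM yrho mulr0 add0r.
have Eyu : y * u^`() = y ^+ o * (o%:R * u1 + y * u1^`()).
  rewrite Eu derivM deriv_exp dy mul1r -mulr_natr -?Ey.
  case: (o) => [|o']; first by rewrite !mulr0 addr0 !mul0r add0r expr0 !mulr1 mul1r.
  by rewrite exprS /=; ring.
have : mu%:R * p * q1 * (o%:R * u1 + y * u1^`()) =
    ((mu - i.+1)%:R * p * (q1 + y * q1^`()) + i.+1%:R * (q1 * y) * p^`()) * u1.
  apply: (mulfI (expf_neq0 o y0)).
  transitivity (mu%:R * p * q1 * (y ^+ o * (o%:R * u1 + y * u1^`()))); first by ring.
  rewrite -?Eyu; transitivity (mu%:R * p * q * u^`()); first by rewrite Eq -?Ey; ring.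
  by rewrite D Eq -?Ey derivM dy Eu -?Ey; ring.
move/(congr1 (horner^~ rho)); rewrite /= -!polyC_natr !(hornerM, hornerD, hornerC) yrho !(mul0r, mulr0, addr0).
move=> E; have : (mu * o)%:R = (mu - i.+1)%:R :> k.
  apply: (mulIf (mulf_neq0 (mulf_neq0 prho q1rho) u1rho)); rewrite natrM.
  transitivity (mu%:R * p.[rho] * q1.[rho] * (o%:R * u1.[rho])); first by ring.
  by rewrite E; ring.
move/(natr_inj0 char0); move: lt_i; clear; case: o => [|o']; first by lia.
by rewrite mulnS; lia.
Qed.

(** The second equation is p u' = p' u, so u = c p. The first becomes (mu w0 - c q') p = q (mu w - c
    p'), and coprimality with the degree bound makes both sides vanish. Since w0 has no term of
    degree d - 1 while q' has one, c = 0. *)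
Lemma ruppert_top (p q u w w0 : {poly k}) mu d : (0 < mu)%N -> (0 < d)%N ->
  p != 0 -> coprimep q p -> size q = d.+1 -> (size w0 <= d - 1)%N ->
  q * (u^`() - mu%:R * w) = q^`() * u - mu%:R * p * w0 ->
  p * (u^`() - mu%:R * w) = p^`() * u - mu%:R * p * w -> [/\ u = 0, w = 0 & w0 = 0].
Proof.
move=> mu0 d0 p0 cop sq sw0 E1 E2.
have q0 : q != 0 by rewrite -size_poly_gt0 sq.
have muk : (mu%:R : k) != 0 by rewrite natr_eq0; lia.
have mup : (mu%:R : {poly k}) != 0 by rewrite -polyC_natr polyC_eq0.
have [c Eu] : exists c, u = c *: p.
  apply: wronskian0_colinear => //.
  transitivity (p * (u^`() - mu%:R * w) + mu%:R * p * w); first by ring.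
  by rewrite E2; ring.
have E3 : (mu%:R * w0 - c%:P * q^`()) * p = q * (mu%:R * w - c%:P * p^`()).
  transitivity (q^`() * u - (q^`() * u - mu%:R * p * w0) - mu%:R * p * w0 + mu%:R * p * w0
     - c%:P * q^`() * p); first by ring.
  by rewrite -E1 Eu derivZ -!mul_polyC; ring.
have sz : (size (mu%:R * w0 - c%:P * q^`())%R < size q)%N.
  rewrite sq ltnS; apply: leq_trans (size_polyBle _ _) _; rewrite geq_max -polyC_natr !mul_polyC.
  rewrite (leq_trans (size_scale_leq _ _)) /=; last by apply: leq_trans sw0 _; apply: leq_subr.
  rewrite (leq_trans (size_scale_leq _ _)) // -ltnS -sq lt_size_deriv //.
have E4 : mu%:R * w0 - c%:P * q^`() = 0.
  apply: contraTeq sz => n0; rewrite -leqNgt; apply: dvdp_leq => //.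
  by rewrite -(Gauss_dvdpl _ cop) E3 dvdp_mulr.
have Ew : mu%:R * w - c%:P * p^`() = 0.
  by move/eqP: E3; rewrite E4 mul0r eq_sym mulf_eq0 (negPf q0) => /eqP.
have c0 : c = 0.
  have := congr1 (fun r : {poly k} => r`_(d.-1)) E4.
  rewrite coefB -polyC_natr !coefCM coef0 [w0`_ _]nth_default; last by apply: leq_trans sw0 _; rewrite subn1.
  rewrite mulr0 sub0r coef_deriv prednK // => /eqP; rewrite oppr_eq0 -mulr_natr.
  rewrite !mulf_eq0 natr_eq0 gtn_eqF // orbF => /orP[/eqP//|].
  by have := q0; rewrite -lead_coef_eq0 lead_coefE sq /= => /negPf->.
move: E4 Ew; rewrite Eu c0 scale0r !mul0r !subr0 => /eqP; rewrite mulf_eq0 (negPf mup) => /eqP->.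
by move/eqP; rewrite mulf_eq0 (negPf mup) => /eqP->.
Qed.

End Ruppert.

(** * Closed differential forms with a given denominator in the plane *)

Section Bivariate.
Variable k : fieldType.
Hypothesis char0 : [pchar k] =i pred0.
Implicit Types (P Q u w : {poly {poly k}}).

Definition deriv_in P : {poly {poly k}} := map_poly (@deriv k) P.

Lemma coef_deriv_in P i : (deriv_in P)`_i = (P`_i)^`().
Proof. by rewrite coef_map_id0 // deriv0. Qed.

Lemma deriv_inD P Q : deriv_in (P + Q) = deriv_in P + deriv_in Q.
Proof. by apply/polyP => i; rewrite coefD !coef_deriv_in coefD derivD. Qed.

Lemma deriv_inM P Q : deriv_in (P * Q) = deriv_in P * Q + P * deriv_in Q.
Proof.
apply/polyP => i; rewrite coefD !coefM coef_deriv_in coefM raddf_sum -big_split /=.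
by apply: eq_bigr => j _; rewrite derivM !coef_deriv_in.
Qed.

Lemma deriv_inB P Q : deriv_in (P - Q) = deriv_in P - deriv_in Q.
Proof. by apply/polyP => i; rewrite coefB !coef_deriv_in coefB derivB. Qed.

Lemma deriv_in_natl (n : nat) P : deriv_in (n%:R * P) = n%:R * deriv_in P.
Proof. by rewrite !mulr_natl /deriv_in raddfMn. Qed.

Lemma deriv_inC (c : k) : deriv_in c%:P%:P = 0.
Proof. by apply/polyP => i; rewrite coef_deriv_in coefC coef0; case: eqP; rewrite ?derivC ?deriv0. Qed.

Lemma deriv_in_comm P : deriv_in P^`() = (deriv_in P)^`().
Proof. by apply/polyP => i; rewrite coef_deriv_in !coef_deriv coef_deriv_in raddfMn. Qed.

(* The equation d(alpha / phi) = 0 for alpha = u dz + w ds, with denominators cleared; [z] is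
   the outer variable and [s] the inner one. *)
Definition closed_defect phi u w : {poly {poly k}} :=
  phi * (deriv_in u - w^`()) - (deriv_in phi * u - phi^`() * w).

(** For every phi the pair u = phi', w = [deriv_in phi], which is d phi / phi, solves the equation.
    When phi_0 has degree d the last bound excludes it, because then w_0 has degree d - 1. The other
    bounds hold for the forms coming from a factorization. *)
Definition ruppert_bounds mu d u w :=
  [/\ (size u <= mu)%N, (size w <= mu.+1)%N,
      forall i, (size (u`_i)%R <= d.+1)%N, forall i, (size (w`_i)%R <= d.+1)%N &
      (size (w`_0)%R <= d - 1)%N].

Definition ruppert mu d phi := forall u w,
  ruppert_bounds mu d u w -> closed_defect phi u w = 0 -> u = 0 /\ w = 0.

(** For a binomial phi the system decouples: the coefficients of z^i and z^(mu + i) involve only u_i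
    and w_(i+1), except that z^(mu - 1) also involves w_0. The exceptional pair is handled by
    [ruppert_top], all others by [ruppert_low]. *)
Lemma ruppert_binomial (p q : {poly k}) rho mu d : (0 < mu)%N -> (0 < d)%N ->
  coprimep q p -> size q = d.+1 -> p.[rho] != 0 -> root q rho -> q^`().[rho] != 0 ->
  ruppert mu d (p%:P * 'X^mu + q%:P).
Proof.
move=> mu0 d0 cop sq prho qrho q'rho u w [su sw _ _ sw0].
have p0 : p != 0 by apply: contraNneq prho => ->; rewrite horner0.
pose phi := p%:P * 'X^mu + q%:P; rewrite /closed_defect -/phi.
have [t Et] : exists t, t = deriv_in u - w^`() by exists (deriv_in u - w^`()).
rewrite -Et => /eqP; rewrite subr_eq0 => /eqP E.
have tE i : t`_i = (u`_i)^`() - i.+1%:R * w`_i.+1.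
  by rewrite Et coefB coef_deriv_in coef_deriv mulr_natl.
have dphi : deriv_in phi = p^`()%:P * 'X^mu + q^`()%:P.
  apply/polyP => i; rewrite coef_deriv_in !coefD !coefCM !coefC coefXn derivD; congr (_ + _).
    by case: eqP => _; rewrite !(mulr1, mulr0) ?deriv0.
  by case: eqP => _; rewrite ?deriv0.
have phi' : phi^`() = (mu%:R * p)%:P * 'X^(mu.-1).
  by rewrite derivD derivC addr0 derivM derivC mul0r add0r derivXn polyCM polyC_natr; ring.
have cX (a : {poly k}) m Q i : (a%:P * 'X^m * Q)`_i = a * (if (i < m)%N then 0 else Q`_(i - m)).
  by rewrite -mulrA coefCM coefXnM.
have E1 i : (i < mu)%N -> q * t`_i = q^`() * u`_i - mu%:R * p * (if (i < mu.-1)%N then 0 else w`_(i - mu.-1)).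
  move=> lt_i; have := congr1 (fun Q : {poly {poly k}} => Q`_i) E.
  rewrite {1}/phi dphi phi' coefB !mulrDl !coefD !cX lt_i !mulr0 !add0r !coefCM.
  by [].
have E2 i : p * t`_i = p^`() * u`_i - mu%:R * p * w`_i.+1.
  have := congr1 (fun Q : {poly {poly k}} => Q`_(mu + i)) E.
  rewrite {1}/phi dphi phi' coefB !mulrDl !coefD !cX !coefCM !ltnNge leq_addr /= addKn.
  rewrite (leq_trans (leq_pred _) (leq_addr _ _)) /=.
  have -> : (mu + i - mu.-1 = i.+1)%N by lia.
  have -> : u`_(mu + i) = 0 by rewrite nth_default // (leq_trans su) ?leq_addr.
  have -> : t`_(mu + i) = 0.
    rewrite tE !nth_default ?deriv0 ?mulr0 ?subr0 //.
      by apply: leq_trans sw _; rewrite ltnS leq_addr.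
    by apply: leq_trans su _; rewrite leq_addr.
  by rewrite !mulr0 !addr0.
have low i : (i.+1 < mu)%N -> u`_i = 0 /\ w`_i.+1 = 0.
  move=> lt_i; apply: (@ruppert_low k char0 p q _ _ mu i rho) => //.
    rewrite -tE E1 ?(ltnW lt_i) //. have -> /= : (i < mu.-1)%N by lia.
    by rewrite mulr0 subr0.
  by rewrite -tE E2.
have [utop wtop w0] : [/\ u`_mu.-1 = 0, w`_mu = 0 & w`_0 = 0].
  apply: (ruppert_top char0 mu0 d0 p0 cop sq sw0).
    have := E1 mu.-1; rewrite ltnn subnn tE prednK //; exact.
  by have := E2 mu.-1; rewrite tE prednK.
split; apply/polyP => i; rewrite coef0.
  have [lt_i|le_i] := ltnP i.+1 mu; first by case: (low i lt_i).
  have [E'|ne] := eqVneq i mu.-1; first by rewrite E'.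
  by rewrite nth_default // (leq_trans su) //; lia.
case: i => // i; have [lt_i|le_i] := ltnP i.+1 mu; first by case: (low i lt_i).
have [->//|ne] := eqVneq i.+1 mu.
by rewrite nth_default // (leq_trans sw) //; lia.
Qed.

Lemma size_bounded_coefM P Q a b : (forall i, (size (P`_i)%R <= a.+1)%N) ->
  (forall i, (size (Q`_i)%R <= b.+1)%N) -> forall i, (size ((P * Q)`_i)%R <= (a + b).+1)%N.
Proof.
move=> HP HQ i; rewrite coefM; apply: leq_trans (size_sum _ _ _) _; apply/bigmax_leqP => j _.
apply: leq_trans (size_polyMleq _ _) _; have := HP j; have := HQ (i - j)%N.
by move: (size _) (size _) => x y; lia.
Qed.

(** The form b dG/G - a dH/H is closed and has denominator G H. The weights are crossed so that its
    numerator meets the bound on w_0; by the criterion the numerator vanishes. *)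
Lemma ruppert_factor (G H : {poly {poly k}}) a b mu : (0 < a)%N -> (0 < b)%N ->
  (forall i, (size (G`_i)%R <= a.+1)%N) -> (forall i, (size (H`_i)%R <= b.+1)%N) ->
  size (G * H)%R = mu.+1 -> ruppert mu (a + b) (G * H) ->
  b%:R * H * G^`() = a%:R * G * H^`().
Proof.
move=> a0 b0 HG HH sGH; set u := b%:R * H * G^`() - a%:R * G * H^`().
set w := b%:R * H * deriv_in G - a%:R * G * deriv_in H.
suff [Hb Hd] : ruppert_bounds mu (a + b) u w /\ closed_defect (G * H) u w = 0.
  by move=> /(_ u w Hb Hd)[/eqP]; rewrite subr_eq0 => /eqP.
have nC (n : nat) : (n%:R : {poly {poly k}}) = n%:R%:P%:P by rewrite !polyC_natr.
split; last first.
  rewrite /closed_defect.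
  have -> : deriv_in u = b%:R * (deriv_in H * G^`() + H * (deriv_in G)^`())
       - a%:R * (deriv_in G * H^`() + G * (deriv_in H)^`()).
    by rewrite /u -!mulrA deriv_inB !deriv_in_natl !deriv_inM !deriv_in_comm.
  have -> : w^`() = b%:R * (H^`() * deriv_in G + H * (deriv_in G)^`())
       - a%:R * (G^`() * deriv_in H + G * (deriv_in H)^`()).
    by rewrite /w derivB !derivM !nC !derivC; ring.
  by rewrite deriv_inM derivM /u /w; ring.
have G0 : G != 0 by apply: contraTneq isT => E; rewrite E mul0r size_poly0 in sGH.
have H0 : H != 0 by apply: contraTneq isT => E; rewrite E mulr0 size_poly0 in sGH.
have sG : (0 < size G)%N by rewrite size_poly_gt0.
have sH : (0 < size H)%N by rewrite size_poly_gt0.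
rewrite size_mul // in sGH.
have HG' : forall i, (size ((deriv_in G)`_i)%R <= a.-1.+1)%N.
  move=> i; rewrite coef_deriv_in prednK //; have [->|n0] := eqVneq G`_i 0; first by rewrite deriv0 size_poly0.
  by rewrite -ltnS (leq_trans (lt_size_deriv n0)).
have HH' : forall i, (size ((deriv_in H)`_i)%R <= b.-1.+1)%N.
  move=> i; rewrite coef_deriv_in prednK //; have [->|n0] := eqVneq H`_i 0; first by rewrite deriv0 size_poly0.
  by rewrite -ltnS (leq_trans (lt_size_deriv n0)).
have HdG i : (size ((G^`())`_i)%R <= a.+1)%N.
  by rewrite coef_deriv -mulr_natl -polyC_natr mul_polyC (leq_trans (size_scale_leq _ _)).
have HdH i : (size ((H^`())`_i)%R <= b.+1)%N.
  by rewrite coef_deriv -mulr_natl -polyC_natr mul_polyC (leq_trans (size_scale_leq _ _)).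
have szB (n1 n2 : nat) (P1 P2 : {poly {poly k}}) m :
   (size P1 <= m)%N -> (size P2 <= m)%N -> (size (n1%:R * P1 - n2%:R * P2)%R <= m)%N.
  move=> s1 s2; apply: leq_trans (size_polyD _ _) _; rewrite size_polyN !nC !mul_polyC geq_max.
  by rewrite !(leq_trans (size_scale_leq _ _)).
have szC (n1 n2 : nat) (P1 P2 : {poly {poly k}}) m i :
   (size (P1`_i)%R <= m)%N -> (size (P2`_i)%R <= m)%N -> (size ((n1%:R * P1 - n2%:R * P2)`_i)%R <= m)%N.
  move=> s1 s2; rewrite coefB !nC !coefCM.
  apply: leq_trans (size_polyD _ _) _; rewrite size_polyN !mul_polyC geq_max.
  by rewrite !(leq_trans (size_scale_leq _ _)).
have szM P1 P2 m : (0 < m)%N -> (size P1 + size P2 <= m.+1)%N -> (size (P1 * P2)%R <= m)%N.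
  by move=> m0 s; apply: leq_trans (size_polyMleq _ _) _; rewrite -subn1 leq_subLR add1n.
have sdG : (size G^`() < size G)%N by apply: lt_size_deriv.
have sdH : (size H^`() < size H)%N by apply: lt_size_deriv.
have sdsG : (size (deriv_in G) <= size G)%N by apply: size_poly.
have sdsH : (size (deriv_in H) <= size H)%N by apply: size_poly.
have szu (Q R : {poly {poly k}}) : (size Q < size R)%N -> forall P, size P + size R = mu.+2 -> (size (P * Q)%R <= mu)%N.
  move=> sQR P sPR; have [->|Q0] := eqVneq Q 0; first by rewrite mulr0 size_poly0.
  have [->|P0] := eqVneq P 0; first by rewrite mul0r size_poly0.
  by rewrite size_mul // -subn1 leq_subLR -ltnS add1n -sPR -addnS leq_add2l.
rewrite /u /w -!mulrA; split.
- by apply: szB; [apply: (szu _ _ sdG)|apply: (szu _ _ sdH)]; move: sGH sG sH; clear;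
    move: (size G) (size H) => x y; lia.
- by apply: szB; apply: szM => //; move: sGH sG sH sdsG sdsH; clear;
    move: (size G) (size H) (size (deriv_in G)) (size (deriv_in H)) => x y z t; lia.
- move=> i; apply: szC; last by apply: size_bounded_coefM.
  by rewrite addnC; apply: size_bounded_coefM.
- move=> i; apply: szC; last first.
    by apply: leq_trans (size_bounded_coefM HG HH' i) _; rewrite ltnS leq_add2l leq_pred.
  by apply: leq_trans (size_bounded_coefM HH HG' i) _; rewrite ltnS addnC leq_add2r leq_pred.
rewrite coefB !nC !coefCM !coefM !big_ord1 !coef_deriv_in.
set g := G`_0; set h := H`_0.
apply/leq_sizeP => j le_j; rewrite coefB !coefCM.
have Hg : (size g <= a.+1)%N by apply: HG.
have Hh : (size h <= b.+1)%N by apply: HH.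
have Hg' : (size g^`() <= a.-1.+1)%N by have := HG' 0%N; rewrite coef_deriv_in.
have Hh' : (size h^`() <= b.-1.+1)%N by have := HH' 0%N; rewrite coef_deriv_in.
have [lt_j|] := ltnP (a + b - 1)%N j.
  rewrite (nth_default 0 (s := h * g^`())) ?(nth_default 0 (s := g * h^`())) ?mulr0 ?subr0 //;
    apply: leq_trans (size_polyMleq _ _) _.
    by move: Hg Hh' lt_j a0 b0; clear; move: (size _) (size _) => x y; lia.
  by move: Hg' Hh lt_j a0 b0; clear; move: (size _) (size _) => x y; lia.
move=> ge_j; have -> : j = (a + b - 1)%N by apply/eqP; rewrite eqn_leq ge_j.
have [e1 e2] : (a + b - 1 = b + a.-1)%N /\ (a + b - 1 = a + b.-1)%N by lia.
(* In degree a + b - 1 the two products both contribute a b g_a h_b, with opposite signs. *)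
rewrite {1}e1 e2 !coefM_top // !coef_deriv !prednK //.
by rewrite -[_ *+ a]mulr_natl -[_ *+ b]mulr_natl; ring.
Qed.

End Bivariate.

(** * Openness of the criterion *)

Section Separable.
Variable k : fieldType.
Hypothesis char0 : [pchar k] =i pred0.

(** Together with its converse [trivial_kernel_separable], this turns separability into the
    injectivity of a Sylvester-type linear map, to which [open_trivial_kernel] applies. *)
Lemma separable_trivial_kernel (p A B : {poly k}) m : size p = m.+1 -> coprimep p p^`() ->
  (size B <= m)%N -> A * p + B * p^`() = 0 -> A = 0 /\ B = 0.
Proof.
move=> sp cop sB E; have p0 : p != 0 by rewrite -size_poly_gt0 sp.
have B0 : B = 0.
  apply: contraTeq sB => B0; rewrite -ltnNge -ltnS -sp ltnS; apply: dvdp_leq => //.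
  rewrite -(Gauss_dvdpl _ cop); apply/Pdiv.Field.dvdpP; exists (- A).
  by rewrite mulNr; apply/eqP; rewrite -addr_eq0 addrC E.
split=> //; move/eqP: E; rewrite B0 mul0r addr0 mulf_eq0 (negPf p0) orbF => /eqP//.
Qed.

(** If p = p1 g and p' = p2 g with g not constant, then p2 p - p1 p' = 0 is a nontrivial solution
    within the bounds. *)
Lemma trivial_kernel_separable (p : {poly k}) m : (0 < m)%N -> size p = m.+1 ->
  (forall A B : {poly k}, (size A <= m)%N -> (size B <= m)%N -> A * p + B * p^`() = 0 -> B = 0) ->
  coprimep p p^`().
Proof.
move=> m0 sp H; have p0 : p != 0 by rewrite -size_poly_gt0 sp.
have /Pdiv.Field.dvdpP[p1 Ep] := dvdp_gcdl p p^`().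
have /Pdiv.Field.dvdpP[p2 Ep'] := dvdp_gcdr p p^`().
set g := gcdp _ _ in Ep Ep'; have g0 : g != 0 by rewrite gcdp_eq0 negb_and p0.
have p10 : p1 != 0 by apply: contraNneq p0 => E; rewrite Ep E mul0r.
rewrite /coprimep -/g; apply: contraTT isT => sg.
have sg2 : (1 < size g)%N.
  by move: sg; have := g0; rewrite -size_poly_gt0; case: (size g) => [|[|]].
have s1 : (size p1 <= m)%N.
  by have := sp; rewrite {1}Ep size_mul // => E; move: sg2 E; move: (size p1) (size g) => x y; lia.
have s2 : (size p2 <= m)%N.
  have [->|p20] := eqVneq p2 0; first by rewrite size_poly0.
  have : (size p^`() < m.+1)%N by rewrite -sp lt_size_deriv.
  by rewrite Ep' size_mul // => E; move: sg2 E; move: (size p2) (size g) => x y; lia.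
suff : p1 = 0 by move/eqP: p10.
apply/eqP; rewrite -oppr_eq0; apply/eqP/(H p2) => //; first by rewrite size_polyN.
by rewrite Ep' {1}Ep mulNr; ring.
Qed.

(** The relation gives b (g h)' = (a + b) g h', so g divides both g h and its derivative and is
    constant; the same holds for h by symmetry. *)
Lemma separable_log_deriv (g h : {poly k}) a b : (0 < a)%N -> (0 < b)%N ->
  coprimep (g * h) (g * h)^`() -> b%:R * h * g^`() = a%:R * g * h^`() ->
  (size (g * h)%R <= 1)%N.
Proof.
have key (g1 h1 : {poly k}) (a1 b1 : nat) : (0 < b1)%N ->
    coprimep (g1 * h1) (g1 * h1)^`() -> b1%:R * h1 * g1^`() = a1%:R * g1 * h1^`() ->
    (size g1 <= 1)%N.
  move=> b0 cop E; suff dg : g1 %| (g1 * h1)^`().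
    have := coprimep_dvdl dg (coprimep_dvdr (dvdp_mulr h1 (dvdpp g1)) cop).
    by rewrite coprimepp => /eqP->.
  have bk : (b1%:R : k) != 0 by rewrite natr_eq0 // -lt0n.
  rewrite -(dvdpZr _ _ bk) -mul_polyC polyC_natr; apply/Pdiv.Field.dvdpP.
  exists ((a1 + b1)%:R * h1^`()); rewrite derivM.
  transitivity (b1%:R * h1 * g1^`() + b1%:R * g1 * h1^`()); first by ring.
  by rewrite E natrD; ring.
move=> a0 b0 cop E; have sg := key g h a b b0 cop E.
have sh : (size h <= 1)%N.
  by apply: (key h g b a a0); rewrite 1?[h * g]mulrC // E.
by apply: leq_trans (size_polyMleq _ _) _; move: sg sh; move: (size g) (size h) => x y; lia.
Qed.


Variables (T J : Type) (x : J -> T -> k) (X : T -> Prop).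
Local Notation pf := (polyfun_on x X).

Definition polyfun1 (p : T -> {poly k}) := forall i, pf (fun D => (p D)`_i).
Definition polyfun2 (P : T -> {poly {poly k}}) := forall i, polyfun1 (fun D => (P D)`_i).

Lemma polyfun1_const c : polyfun1 (fun=> c).
Proof. by move=> i; apply: polyfun_on_const. Qed.

Lemma polyfun1_add p q : polyfun1 p -> polyfun1 q -> polyfun1 (fun D => p D + q D).
Proof.
move=> Hp Hq i; apply: polyfun_on_ext (polyfun_on_add (Hp i) (Hq i)) => D _.
by rewrite coefD.
Qed.

Lemma polyfun1_sum (I : Type) (r : seq I) (F : I -> T -> {poly k}) :
  (forall i, polyfun1 (F i)) -> polyfun1 (fun D => \sum_(i <- r) F i D).
Proof.
move=> H i; apply: polyfun_on_ext (polyfun_on_sum r xpredT (fun j => H j i)) => D _.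
by rewrite coef_sum.
Qed.

Lemma polyfun1_mul p q : polyfun1 p -> polyfun1 q -> polyfun1 (fun D => p D * q D).
Proof.
move=> Hp Hq i; apply: (@polyfun_on_ext _ _ _ _ _ (fun D => \sum_(j < i.+1) (p D)`_j * (q D)`_(i - j))).
  by move=> D _; rewrite coefM.
by apply: polyfun_on_sum => j; apply: polyfun_on_mul.
Qed.

Lemma polyfun1_deriv p : polyfun1 p -> polyfun1 (fun D => (p D)^`()).
Proof.
move=> Hp i; apply: polyfun_on_ext (polyfun_on_mul (polyfun_on_const _ _ i.+1%:R) (Hp i.+1)) => D _.
by rewrite coef_deriv mulr_natl.
Qed.

Lemma polyfun1_opp p : polyfun1 p -> polyfun1 (fun D => - p D).
Proof.
move=> Hp i; apply: polyfun_on_ext (polyfun_on_mul (polyfun_on_const _ _ (-1)) (Hp i)) => D _.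
by rewrite coefN mulN1r.
Qed.

Lemma polyfun2_const c : polyfun2 (fun=> c).
Proof. by move=> i; apply: polyfun1_const. Qed.

Lemma polyfun1_ext p q : (forall D, X D -> p D = q D) -> polyfun1 p -> polyfun1 q.
Proof. by move=> E Hp i; apply: polyfun_on_ext (Hp i) => D XD; rewrite E. Qed.

Lemma polyfun2_ext p q : (forall D, X D -> p D = q D) -> polyfun2 p -> polyfun2 q.
Proof. by move=> E Hp i; apply: polyfun1_ext (Hp i) => D XD; rewrite E. Qed.

Lemma polyfun2_add p q : polyfun2 p -> polyfun2 q -> polyfun2 (fun D => p D + q D).
Proof.
by move=> Hp Hq i; apply: polyfun1_ext (polyfun1_add (Hp i) (Hq i)) => D _; rewrite coefD.
Qed.

Lemma polyfun2_mul p q : polyfun2 p -> polyfun2 q -> polyfun2 (fun D => p D * q D).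
Proof.
move=> Hp Hq i.
apply: (@polyfun1_ext (fun D => \sum_(j < i.+1) (p D)`_j * (q D)`_(i - j))).
  by move=> D _; rewrite coefM.
by apply: polyfun1_sum => j; apply: polyfun1_mul.
Qed.

Lemma polyfun2_opp p : polyfun2 p -> polyfun2 (fun D => - p D).
Proof. by move=> Hp i; apply: polyfun1_ext (polyfun1_opp (Hp i)) => D _; rewrite coefN. Qed.

Lemma polyfun2_deriv p : polyfun2 p -> polyfun2 (fun D => (p D)^`()).
Proof.
move=> Hp i; apply: polyfun1_ext (polyfun1_mul (polyfun1_const i.+1%:R) (Hp i.+1)) => D _.
by rewrite coef_deriv mulr_natl.
Qed.

Lemma polyfun2_deriv_in p : polyfun2 p -> polyfun2 (fun D => deriv_in (p D)).
Proof. by move=> Hp i; apply: polyfun1_ext (polyfun1_deriv (Hp i)) => D _; rewrite coef_deriv_in. Qed.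

Lemma open_separable (p : T -> {poly k}) m D0 : polyfun1 p -> X D0 ->
  (forall D, X D -> (size (p D) <= m.+1)%N) -> (0 < m)%N ->
  size (p D0) = m.+1 -> coprimep (p D0) (p D0)^`() ->
  exists h, [/\ polyfun x h, h D0 != 0 & forall D, X D -> h D != 0 ->
    size (p D) = m.+1 /\ coprimep (p D) (p D)^`()].
Proof.
move=> Hp XD0 sp m0 sp0 cop0.
pose I := ('I_m + 'I_m)%type.
pose A (xi : I -> k) : {poly k} := \sum_i xi (inl i) *: 'X^i.
pose B (xi : I -> k) : {poly k} := \sum_i xi (inr i) *: 'X^i.
pose b (j : nat) D (i : I) := match i with
  | inl i => ('X^i * p D)`_j | inr i => ('X^i * (p D)^`())`_j end.
have bE D xi j : \sum_i b j D i * xi i = (A xi * p D + B xi * (p D)^`())`_j.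
  rewrite big_sumType /= coefD !mulr_suml !coef_sum; congr (_ + _); apply: eq_bigr => i _;
  by rewrite -scalerAl coefZ mulrC.
have sA (c : 'I_m -> k) : (size (\sum_i c i *: 'X^i)%R <= m)%N.
  apply: leq_trans (size_sum _ _ _) _; apply/bigmax_leqP => i _.
  by apply: leq_trans (size_scale_leq _ _) _; rewrite size_polyXn.
have cA (c : 'I_m -> k) (i : 'I_m) : (\sum_i c i *: 'X^i)`_i = c i.
  rewrite coef_sum (bigD1 i) //= coefZ coefXn eqxx mulr1 big1 ?addr0 // => j ji.
  by rewrite coefZ coefXn eq_sym (negPf ji : (j == i :> nat) = false) mulr0.
have [||h [ph h0 hP]] := @open_trivial_kernel k T J x X I nat b D0 _ XD0.
- move=> j [i|i] /=; [exact: (polyfun1_mul (polyfun1_const _) Hp)|].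
  exact: (polyfun1_mul (polyfun1_const _) (polyfun1_deriv Hp)).
- move=> xi Hxi; have [|A0 B0] := @separable_trivial_kernel (p D0) (A xi) (B xi) m sp0 cop0 (sA _).
    by apply/polyP => j; rewrite -bE Hxi coef0.
  by case=> i; [rewrite -(cA (fun i => xi (inl i))) -/(A xi) A0|
    rewrite -(cA (fun i => xi (inr i))) -/(B xi) B0]; rewrite coef0.
(* The coefficient of degree m enters the open condition so that the degree cannot drop. *)
have [l pl El] := Hp m.
exists (fun D => h D * l D); split; first exact: polyfun_mul.
  rewrite mulf_neq0 // -El //; have : lead_coef (p D0) != 0.
    by rewrite lead_coef_eq0 -size_poly_gt0 sp0.
  by rewrite lead_coefE sp0.
move=> D XD; rewrite mulf_eq0 negb_or -El // => /andP[hD lD].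
have spD : size (p D) = m.+1.
  apply/eqP; rewrite eqn_leq sp //= ltnNge; apply: contra lD => s.
  by rewrite nth_default.
split=> //; apply: (trivial_kernel_separable m0 spD) => A' B' sA' sB' E.
pose xi (i : I) := match i with inl i => A'`_i | inr i => B'`_i end.
have pE (q : {poly k}) : (size q <= m)%N -> \sum_(i < m) q`_i *: 'X^i = q.
  by move=> sq; rewrite -poly_def; apply/polyP => i; rewrite coef_poly; case: ltnP => // le_i;
    rewrite nth_default // (leq_trans sq).
have H0 : forall i, xi i = 0.
  by apply: (hP D XD hD) => j; rewrite bE /A /B /= !pE // E coef0.
apply/polyP => i; rewrite coef0; have [lt_i|le_i] := ltnP i m.
  exact: (H0 (inr (Ordinal lt_i))).
by rewrite nth_default // (leq_trans sB').
Qed.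

(** The bounds cut out a finite-dimensional space of pairs (u, w), on which the equation is linear
    with coefficients polynomial in those of phi. *)
Lemma open_ruppert (phi : T -> {poly {poly k}}) mu d D0 : polyfun2 phi -> X D0 -> (0 < d)%N ->
  ruppert mu d (phi D0) ->
  exists h, [/\ polyfun x h, h D0 != 0 & forall D, X D -> h D != 0 -> ruppert mu d (phi D)].
Proof.
move=> Hp XD0 d0 H0.
pose I := ('I_mu * 'I_d.+1 + 'I_mu.+1 * 'I_d.+1)%type.
pose mon (i j : nat) : {poly {poly k}} := ('X^j : {poly k})%:P * 'X^i.
pose Ub (i : I) : {poly {poly k}} := match i with inl (i, j) => mon i j | inr _ => 0 end.
pose Wb (i : I) : {poly {poly k}} := match i with inr (i, j) => mon i j | inl _ => 0 end.
pose U (xi : I -> k) : {poly {poly k}} := \sum_i (xi i)%:P%:P * Ub i.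
pose W (xi : I -> k) : {poly {poly k}} := \sum_i (xi i)%:P%:P * Wb i.
(* The unknowns allow degree d in every w_i; the two conditions indexed by 'I_2 kill the terms of
   degree d - 1 and d of w_0, as the last bound requires. *)
pose b (th : nat * nat + 'I_2) D (i : I) := match th with
  | inl (a, c) => (closed_defect (phi D) (Ub i) (Wb i))`_a`_c
  | inr e => (Wb i)`_0`_(d - 1 + e) end.
have cE n (c : 'I_n -> 'I_d.+1 -> k) : exists c' : nat -> nat -> k, (forall (i : 'I_n) (j : 'I_d.+1), c' i j = c i j) /\
    \sum_i \sum_j (c i j)%:P%:P * mon i j = \poly_(i < n) \poly_(j < d.+1) c' i j.
  exists (fun i j => if insub i is Some i' then if insub j is Some j' then c i' j' else 0 else 0).
  split=> [i j|]; first by rewrite !valK.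
  rewrite poly_def; apply: eq_bigr => i _; rewrite -mul_polyC poly_def raddf_sum mulr_suml.
  by apply: eq_bigr => j _; rewrite !valK /mon mulrA -polyCM; congr (_%:P * _); rewrite mul_polyC.
have sumE n (c : 'I_n -> 'I_d.+1 -> k) :
    let P : {poly {poly k}} := \sum_i \sum_j (c i j)%:P%:P * mon i j in
    [/\ (size P <= n)%N, forall i, (size (P`_i)%R <= d.+1)%N & forall (i : 'I_n) (j : 'I_d.+1), P`_i`_j = c i j].
  have [c' [Ec ->]] := cE n c; split=> [|i|i j]; first exact: size_poly.
    by rewrite coef_poly; case: ltnP => _; rewrite ?size_poly0 ?size_poly.
  by rewrite coef_poly ltn_ord coef_poly ltn_ord Ec.
have sumK n (u : {poly {poly k}}) : (size u <= n)%N -> (forall i, (size (u`_i)%R <= d.+1)%N) ->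
    \sum_(i < n) \sum_(j < d.+1) (u`_i`_j)%:P%:P * mon i j = u.
  move=> su suu; apply/polyP => i; apply/polyP => j.
  have [] := sumE n (fun i j => u`_i`_j); set P := \sum_(i < n) _ => sP sPi EP.
  have [lt_i|le_i] := ltnP i n; last first.
    by rewrite !(nth_default 0 (n := i)) // ?(leq_trans su) ?(leq_trans sP).
  have [lt_j|le_j] := ltnP j d.+1; first exact: (EP (Ordinal lt_i) (Ordinal lt_j)).
  by rewrite !(nth_default 0 (n := j)) // ?(leq_trans (suu i)) ?(leq_trans (sPi i)).
have UE xi : U xi = \sum_i \sum_j (xi (inl (i, j)))%:P%:P * mon i j.
  rewrite /U big_sumType /= [X in _ + X]big1 ?addr0 => [|i _]; last by rewrite mulr0.
  by rewrite pair_big; apply: eq_bigr => -[i j].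
have WE xi : W xi = \sum_i \sum_j (xi (inr (i, j)))%:P%:P * mon i j.
  rewrite /W big_sumType /= big1 ?add0r => [|i _]; last by rewrite mulr0.
  by rewrite pair_big; apply: eq_bigr => -[i j].
have bE D xi a c : \sum_i b (inl (a, c)) D i * xi i = (closed_defect (phi D) (U xi) (W xi))`_a`_c.
  have dsum (V : I -> {poly {poly k}}) : deriv_in (\sum_i (xi i)%:P%:P * V i)
     = \sum_i (xi i)%:P%:P * deriv_in (V i).
    have d00 : deriv_in 0 = 0 :> {poly {poly k}} by have := deriv_inC (0 : k); rewrite !polyC0.
    rewrite (big_morph (@deriv_in k) (@deriv_inD k) d00).
    by apply: eq_bigr => i _; rewrite deriv_inM deriv_inC mul0r add0r.
  have dsum' (V : I -> {poly {poly k}}) : (\sum_i (xi i)%:P%:P * V i)^`()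
     = \sum_i (xi i)%:P%:P * (V i)^`().
    by rewrite raddf_sum /=; apply: eq_bigr => i _; rewrite derivM derivC mul0r add0r.
  rewrite /closed_defect dsum dsum' -sumrB !mulr_sumr -!sumrB !coef_sum.
  apply: eq_bigr => i _; rewrite mulrC -!coefCM; congr ((_ : {poly {poly k}})`_a`_c).
  by rewrite /closed_defect; ring.
have bE' D xi e : \sum_i b (inr e) D i * xi i = (W xi)`_0`_(d - 1 + e).
  rewrite /W !coef_sum; apply: eq_bigr => i _; rewrite mulrC !coefCM.
  by [].
have [||h [ph h0 hP]] := @open_trivial_kernel k T J x X I _ b D0 _ XD0.
- case=> [[a c]|e] i /=; last exact: polyfun_on_const.
  apply: (polyfun2_add (polyfun2_mul Hp (polyfun2_const _)) (polyfun2_opp (polyfun2_add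
     (polyfun2_mul (polyfun2_deriv_in Hp) (polyfun2_const _))
     (polyfun2_opp (polyfun2_mul (polyfun2_deriv Hp) (polyfun2_const _)))))).
- move=> xi Hxi; have [u0 w0] : U xi = 0 /\ W xi = 0.
    have [su1 su2 _] := sumE mu (fun i j => xi (inl (i, j))).
    have [sw1 sw2 _] := sumE mu.+1 (fun i j => xi (inr (i, j))).
    apply: H0; last by apply/polyP => a; apply/polyP => c; rewrite -bE Hxi !coef0.
    split; rewrite ?UE ?WE //; rewrite -WE.
    apply/leq_sizeP => j le_j; have [lt_j|le_j'] := leqP j d; last first.
      by rewrite nth_default // WE (leq_trans (sw2 0%N)).
    have lt_e : (j - (d - 1) < 2)%N by lia.
    by have := bE' D0 xi (Ordinal lt_e); rewrite Hxi /= subnKC.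
  case=> -[i j].
    by have [_ _] := sumE mu (fun i j => xi (inl (i, j))); rewrite -UE u0 => <-; rewrite !coef0.
  by have [_ _] := sumE mu.+1 (fun i j => xi (inr (i, j))); rewrite -WE w0 => <-; rewrite !coef0.
exists h; split=> // D XD hD u w [su sw su' sw' sw0] E.
pose xi (i : I) := match i with inl (i, j) => u`_i`_j | inr (i, j) => w`_i`_j end.
have Eu : U xi = u by rewrite UE /= sumK.
have Ew : W xi = w by rewrite WE /= sumK.
have xi0 : forall i, xi i = 0.
  apply: (hP D XD hD) => -[[a c]|e]; first by rewrite bE Eu Ew E !coef0.
  by rewrite bE' Ew nth_default // (leq_trans sw0) ?leq_addr.
by split; rewrite -?Eu -?Ew /U /W big1 // => i _; rewrite xi0 !polyC0 mul0r.
Qed.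

End Separable.

(** * Restriction of a polynomial to an affine plane *)

Section Slice.
Variables (k : fieldType) (n : nat).
Hypothesis char0 : [pchar k] =i pred0.
Variables e a b : 'I_n -> k.
Local Notation R2 := {poly {poly k}}.

Definition slice_var (i : 'I_n) : R2 := ((b i)%:P + a i *: 'X)%:P + (e i)%:P%:P * 'X.

Definition slice (f : {mpoly k[n]}) : R2 := mmap (polyC \o polyC) slice_var f.

Lemma sliceD f g : slice (f + g) = slice f + slice g.
Proof. exact: mmapD. Qed.

Lemma sliceM f g : slice (f * g) = slice f * slice g.
Proof. exact: rmorphM. Qed.

Lemma sliceC c : slice c%:MP = c%:P%:P.
Proof. exact: mmapC. Qed.

Lemma sliceXU i : slice 'X_i = slice_var i.
Proof. by rewrite /slice mmapX mmap1U. Qed.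

Lemma horner_slice f z s : (slice f).[z%:P].[s] = f.@[fun i => b i + a i * s + e i * z].
Proof.
elim/mpoly_ringind: f => [c|i|p q Hp Hq|p q Hp Hq].
- by rewrite sliceC !hornerC mevalC.
- by rewrite sliceXU /slice_var mevalXU !hornerE.
- by rewrite sliceD mevalD !hornerD -Hp -Hq.
- by rewrite sliceM mevalM !hornerM -Hp -Hq.
Qed.

Lemma size_coef_slice f N i : (msize f <= N.+1)%N -> (size ((slice f)`_i)%R <= N.+1)%N.
Proof.
move=> sf; rewrite [f]mpolyE /slice raddf_sum /= coef_sum.
apply: leq_trans (size_sum _ _ _) _; rewrite big_seq; apply/bigmax_leqP_seq => m ms _.
have mN : (mdeg m <= N)%N by rewrite -ltnS (leq_trans (msize_mdeg_lt ms)).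
rewrite mmapZ mmapX coefCM /= mul_polyC; apply: leq_trans (size_scale_leq _ _) _.
apply: leq_trans (_ : (mdeg m).+1 <= _)%N; last by [].
rewrite mdegE /mmap1; move: i.
apply: (big_ind2 (fun (P : R2) d => forall i, (size (P`_i)%R <= d.+1)%N)).
- by move=> i; rewrite coef1; case: eqP => _; rewrite ?size_poly1 ?size_poly0.
- by move=> P c Q d HP HQ; apply: size_bounded_coefM.
move=> j _; elim: (m j) => [|d IH].
  by move=> i; rewrite expr0 coef1; case: eqP => _; rewrite ?size_poly1 ?size_poly0.
rewrite exprS; apply: (@size_bounded_coefM k _ _ 1 d) => // i.
rewrite /slice_var coefD coefC coefCM coefX.
apply: leq_trans (size_polyD _ _) _; rewrite geq_max; apply/andP; split.
  case: eqP => _; rewrite ?size_poly0 //; apply: leq_trans (size_polyD _ _) _.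
  rewrite geq_max (leq_trans (size_polyC_leq1 _)) //=.
  by apply: leq_trans (size_scale_leq _ _) _; rewrite size_polyX.
by case: eqP => _; rewrite ?mulr1 ?mulr0 ?size_poly0 // (leq_trans (size_polyC_leq1 _)).
Qed.

(** If both factors had positive degree, these degrees would add up to d and bound the slices of g
    and h, so [ruppert_factor] would give a relation between logarithmic derivatives; restricted to
    the line s = 0 it contradicts separability. *)
Lemma slice_irreducible f g h mu d : f = g * h -> msize f = d.+1 -> (0 < mu)%N ->
  size (slice f) = mu.+1 -> ruppert mu d (slice f) ->
  let p := map_poly (horner_eval 0) (slice f) in
  size p = mu.+1 -> coprimep p p^`() -> (msize g <= 1)%N \/ (msize h <= 1)%N.
Proof.
move=> Ef sf mu0 sS rup p sp cop; apply: NNPP => H.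
have sg : (1 < msize g)%N by rewrite ltnNge; apply/negP => ?; apply: H; left.
have sh : (1 < msize h)%N by rewrite ltnNge; apply/negP => ?; apply: H; right.
have [A EA] : exists A, msize g = A.+2 by exists (msize g).-2; move: sg; case: (msize g) => [|[]].
have [B EB] : exists B, msize h = B.+2 by exists (msize h).-2; move: sh; case: (msize h) => [|[]].
have g0 : g != 0 by rewrite -msize_poly_eq0 EA.
have h0 : h != 0 by rewrite -msize_poly_eq0 EB.
have Ed : d = (A.+1 + B.+1)%N by have := sf; rewrite Ef msizeM // EA EB; lia.
rewrite {}Ed in rup; rewrite Ef sliceM in sS rup.
have E := ruppert_factor (isT : 0 < A.+1)%N (isT : 0 < B.+1)%N
  (fun i => @size_coef_slice g A.+1 i (eq_leq EA)) (fun i => @size_coef_slice h B.+1 i (eq_leq EB)) sS rup.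
pose ev := map_poly (horner_eval (0 : k)).
have evn (m : nat) : ev m%:R = m%:R by rewrite /ev -(rmorph_nat (@polyC {poly k})) map_polyC /= horner_evalE -polyC_natr hornerC polyC_natr.
have Ep : p = ev (slice g) * ev (slice h) by rewrite /p Ef sliceM rmorphM.
have := congr1 ev E; rewrite /ev !rmorphM /=. rewrite -!deriv_map => E'.
have := @separable_log_deriv k char0 (ev (slice g)) (ev (slice h)) A.+1 B.+1 isT isT.
rewrite -Ep sp -(evn B.+1) -(evn A.+1) => /(_ cop E').
by rewrite ltnNge mu0.
Qed.

End Slice.

Section PolyfunMpoly.
Variables (k : fieldType) (n : nat).
Variables (T J : Type) (x : J -> T -> k) (X : T -> Prop).
Local Notation pf := (polyfun_on x X).

(** The uniform degree bound makes values and slices finite sums of coefficients, as [polyfun]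
    demands. *)
Definition polyfunm (H : T -> {mpoly k[n]}) :=
  (forall m, pf (fun D => (H D)@_m)) /\ exists N, forall D, X D -> (msize (H D) <= N)%N.

Lemma polyfunm_const c : polyfunm (fun=> c).
Proof. by split=> [m|]; [exact: polyfun_on_const|exists (msize c)]. Qed.

Lemma polyfunm_add H G : polyfunm H -> polyfunm G -> polyfunm (fun D => H D + G D).
Proof.
move=> [H1 [N HN]] [G1 [N' GN]]; split=> [m|].
  by apply: polyfun_on_ext (polyfun_on_add (H1 m) (G1 m)) => D _; rewrite mcoeffD.
exists (maxn N N') => D XD; apply: leq_trans (msizeD_le _ _) _.
by rewrite geq_max !leq_max HN ?GN ?orbT.
Qed.

Lemma polyfunm_mul H G : polyfunm H -> polyfunm G -> polyfunm (fun D => H D * G D).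
Proof.
move=> [H1 [N HN]] [G1 [N' GN]]; split=> [m|].
  have HS := polyfun_on_sum (index_enum ('X_{1..n < (mdeg m).+1, (mdeg m).+1} : finType))
    (fun c : 'X_{1..n < (mdeg m).+1, (mdeg m).+1} => m == (c.1 + c.2)%MM)
    (fun c => polyfun_on_mul (H1 c.1) (G1 c.2)).
  by apply: polyfun_on_ext HS => D _; rewrite mcoeffM.
exists (N + N')%N => D XD; have [->|H0] := eqVneq (H D) 0; first by rewrite mul0r msize0.
have [->|G0] := eqVneq (G D) 0; first by rewrite mulr0 msize0.
by rewrite msizeM // (leq_trans (leq_pred _)) // leq_add ?HN ?GN.
Qed.

Lemma polyfunm_sum (I : Type) (r : seq I) (F : I -> T -> {mpoly k[n]}) :
  (forall i, polyfunm (F i)) -> polyfunm (fun D => \sum_(i <- r) F i D).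
Proof.
move=> H; elim: r => [|i r [IH1 [N IH2]]].
  split=> [m|]; last by exists 0%N => D _; rewrite big_nil msize0.
  by apply: polyfun_on_ext (polyfun_on_const x X 0) => D _; rewrite big_nil mcoeff0.
have [A1 [N' A2]] := polyfunm_add (H i) (conj IH1 (ex_intro _ N IH2)).
split=> [m|]; first by apply: polyfun_on_ext (A1 m) => D _; rewrite big_cons.
by exists N' => D XD; rewrite big_cons A2.
Qed.

Lemma polyfunm_exp H m : polyfunm H -> polyfunm (fun D => H D ^+ m).
Proof.
move=> HH; elim: m => [|m [IH1 [N IH2]]].
  have [A1 [N A2]] := polyfunm_const 1.
  by split=> [m|]; [apply: polyfun_on_ext (A1 m) => D _|exists N => D XD; have := A2 D XD];
     rewrite expr0.
have [A1 [N' A2]] := polyfunm_mul HH (conj IH1 (ex_intro _ N IH2)).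
by split=> [l|]; [apply: polyfun_on_ext (A1 l) => D _|exists N' => D XD; have := A2 D XD];
   rewrite exprS.
Qed.

Lemma polyfunm_slice H e a b : polyfunm H -> polyfun2 x X (fun D => slice e a b (H D)).
Proof.
move=> [H1 [N HN]].
apply: (@polyfun2_ext _ _ _ _ _ (fun D => \sum_(m : 'X_{1..n < N}) ((H D)@_m)%:P%:P * slice e a b 'X_[m])).
  move=> D XD; rewrite [in RHS](mpolywE (HN D XD)) /slice raddf_sum /=.
  by apply: eq_bigr => m _; rewrite mmapZ.
move=> i j.
have HS := polyfun_on_sum (index_enum ('X_{1..n < N} : finType)) xpredT
  (fun m => polyfun_on_mul (H1 (bmnm m)) (polyfun_on_const x X ((slice e a b 'X_[m])`_i`_j))).
by apply: polyfun_on_ext HS => D XD; rewrite !coef_sum; apply: eq_bigr => m _; rewrite !coefCM.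
Qed.

Lemma polyfunm_meval H v : polyfunm H -> pf (fun D => (H D).@[v]).
Proof.
move=> [H1 [N HN]].
have HS := polyfun_on_sum (index_enum ('X_{1..n < N} : finType)) xpredT
  (fun m => polyfun_on_mul (H1 (bmnm m)) (polyfun_on_const x X ('X_[m]).@[v])).
apply: polyfun_on_ext HS => D XD; rewrite [in RHS](mpolywE (HN D XD)) raddf_sum /=.
by apply: eq_bigr => m _; rewrite mevalZ.
Qed.

Lemma polyfunm_mderiv H i : polyfunm H -> polyfunm (fun D => (H D)^`M(i)).
Proof.
move=> [H1 [N HN]]; split=> [m|].
  apply: polyfun_on_ext (polyfun_on_mul (polyfun_on_const x X (m i).+1%:R) (H1 (m + U_(i))%MM)) => D _.
  by rewrite mcoeff_deriv mulr_natl.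
exists N => D XD; rewrite msizeE; apply/bigmax_leqP_seq => m; rewrite mcoeff_msupp mcoeff_deriv => m0 _.
have /msize_mdeg_lt : (m + U_(i))%MM \in msupp (H D).
  by rewrite mcoeff_msupp; apply: contraNneq m0 => ->; rewrite mul0rn.
by rewrite mdegD mdeg1 addn1 => lt; apply: leq_trans (HN D XD); apply: ltnW.
Qed.

End PolyfunMpoly.

(** * Permutti polynomials *)

Section Homog.
Variables (k : fieldType) (m : nat).
Implicit Types p : {mpoly k[m]}.

Lemma dhomog_msize_le p d : p \is d.-homog -> (msize p <= d.+1)%N.
Proof.
move=> /dhomogP Hp; rewrite msizeE; apply/bigmax_leqP_seq => mm Hm _.
by rewrite ltnS (Hp mm Hm).
Qed.

Lemma dhomog_msize p d : p \is d.-homog -> p != 0 -> msize p = d.+1.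
Proof. by move=> hp p0; rewrite -(mlead_deg p0) (dhomog_mf hp) // mlead_supp. Qed.

Lemma meval_homog p d c v : p \is d.-homog -> p.@[fun i => c * v i] = c ^+ d * p.@[v].
Proof.
move=> hp; rewrite [p]mpolyE !raddf_sum /= big_seq [in RHS]big_seq mulr_sumr.
apply: eq_bigr => mm Hm; rewrite !mevalZ !mevalX mulrCA; congr (_ * _).
have -> : d = mdeg mm by rewrite -(dhomog_mf hp Hm).
rewrite mdegE -prodrXr -big_split /=.
by apply: eq_bigr => i _; rewrite exprMn.
Qed.

End Homog.

Lemma poly2_ext (k : fieldType) (P Q : {poly {poly k}}) : [pchar k] =i pred0 ->
  (forall z s : k, P.[z%:P].[s] = Q.[z%:P].[s]) -> P = Q.
Proof.
move=> char0 H; apply/polyP => i; apply: (poly_ext char0) => s.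
suff E : map_poly (horner_eval s) P = map_poly (horner_eval s) Q.
  by have := congr1 (fun q : {poly k} => q`_i) E; rewrite !coef_map.
apply: (poly_ext char0) => z; have := H z s.
have Ez : horner_eval s z%:P = z by rewrite /horner_eval hornerC.
by rewrite -{3 4}Ez !horner_map.
Qed.

Lemma avoid_seq (k : fieldType) (L : seq k) : [pchar k] =i pred0 -> exists x, x \notin L.
Proof.
move=> char0; apply: NNPP => H.
have : \prod_(a <- L) ('X - a%:P) != 0 :> {poly k}.
  by apply: monic_neq0; apply: monic_prod_XsubC.
case/eqP; apply: (poly_ext0 char0) => x; apply/eqP; rewrite -/(root _ _) root_prod_XsubC.
by apply: NNPP => Hx; apply: H; exists x; apply/negP.
Qed.

Section PermuttiBasics.
Variables (k : fieldType) (r t n d mu : nat).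
Hypothesis char0 : [pchar k] =i pred0.
Hypotheses (ht : (t <= r)%N) (hmu : (mu * n <= d)%N).
Local Notation X := (@pdata_wf k r t mu n d).
Local Notation coords := (@pdata_coef k r t mu).
Implicit Types D : pdata k r t mu.

Lemma meval_outer (p : {mpoly k[r.+1]}) v v' : outer_vars t p ->
  (forall i : 'I_r.+1, (t < i)%N -> v i = v' i) -> p.@[v] = p.@[v'].
Proof.
move=> op E; rewrite [p]mpolyE !raddf_sum /= big_seq [in RHS]big_seq.
apply: eq_bigr => mm Hm; rewrite !mevalZ !mevalX; congr (_ * _).
apply: eq_bigr => i _; have [lt_i|le_i] := ltnP t i; first by rewrite E.
by rewrite (op mm Hm i le_i) !expr0.
Qed.

Lemma outer_varsD p q : outer_vars t p -> outer_vars t q -> outer_vars (k := k) (r := r) t (p + q).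
Proof. by move=> Hp Hq mm /msuppD_le; rewrite mem_cat => /orP[/Hp|/Hq]. Qed.

Lemma outer_varsZ c p : outer_vars t p -> outer_vars (k := k) (r := r) t (c *: p).
Proof. by move=> Hp mm /msuppZ_le/Hp. Qed.

Lemma outer_varsM p q : outer_vars t p -> outer_vars t q -> outer_vars (k := k) (r := r) t (p * q).
Proof.
move=> Hp Hq mm /msuppM_le/allpairsP[[m1 m2] /= [H1 H2 ->]] i le_i.
by rewrite mnmDE Hp ?Hq.
Qed.

Lemma outer_vars1 : outer_vars (k := k) (r := r) t 1.
Proof.
move=> mm; rewrite mcoeff_msupp mcoeff1; case: (mm =P 0%MM) => [-> _ i _|]; last by rewrite eqxx.
by rewrite mnm0E.
Qed.

Lemma outer_varsXn p e : outer_vars t p -> outer_vars (k := k) (r := r) t (p ^+ e).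
Proof.
move=> Hp; elim: e => [|e IH]; first by rewrite expr0; exact: outer_vars1.
by rewrite exprS; apply: outer_varsM.
Qed.

Lemma outer_varsX (j : 'I_r.+1) : (t < j)%N -> outer_vars (k := k) (r := r) t 'X_j.
Proof.
move=> lt_j mm; rewrite msuppX inE => /eqP -> i le_i; rewrite mnm1E.
by case: eqP => // E; move: lt_j; rewrite E ltnNge le_i.
Qed.

Lemma outer_vars0 : outer_vars (k := k) (r := r) t 0.
Proof. by move=> mm; rewrite mcoeff_msupp mcoeff0 eqxx. Qed.

Lemma meval_Qform D v : (Qform D).@[v] = \sum_(i < t.+1) (coreM D i).@[v] * v (inord i).
Proof. by rewrite /Qform raddf_sum /=; apply: eq_bigr => i _; rewrite mevalM mevalXU. Qed.

Lemma meval_permutti D v :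
  (permutti D).@[v] = \sum_(l < mu.+1) (Qform D).@[v] ^+ l * (coefP D l).@[v].
Proof.
by rewrite /permutti raddf_sum /=; apply: eq_bigr => l _; rewrite mevalM rmorphXn.
Qed.

Lemma Qform_homog D : X D -> (0 < n)%N -> Qform D \is n.-homog.
Proof.
move=> [HM _ _] n0; apply: rpred_sum => i _; have [hM _] := HM i.
by have := dhomogM hM (_ : 'X_(inord i) \is 1.-homog); rewrite subnK //; apply; rewrite dhomogX /= mdeg1.
Qed.

Lemma permutti_homog D : X D -> (0 < n)%N -> permutti D \is d.-homog.
Proof.
move=> XD n0; have [_ _ HP] := XD; apply: rpred_sum => l _; have [hP _] := HP l.
have le_l : (l * n <= d)%N.
  by apply: leq_trans hmu; rewrite leq_mul2r -ltnS ltn_ord orbT.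
have := dhomogM (dhomogMn l (Qform_homog XD n0)) hP.
by rewrite [(n * l)%N]mulnC subnKC.
Qed.

Lemma polyfunm_coreM i : polyfunm coords X (fun D => coreM D i).
Proof.
split=> [m|]; first exact: (polyfun_onW _ (polyfun_coord coords (inl i, m))).
by exists (n - 1).+1 => D [HM _ _]; apply: dhomog_msize_le; case: (HM i).
Qed.

Lemma polyfunm_coefP l : polyfunm coords X (fun D => coefP D l).
Proof.
split=> [m|]; first exact: (polyfun_onW _ (polyfun_coord coords (inr l, m))).
by exists (d - l * n).+1 => D [_ _ HP]; apply: dhomog_msize_le; case: (HP l).
Qed.

Lemma polyfunm_permutti : polyfunm coords X (fun D => permutti D).
Proof.
apply: polyfunm_sum => l; apply: polyfunm_mul; last exact: polyfunm_coefP.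
apply: polyfunm_exp; apply: polyfunm_sum => i.
by apply: polyfunm_mul; [exact: polyfunm_coreM|exact: polyfunm_const].
Qed.

Lemma polyfun_coords_eq h D D' : polyfun coords h ->
  (forall i, coreM D i = coreM D' i) -> (forall l, coefP D l = coefP D' l) -> h D = h D'.
Proof.
move=> [s [c [p H]]] EM EP; rewrite !H; apply: meval_eq => l.
by rewrite /pdata_coef; case: (c l) => [[i|i] mm] /=; rewrite ?EM ?EP.
Qed.

Lemma move_coefP D0 W P' h : X D0 -> zopen coords W -> W D0 ->
  (forall l : 'I_mu.+1, P' l \is (d - l * n).-homog /\ outer_vars t (P' l)) ->
  polyfun coords h -> h (PData (coreM D0) P') != 0 ->
  exists D1, [/\ X D1, W D1, h D1 != 0 & coreM D1 = coreM D0].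
Proof.
move=> XD0 oW WD0 HP' ph hD; have [w [pw w0 wW]] := zopen_polyfun oW WD0.
pose L c := PData (coreM D0) (fun l => coefP D0 l + c *: (P' l - coefP D0 l)).
have [HM AD HP] := XD0.
have XL c : X (L c).
  split=> // l /=; have [h1 h2] := HP l; have [h3 h4] := HP' l; split.
    by rewrite dhomogD // dhomogZ // dhomogD // dhomogN.
  by apply: outer_varsD => //; apply/outer_varsZ/outer_varsD => //;
    rewrite -scaleN1r; apply: outer_varsZ.
have HL j : exists p : {poly k}, forall c, coords j (L c) = p.[c].
  case: j => -[i|l] mm; rewrite /pdata_coef /=.
    by exists ((coreM D0 i)@_mm)%:P => c; rewrite hornerC.
  exists (((coefP D0 l)@_mm)%:P + ((P' l)@_mm - (coefP D0 l)@_mm)%:P * 'X) => c.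
  by rewrite mcoeffD mcoeffZ mcoeffB !hornerE mulrC.
have [||e [we he]] := line_meets (c := 0) (c' := 1) char0 HL pw ph.
- by rewrite (@polyfun_coords_eq _ (L 0) D0) //= => l; rewrite scale0r addr0.
- rewrite (@polyfun_coords_eq _ (L 1) (PData (coreM D0) P')) //= => l.
  by rewrite scale1r addrC subrK.
by exists (L e); split=> //; apply: wW.
Qed.

(** If M_0 = 0, it is replaced by c N, where N is a nonzero M_j with j > 0, or any nonzero form if
    all M_i vanish. A relation survives: M_0 remains proportional to M_j in the first case, and M_j
    = 0 in the second. *)
Lemma move_coreM0 D0 W : (1 <= t)%N -> (t < r)%N -> X D0 -> zopen coords W -> W D0 ->
  exists D1, [/\ X D1, W D1 & coreM D1 ord0 != 0].
Proof.
move=> t1 tr XD0 oW WD0; have [w [pw w0 wW]] := zopen_polyfun oW WD0.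
have [M0|M0] := eqVneq (coreM D0 ord0) 0; last by exists D0.
have [HM AD HP] := XD0.
have [N [j [hN oN N0 j0 HN]]] : exists N j, [/\ N \is (n - 1).-homog, outer_vars t N, N != 0,
   j != ord0 & exists c0, coreM D0 j = c0 *: N].
  have [[j Mj]|H] := classic (exists j, coreM D0 j != 0).
    exists (coreM D0 j), j; have [h1 h2] := HM j; split=> //; last by exists 1; rewrite scale1r.
    by apply: contraNneq Mj => ->; rewrite M0.
  exists ('X_ord_max ^+ (n - 1)), ord_max; split.
  - have := dhomogMn (n - 1) (_ : ('X_ord_max : {mpoly k[r.+1]}) \is 1.-homog).
    by rewrite mul1n; apply; rewrite dhomogX /= mdeg1.
  - exact/outer_varsXn/outer_varsX.
  - by rewrite mpolyXn -msupp_eq0 msuppX.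
  - by rewrite -val_eqE /= -lt0n.
  - by exists 0; rewrite scale0r; apply: NNPP => /eqP Hj; apply: H; exists ord_max.
have [c0 Ec0] := HN.
pose L c := PData (fun i => if i == ord0 then c *: N else coreM D0 i) (coefP D0).
have XL c : X (L c).
  split=> //= [i|].
    case: eqP => _; last exact: HM.
    by split; [rewrite dhomogZ|apply: outer_varsZ].
  have [c00|c00] := eqVneq c0 0.
    exists 'X_j; first by rewrite -msupp_eq0 msuppX.
    by rewrite comp_mpolyXU -tnth_nth tnth_mktuple (negPf j0) Ec0 c00 scale0r.
  exists (c0 *: 'X_ord0 - c *: 'X_j).
    apply: contraNneq c00 => /(congr1 (mcoeff U_(ord0))).
    by rewrite mcoeffB !mcoeffZ !mcoeffXU mcoeff0 eqxx (negPf j0) mulr1 mulr0 subr0 => /eqP.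
  by rewrite comp_mpolyB !comp_mpolyZ !comp_mpolyXU -!tnth_nth !tnth_mktuple eqxx (negPf j0) Ec0
     !scalerA mulrC subrr.
have [mm Nm] : exists mm, N@_mm != 0.
  by exists (mlead N); rewrite mleadc_eq0.
have HL j' : exists p : {poly k}, forall c, coords j' (L c) = p.[c].
  case: j' => -[i|l] m'; rewrite /pdata_coef /=; last first.
    by exists ((coefP D0 l)@_m')%:P => c; rewrite hornerC.
  case: eqP => _; last by exists ((coreM D0 i)@_m')%:P => c; rewrite hornerC.
  by exists ((N@_m')%:P * 'X) => c; rewrite mcoeffZ !hornerE mulrC.
have [||e [we he]] := line_meets (c := 0) (c' := 1) char0 HL pw (polyfun_coord coords (inl ord0, mm)).
- by rewrite (@polyfun_coords_eq _ (L 0) D0) //= => l; case: eqP => // ->; rewrite scale0r M0.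
- by rewrite /pdata_coef /= scale1r.
exists (L e); split=> //; first exact: wW.
by apply: contraNneq he => E; move: E; rewrite /pdata_coef /= => ->; rewrite mcoeff0.
Qed.

End PermuttiBasics.

Section InnerOuter.
Variables (k : fieldType) (r t mu : nat).
Hypothesis ht : (t <= r)%N.
Implicit Types (D : pdata k r t mu) (p : {mpoly k[r.+1]}).

Definition inner0 (v : 'I_r.+1 -> k) := forall i : 'I_r.+1, (i <= t)%N -> v i = 0.

Definition dir0 (i : 'I_r.+1) : k := (i == ord0)%:R.

Lemma inord_eq0 (i : 'I_t.+1) : ((inord i : 'I_r.+1) == ord0) = (i == ord0).
Proof. by rewrite -!val_eqE /= inordK // (leq_trans (ltn_ord i)). Qed.

Lemma inord_le (i : 'I_t.+1) : ((inord i : 'I_r.+1) <= t)%N.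
Proof. by rewrite inordK ?(leq_trans (ltn_ord i)) // -ltnS. Qed.

(** This singles out M_0: on a plane spanned by the first coordinate direction and a line in the
    outer variables, Q restricts to M_0 z, and f to a polynomial in z with coefficients M_0^l
    P_l. *)
Lemma meval_Qform_dir0 D v z : inner0 v ->
  (Qform D).@[fun i => v i + dir0 i * z] = (coreM D ord0).@[fun i => v i + dir0 i * z] * z.
Proof.
move=> v0; rewrite meval_Qform (bigD1 ord0) //= big1 ?addr0 => [|i i0].
  have -> : inord 0 = ord0 :> 'I_r.+1 by apply/val_inj; rewrite /= inordK.
  by rewrite v0 // /dir0 eqxx mul1r add0r.
by rewrite v0 ?inord_le // /dir0 inord_eq0 (negPf i0) mul0r addr0 mulr0.
Qed.

Lemma outer_dir0 p v z : outer_vars t p -> p.@[fun i => v i + dir0 i * z] = p.@[v].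
Proof.
move=> op; apply: (meval_outer op) => i lt_i; rewrite /dir0 -val_eqE /=.
by case: (i : nat) lt_i => // j _; rewrite mul0r addr0.
Qed.

Lemma Qform_inner0 D w : inner0 w -> (Qform D).@[w] = 0.
Proof.
move=> w0; rewrite meval_Qform big1 // => i _; rewrite w0 ?mulr0 //.
by rewrite inord_le.
Qed.

End InnerOuter.

Section PermuttiSlice.
Variables (k : closedFieldType) (r t n d mu : nat).
Hypothesis char0 : [pchar k] =i pred0.
Hypotheses (ht1 : (1 <= t)%N) (htr : (t.+2 <= r)%N) (hn : (1 <= n)%N) (hnd : (n < d)%N).
Hypotheses (hmu0 : (0 < mu)%N) (hmu : (mu * n <= d)%N).
Local Notation X := (@pdata_wf k r t mu n d).
Local Notation coords := (@pdata_coef k r t mu).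
Implicit Types D : pdata k r t mu.

Local Notation dir0 := (@dir0 k r).
Local Notation inner0 := (@inner0 k r t).

Let ht : (t <= r)%N. Proof. by lia. Qed.
Let htr1 : (t < r)%N. Proof. by lia. Qed.
Let htr2 : (t < r.-1)%N. Proof. by lia. Qed.
Let hd0 : (0 < d)%N. Proof. by lia. Qed.

Definition line_part a b (f : {mpoly k[r.+1]}) : {poly k} := (slice dir0 a b f)`_0.

Lemma horner_line_part a b f s : (line_part a b f).[s] = f.@[fun i => b i + a i * s].
Proof.
have E0 : (0 : {poly k}) = (0 : k)%:P by rewrite polyC0.
rewrite /line_part -horner_coef0 E0 horner_slice.
by apply: meval_eq => i; rewrite mulr0 addr0.
Qed.

Lemma slice_permutti D a b : X D -> inner0 a -> inner0 b ->
  slice dir0 a b (permutti D) = \poly_(l < mu.+1)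
    (line_part a b (coreM D ord0) ^+ l * line_part a b (coefP D (inord l))).
Proof.
move=> [HM _ HP] a0 b0; apply: (poly2_ext char0) => z s.
have ab0 : inner0 (fun i => b i + a i * s) by move=> i le_i; rewrite a0 // b0 // mul0r addr0.
have [_ oM] := HM ord0.
rewrite horner_slice meval_permutti (meval_Qform_dir0 ht D z ab0) (outer_dir0 _ z oM).
rewrite horner_poly -[RHS]/(horner_eval s _) raddf_sum; apply: eq_bigr => l _.
have [_ oP] := HP l; rewrite inord_val (outer_dir0 _ z oP).
rewrite /= /horner_eval !hornerM !horner_exp hornerC !horner_line_part exprMn.
by rewrite -!mulrA; congr (_ * _); rewrite mulrC.
Qed.

Definition z_line D (b : 'I_r.+1 -> k) : {poly k} :=
  \poly_(l < mu.+1) ((coreM D ord0).@[b] ^+ l * (coefP D (inord l)).@[b]).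

Lemma slice_at0 D a b : X D -> inner0 a -> inner0 b ->
  map_poly (horner_eval 0) (slice dir0 a b (permutti D)) = z_line D b.
Proof.
move=> XD a0 b0; rewrite slice_permutti //; apply/polyP => l.
rewrite coef_map !coef_poly; case: ltnP => _ /=; last by rewrite /horner_eval horner0.
rewrite /horner_eval hornerM horner_exp !horner_line_part; congr (_ ^+ _ * _);
by apply: meval_eq => i; rewrite mulr0 addr0.
Qed.

(* The polynomial [z_line D b] is the restriction of the equation to the line through the
   point b in the direction of the first coordinate vector. *)
Definition slice_good D := (exists a b : 'I_r.+1 -> k,
    [/\ inner0 a, inner0 b, ruppert mu d (slice dir0 a b (permutti D)),
    size (z_line D b) = mu.+1 & coprimep (z_line D b) (z_line D b)^`()]).

Lemma coprimep_noroot (p q : {poly k}) : (forall x, root p x -> q.[x] != 0) -> coprimep p q.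
Proof. by move=> H; apply/Pdiv.ClosedField.coprimepP => x /H. Qed.

Lemma slice_good_sample D : X D -> coreM D ord0 != 0 ->
  exists P', (forall l : 'I_mu.+1, P' l \is (d - l * n).-homog /\ outer_vars t (P' l)) /\
   exists h, [/\ polyfun coords h, h (PData (coreM D) P') != 0 &
      forall D', X D' -> h D' != 0 -> slice_good D'].
Proof.
move=> XD M0; have [HM AD HP] := XD; have [hM oM] := HM ord0.
have [v] : exists v, (coreM D ord0 * 'X_ord_max).@[v] != 0.
  by apply: (mpoly_neq0P char0); rewrite mulf_neq0 // -msupp_eq0 msuppX.
rewrite mevalM mevalXU mulf_eq0 negb_or => /andP[Mv vmax].
(* As t <= r - 2, both x_(r-1) and x_r are outer variables: the line runs along the first, while the
   second is constant and nonzero on it. *)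
pose j1 : 'I_r.+1 := inord r.-1.
have j1E : j1 = r.-1 :> nat by rewrite inordK //; lia.
have j1m : j1 != ord_max by rewrite -val_eqE /= j1E; lia.
pose a (i : 'I_r.+1) : k := (i == j1)%:R.
pose b (i : 'I_r.+1) : k := if (i <= t)%N then 0 else v i.
have a0 : inner0 a by move=> i le_i; rewrite /a -val_eqE /= j1E; case: eqP => // E; lia.
have b0 : inner0 b by move=> i le_i; rewrite /b le_i.
have bo (i : 'I_r.+1) : (t < i)%N -> b i = v i by move=> lt_i; rewrite /b leqNgt lt_i.
have Mb : (coreM D ord0).@[b] != 0 by rewrite (meval_outer oM (v' := v)).
pose N := line_part a b (coreM D ord0).
have N0 : N.[0] != 0.
  by rewrite horner_line_part (meval_eq (v2 := b)) // => i; rewrite mulr0 addr0.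
have Nn0 : N != 0 by apply: contraNneq N0 => ->; rewrite horner0.
have [rs ErN] := closed_field_poly_normal N.
(* tau is nonzero, so s^d - tau has simple roots, and it is not the d-th power of a root of N, so
   s^d - tau is coprime to N^mu. *)
have [tau] := avoid_seq (0 :: [seq rho ^+ d | rho <- rs]) char0.
rewrite inE negb_or => /andP[tau0 taurs].
(* On the chosen line l2 is the constant 1 and l1 the coordinate s; powers of l2 thus homogenize
   without changing the restriction. *)
pose l2 : {mpoly k[r.+1]} := (v ord_max)^-1 *: 'X_ord_max.
pose l1 : {mpoly k[r.+1]} := 'X_j1 - v j1 *: l2.
have X1 (j : 'I_r.+1) : ('X_j : {mpoly k[r.+1]}) \is 1.-homog by rewrite dhomogX /= mdeg1.
have hl2 : l2 \is 1.-homog by rewrite dhomogZ.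
have hl1 : l1 \is 1.-homog by rewrite dhomogD // dhomogN dhomogZ.
have ol2 : outer_vars t l2 by apply: outer_varsZ; exact: outer_varsX.
have ol1 : outer_vars t l1.
  apply: outer_varsD; first by apply: outer_varsX; rewrite j1E.
  by rewrite -scaleN1r; do 2 apply: outer_varsZ.
have el2 s : l2.@[fun i => b i + a i * s] = 1.
  rewrite mevalZ mevalXU bo //.
  by rewrite /a eq_sym (negPf j1m) mul0r addr0 mulVf.
have el1 s : l1.@[fun i => b i + a i * s] = s.
  rewrite mevalB mevalZ el2 mevalXU bo; last by rewrite j1E.
  by rewrite /a eqxx mul1r mulr1 addrC addKr.
have hX (l : {mpoly k[r.+1]}) e : l \is 1.-homog -> l ^+ e \is e.-homog.
  by move=> hl; have := dhomogMn e hl; rewrite mul1n.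
pose P' (l : 'I_mu.+1) : {mpoly k[r.+1]} :=
  if l == ord_max then l2 ^+ (d - mu * n) else if l == ord0 then l1 ^+ d - tau *: l2 ^+ d else 0.
have wfP (l : 'I_mu.+1) : P' l \is (d - l * n).-homog /\ outer_vars t (P' l).
  rewrite /P'; case: eqP => [->|_] /=; first by split; [exact: hX|exact: outer_varsXn].
  case: eqP => [->|_] /=; last by split; [exact: dhomog0|exact: outer_vars0].
  rewrite mul0n subn0; split.
    by rewrite dhomogD ?dhomogN ?dhomogZ ?hX.
  apply: outer_varsD; first exact: outer_varsXn.
  by rewrite -scaleN1r; do 2 apply: outer_varsZ; apply: outer_varsXn.
exists P'; split=> //; pose D1 := PData (coreM D) P'.
have XD1 : X D1 by [].
pose q : {poly k} := 'X^d - tau%:P.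
have d0 := hd0.
have sq : size q = d.+1 by rewrite size_XnsubC.
have EP0 : line_part a b (P' ord0) = q.
  apply: (poly_ext char0) => s; rewrite horner_line_part /P' -val_eqE /= eq_sym.
  rewrite gtn_eqF //= mevalB mevalZ !rmorphXn /= el1 el2 expr1n mulr1.
  by rewrite !hornerE ?horner_exp ?hornerX.
have EPm : line_part a b (P' ord_max) = 1.
  apply: (poly_ext char0) => s.
  by rewrite horner_line_part /P' eqxx rmorphXn /= el2 expr1n hornerC.
have EP (l : 'I_mu.+1) : l != ord0 -> l != ord_max -> line_part a b (P' l) = 0.
  move=> l0 lm; apply: (poly_ext char0) => s.
  by rewrite horner_line_part /P' (negPf l0) (negPf lm) meval0 horner0.
have o0 : ord0 != ord_max :> 'I_mu.+1 by rewrite -val_eqE /= eq_sym -lt0n.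
have Esl : slice dir0 a b (permutti D1) = (N ^+ mu)%:P * 'X^mu + q%:P.
  rewrite slice_permutti // poly_def (bigD1 ord_max) //= (bigD1 ord0) //= big1 ?addr0.
    rewrite -/N; have -> : inord mu = ord_max :> 'I_mu.+1 by apply/val_inj; rewrite /= inordK.
    have -> : inord 0 = ord0 :> 'I_mu.+1 by apply/val_inj; rewrite /= inordK.
    by rewrite EPm EP0 mulr1 expr0 mul1r !mul_polyC expr0 alg_polyC.
  by move=> l /andP[lm l0]; rewrite /= inord_val EP // mulr0 scale0r.
have cop : coprimep q (N ^+ mu).
  apply: coprimep_expr; apply: coprimep_noroot => x; rewrite /root !hornerE ?horner_exp ?hornerX subr_eq0.
  move=> /eqP xd; apply: contra taurs => Nx; apply/mapP; exists x => //.
  move: Nx; rewrite -/(root N x) ErN rootZ ?lead_coef_eq0 // root_prod_XsubC //.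
have [rho qrho] : exists rho, root q rho by apply/closed_rootP; rewrite sq eqSS -lt0n.
have rhod : rho ^+ d = tau.
  by move: qrho; rewrite /root !hornerE ?horner_exp ?hornerX subr_eq0 => /eqP.
have rho0 : rho != 0 by apply: contraNneq tau0 => E; rewrite -rhod E expr0n gtn_eqF.
have prho : (N ^+ mu).[rho] != 0.
  by move/Pdiv.ClosedField.coprimepP: cop => /(_ rho qrho); rewrite /root.
have q'rho : q^`().[rho] != 0.
  rewrite derivB derivXn derivC subr0 hornerMn !hornerE ?horner_exp ?hornerX -mulr_natr.
  by rewrite mulf_neq0 ?natr_eq0 ?expf_neq0 // -lt0n.
have rup : ruppert mu d (slice dir0 a b (permutti D1)).
  by rewrite Esl; apply: (ruppert_binomial char0 (rho := rho)).
have Ez : z_line D1 b = (N.[0] ^+ mu) *: 'X^mu - tau%:P.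
  rewrite -(slice_at0 XD1 a0 b0) Esl rmorphD rmorphM /= map_polyXn !map_polyC /=.
  rewrite /horner_eval !hornerE ?horner_exp ?hornerX expr0n gtn_eqF // sub0r mul_polyC.
  by rewrite polyCN ?horner_exp.
have Nm0 : N.[0] ^+ mu != 0 by rewrite expf_neq0.
have sz : size (z_line D1 b) = mu.+1.
  rewrite Ez size_polyDl size_scale // size_polyXn // size_polyN.
  by apply: leq_ltn_trans (size_polyC_leq1 _) _; rewrite ltnS.
have copz : coprimep (z_line D1 b) (z_line D1 b)^`().
  apply: coprimep_noroot => x; rewrite Ez /root derivB derivZ derivXn derivC subr0 !hornerE.
  rewrite ?hornerMn ?horner_exp ?hornerX => /eqP E.
  have x0 : x != 0.
    by apply: contraNneq tau0 => Ex; move: E; rewrite Ex expr0n gtn_eqF // mulr0 sub0r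
       => /eqP; rewrite oppr_eq0.
  by rewrite -mulr_natr !mulf_neq0 ?natr_eq0 ?expf_neq0 // -lt0n.
have pfs : polyfun2 coords X (fun D => slice dir0 a b (permutti D)).
  by apply: polyfunm_slice; apply: polyfunm_permutti.
have [h1 [ph1 h10 H1]] := open_ruppert pfs XD1 d0 rup.
have pfz : polyfun1 coords X (fun D => z_line D b).
  apply: (@polyfun1_ext _ _ _ _ _ (fun D => map_poly (horner_eval 0) (slice dir0 a b (permutti D)))).
    by move=> D' XD'; rewrite slice_at0.
  move=> i; apply: polyfun_on_ext (pfs i 0%N) => D' _.
  by rewrite coef_map /= /horner_eval horner_coef0.
have [h2 [ph2 h20 H2]] := open_separable pfz XD1 (fun D' _ => size_poly _ _) hmu0 sz copz.
exists (fun D' => h1 D' * h2 D'); split; [exact: polyfun_mul|exact: mulf_neq0|].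
move=> D' XD'; rewrite mulf_eq0 negb_or => /andP[hD1 hD2].
by have [s' c'] := H2 D' XD' hD2; exists a, b; split; [exact: a0|exact: b0|exact: H1|exact: s'|exact: c'].
Qed.

Lemma generically_slice_good : generically_in coords X slice_good.
Proof.
apply: generically_intro => D0 W XD0 oW WD0.
have [D1 [X1 W1 M1]] := move_coreM0 char0 ht1 htr1 XD0 oW WD0.
have [P' [wfP [h [ph hP HG]]]] := slice_good_sample X1 M1.
have [D2 [X2 W2 h2 _]] := move_coefP char0 X1 oW W1 wfP ph hP.
by exists D2; split=> //; exists h.
Qed.

Lemma generically_coreM0 : generically_in coords X (fun D => coreM D ord0 != 0).
Proof.
apply: generically_intro => D0 W XD0 oW WD0.
have [D1 [X1 W1 M1]] := move_coreM0 char0 ht1 htr1 XD0 oW WD0.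
exists D1; split=> //.
exists (fun D => coords (inl ord0, mlead (coreM D1 ord0)) D); split; first exact: polyfun_coord.
  by rewrite /pdata_coef /= mleadc_eq0.
by move=> D XD; apply: contraNneq => E; rewrite /pdata_coef /= E mcoeff0.
Qed.

Lemma slice_good_irreducible D g h : X D -> slice_good D -> permutti D = g * h ->
  (msize g <= 1)%N \/ (msize h <= 1)%N.
Proof.
move=> XD [a [b [a0 b0 rup sz cop]]] E.
have s0 : size (slice dir0 a b (permutti D)) = mu.+1.
  apply/eqP; rewrite eqn_leq {1}slice_permutti // size_poly /=.
  by rewrite -sz -(slice_at0 XD a0 b0) size_poly.
have f0 : permutti D != 0.
  apply: contra_eq_neq s0 => ->; rewrite -mpolyC0 sliceC !polyC0 size_poly0.
  by [].
apply: (slice_irreducible char0 E (dhomog_msize (permutti_homog hmu XD hn) f0) hmu0 s0 rup);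
  by rewrite slice_at0.
Qed.

Lemma slice_good_neq0 D : X D -> slice_good D -> permutti D != 0.
Proof.
move=> XD [a [b [a0 b0 _ sz _]]]; apply: contra_eq_neq sz => E.
by rewrite -(slice_at0 XD a0 b0) E -mpolyC0 sliceC !polyC0 rmorph0 size_poly0.
Qed.

End PermuttiSlice.

(** * Relations among the forms M_i *)

Section Relations.
Variables (k : closedFieldType) (r t e : nat).
Hypothesis char0 : [pchar k] =i pred0.
Variable M : 'I_t.+1 -> {mpoly k[r.+1]}.
Hypothesis HM : forall i, M i \is e.-homog.

Lemma comp_relation (G : {mpoly k[t.+1]}) :
  G \mPo [tuple M i | i < t.+1] = 0 <-> forall w, G.@[fun i => (M i).@[w]] = 0.
Proof.
have E w : (G \mPo [tuple M i | i < t.+1]).@[w] = G.@[fun i => (M i).@[w]].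
  by rewrite comp_mpoly_meval; apply: meval_eq => i; rewrite tnth_mktuple.
split=> [G0 w|H]; first by rewrite -E G0 meval0.
by apply: (mpoly_ext0 char0) => w; rewrite E.
Qed.

Lemma lin_dependent_const : (1 <= t)%N -> e = 0%N -> lin_dependent M.
Proof.
move=> t1 e0; have Mc i : M i = ((M i)@_0%MM)%:MP.
  by apply: msize1_polyC; rewrite -e0; apply: dhomog_msize_le.
pose c i := (M i)@_0%MM; have [c0|c0] := eqVneq (c ord0) 0.
  exists (fun i => (i == ord0)%:R); first by exists ord0; rewrite eqxx oner_eq0.
  rewrite (bigD1 ord0) //= big1 => [|i /negPf->]; last by rewrite scale0r.
  by rewrite Mc -/(c ord0) c0 mpolyC0 scaler0 addr0.
have m0 : (ord_max : 'I_t.+1) != ord0 by rewrite -val_eqE /= -lt0n.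
exists (fun i => if i == ord0 then - c ord_max else if i == ord_max then c ord0 else 0).
  by exists ord_max; rewrite (negPf m0) eqxx.
rewrite (bigD1 ord0) //= (bigD1 ord_max) //= big1 => [|i /andP[/negPf-> /negPf->]]; last by rewrite scale0r.
rewrite eqxx (negPf m0) addr0 (Mc ord0) (Mc ord_max) -!mul_mpolyC -!mpolyCM -mpolyCD.
by rewrite -/(c ord0) -/(c ord_max) mulNr mulrC addNr mpolyC0.
Qed.

(** For e > 0, replacing w by a w separates the homogeneous components of a relation by powers of
    a^e, so each of them is a relation. For e = 0 nothing is separated, but constants satisfy a
    linear relation. *)
Lemma homog_relation : (1 <= t)%N -> alg_dependent M ->
  exists (G : {mpoly k[t.+1]}) c, [/\ G \is c.-homog, G != 0 & forall w, G.@[fun i => (M i).@[w]] = 0].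
Proof.
move=> t1 [G G0 /comp_relation GM]; have [e0|e0] := posnP e.
  have [c [i ci] Ec] := lin_dependent_const t1 e0.
  exists (\sum_j c j *: 'X_j), 1%N; split.
  - by apply: rpred_sum => j _; rewrite dhomogZ // dhomogX /= mdeg1.
  - apply: contraNneq ci => /(congr1 (mcoeff U_(i))); rewrite mcoeff0 raddf_sum /=.
    rewrite (bigD1 i) //= big1 ?addr0 => [|j /negPf ji]; last by rewrite mcoeffZ mcoeffXU ji mulr0.
    by rewrite mcoeffZ mcoeffXU eqxx mulr1 => /eqP.
  move=> w; transitivity ((\sum_j c j *: M j).@[w]); last by rewrite Ec meval0.
  by rewrite !raddf_sum /=; apply: eq_bigr => j _; rewrite !mevalZ mevalXU.
pose Gc c := pihomog mdeg c G.
have EG : G = \sum_(c < msize G) Gc c by rewrite -(pihomog_partitionE (leqnn _)).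
have [c Gc0] : exists c : 'I_(msize G), Gc c != 0.
  apply: NNPP => H; case/eqP: G0; rewrite EG big1 // => c _; apply: NNPP => /eqP ?.
  by apply: H; exists c.
exists (Gc c), (c : nat); split=> // [|w]; first exact: pihomogP.
pose v i := (M i).@[w].
have P0 : \sum_(l < msize G) (Gc l).@[v] *: 'X^(e * l) = 0 :> {poly k}.
  apply: (poly_ext0 char0) => a; rewrite -(GM (fun i => a * w i)) [in RHS]EG raddf_sum.
  rewrite -[LHS]/(horner_eval a _) raddf_sum; apply: eq_bigr => l _.
  rewrite /= /horner_eval hornerZ hornerXn exprM mulrC -(meval_homog _ _ (pihomogP _ l G)).
  by apply: meval_eq => i; rewrite (meval_homog _ _ (HM i)).
have := congr1 (fun p : {poly k} => p`_(e * c)) P0; rewrite coef0 coef_sum (bigD1 c) //=.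
rewrite coefZ coefXn eqxx mulr1 big1 ?addr0 // => l lc.
by rewrite coefZ coefXn eqn_pmul2l // eq_sym (negPf lc : (l == c :> nat) = false) mulr0.
Qed.

Lemma linear_form_meval (p : {mpoly k[r.+1]}) w : p \is 1.-homog ->
  p.@[w] = \sum_j p@_U_(j) * w j.
Proof.
move=> hp; suff {1}-> : p = \sum_j p@_U_(j) *: 'X_j.
  by rewrite raddf_sum; apply: eq_bigr => j _; rewrite /= mevalZ mevalXU.
apply/mpolyP => m; rewrite raddf_sum /=; have [m1|m1] := eqVneq (mdeg m) 1%N.
  have /mdeg1P[j /eqP Em] := introT eqP m1.
  rewrite Em (bigD1 j) //= big1 => [|l /negPf lj]; last by rewrite mcoeffZ mcoeffXU lj mulr0.
  by rewrite mcoeffZ mcoeffXU eqxx mulr1 addr0.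
rewrite (dhomog_nemf_coeff hp m1) big1 // => j _; rewrite mcoeffZ mcoeffX.
case: (_ =P m) m1 => [<-|_ _]; last by rewrite mulr0.
by rewrite mdeg1 eqxx.
Qed.

(** Linearly independent linear forms take arbitrary values simultaneously, so a relation between
    them would vanish everywhere. *)
Lemma lin_dependent_linear : e = 1%N -> alg_dependent M -> lin_dependent M.
Proof.
move=> e1 [G G0 /comp_relation GM]; apply: NNPP => ML; case/eqP: G0.
pose A : 'M[k]_(t.+1, r.+1) := \matrix_(i, j) (M i)@_U_(j).
have ME i w : (M i).@[w] = \sum_j A i j * w j.
  by rewrite linear_form_meval -?e1 //; apply: eq_bigr => j _; rewrite mxE.
have fA : row_free A.
  apply: inj_row_free => u uA; apply/rowP => i; rewrite mxE; apply: NNPP => ui; apply: ML.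
  exists (u 0); first by exists i; apply/eqP.
  apply: (mpoly_ext0 char0) => w; rewrite raddf_sum /=.
  transitivity ((u *m A *m (\col_j w j)) 0 0); last by rewrite uA mul0mx mxE.
  rewrite -mulmxA mxE; apply: eq_bigr => j _; rewrite mevalZ ME mxE; congr (_ * _).
  by apply: eq_bigr => l _; rewrite [(\col__ _) _ _]mxE.
apply: (mpoly_ext0 char0) => z.
rewrite -(GM (fun j => (pinvmx A *m (\col_i z i)) j 0)); apply: meval_eq => i.
rewrite ME; transitivity ((A *m (pinvmx A *m (\col_i z i))) i 0); last by rewrite mxE.
by rewrite mulmxA mulmxVp // mul1mx mxE.
Qed.

(** A homogeneous relation in two variables splits into linear factors over a closed field, and one
    of them already vanishes on (M_0, M_1) because polynomials form a domain. *)
Lemma lin_dependent_pair : t = 1%N -> alg_dependent M -> lin_dependent M.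
Proof.
move=> t1 MD; have [G [c [hG G0 GM]]] := homog_relation (eq_leq (esym t1)) MD.
have m0 : (ord_max : 'I_t.+1) != ord0 by rewrite -val_eqE /= t1.
have two (i : 'I_t.+1) : i = ord0 \/ i = ord_max.
  have lt_i := ltn_ord i; have [E|E] := eqVneq (i : nat) 0%N; [left|right];
    apply/val_inj => //=; move: t1 E lt_i; clear; lia.
have [M0|M0] := eqVneq (M ord0) 0.
  exists (fun i => (i == ord0)%:R); first by exists ord0; rewrite eqxx oner_eq0.
  rewrite (bigD1 ord0) //= big1 => [|i /negPf->]; last by rewrite scale0r.
  by rewrite M0 scaler0 addr0.
pose pt (a b : k) (i : 'I_t.+1) := if i == ord0 then a else b.
pose p : {poly k} := mmap polyC (fun i : 'I_t.+1 => if i == ord0 then 1 else 'X) G.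
have pE b : p.[b] = G.@[pt 1 b].
  rewrite /p; elim/mpoly_ringind: (G) => [a|i|g h Hg Hh|g h Hg Hh].
  - by rewrite mmapC hornerC mevalC.
  - by rewrite mmapX mmap1U mevalXU /pt; case: eqP => _; rewrite ?hornerC ?hornerX.
  - by rewrite mmapD hornerD mevalD -Hg -Hh.
  - by rewrite rmorphM hornerM mevalM -Hg -Hh.
have GE (v : 'I_t.+1 -> k) : v ord0 != 0 -> G.@[v] = v ord0 ^+ c * p.[v ord_max / v ord0].
  move=> v0; rewrite pE -(meval_homog _ _ hG); apply: meval_eq => i.
  by rewrite /pt; case: (two i) => ->; rewrite ?eqxx ?(negPf m0) ?mulr1 // mulrCA mulfV // mulr1.
have p0 : p != 0.
  apply: contraNneq G0 => p0; have : G * 'X_ord0 = 0.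
    apply: (mpoly_ext0 char0) => v; rewrite mevalM mevalXU.
    have [->|v0] := eqVneq (v ord0) 0; first by rewrite mulr0.
    by rewrite GE // p0 horner0 mulr0 mul0r.
  by move/eqP; rewrite mulf_eq0 -[_ == 0 in X in _ || X]msupp_eq0 msuppX orbF.
have [rs Ep] := closed_field_poly_normal p.
(* The factor M_0 covers the points where dehomogenizing by M_0 is impossible. *)
have : M ord0 * \prod_(a <- rs) (M ord_max - a *: M ord0) = 0.
  apply: (mpoly_ext0 char0) => w; rewrite mevalM rmorph_prod /=.
  have [->|w0] := eqVneq ((M ord0).@[w]) 0; first by rewrite mul0r.
  have := GM w; rewrite GE // => /eqP; rewrite mulf_eq0 expf_eq0 (negPf w0) andbF /=.
  rewrite Ep -/(root _ _) rootZ ?lead_coef_eq0 // root_prod_XsubC => /(nthP 0)[i lt_i Ei].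
  rewrite (big_nth 0) big_mkord (bigD1 (Ordinal lt_i)) //= Ei mevalB mevalZ mulfVK //.
  by rewrite subrr mul0r mulr0.
move/eqP; rewrite mulf_eq0 (negPf M0) prodf_seq_eq0 => /hasP[a _ /eqP Ea].
exists (pt (- a) 1); first by exists ord_max; rewrite /pt (negPf m0) oner_eq0.
rewrite (bigD1 ord0) //= (bigD1 ord_max) //= big1 => [|i]; last first.
  by case: (two i) => ->; rewrite eqxx ?andbF.
by rewrite /pt eqxx (negPf m0) scale1r addr0 addrC scaleNr.
Qed.

End Relations.

(** * Independence of the partial derivatives *)

Section DirectionalDerivative.
Variables (k : fieldType) (m : nat).
Implicit Types (p q : {mpoly k[m]}) (v : 'I_m -> k).

Definition dderiv v p := \sum_(i < m) v i *: p^`M(i).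

Lemma dderivD v p q : dderiv v (p + q) = dderiv v p + dderiv v q.
Proof. by rewrite -big_split; apply: eq_bigr => i _; rewrite mderivD scalerDr. Qed.

Lemma dderivM v p q : dderiv v (p * q) = dderiv v p * q + p * dderiv v q.
Proof.
rewrite /dderiv mulr_suml mulr_sumr -big_split; apply: eq_bigr => i _.
by rewrite mderivM scalerDr -scalerAl -scalerAr.
Qed.

Lemma dderivC v c : dderiv v c%:MP = 0.
Proof. by rewrite /dderiv big1 // => i _; rewrite mderivC scaler0. Qed.

Lemma dderiv0 v : dderiv v 0 = 0.
Proof. by rewrite -mpolyC0 dderivC. Qed.

Lemma dderivZ v c p : dderiv v (c *: p) = c *: dderiv v p.
Proof. by rewrite -mul_mpolyC dderivM dderivC mul0r add0r mul_mpolyC. Qed.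

Lemma dderivN v p : dderiv v (- p) = - dderiv v p.
Proof. by rewrite -scaleN1r dderivZ scaleN1r. Qed.

Lemma dderivX v i : dderiv v 'X_i = (v i)%:MP.
Proof.
rewrite /dderiv (bigD1 i) //= big1 ?addr0 => [|j ji].
  by rewrite mderivX mnm1E eqxx scale1r -[(U_(i) - _)%MM]/(_) -alg_mpolyC; congr (_ *: _);
     rewrite -mpolyX0; congr ('X_[_]); apply/mnmP => l; rewrite mnmBE mnm0E subnn.
by rewrite mderivX mnm1E eq_sym (negPf ji) scale0r scaler0.
Qed.

Lemma dderiv_exp v p n : dderiv v (p ^+ n) = n%:R * p ^+ n.-1 * dderiv v p.
Proof.
elim: n => [|n IH]; first by rewrite expr0 -mpolyC1 dderivC !mul0r.
rewrite exprS dderivM IH /=; case: n {IH} => [|n]; first by rewrite !expr0 !mul0r mulr0 addr0; ring.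
by rewrite exprS /=; ring.
Qed.

Lemma dderiv_sum v (I : Type) (r : seq I) (P : pred I) (F : I -> {mpoly k[m]}) :
  dderiv v (\sum_(i <- r | P i) F i) = \sum_(i <- r | P i) dderiv v (F i).
Proof. exact: (big_morph (dderiv v) (@dderivD v) (dderiv0 v)). Qed.

Definition on_line (w v : 'I_m -> k) (f : {mpoly k[m]}) : {poly k} :=
  mmap polyC (fun i => (w i)%:P + v i *: 'X) f.

Lemma horner_on_line w v f a : (on_line w v f).[a] = f.@[fun i => w i + v i * a].
Proof.
rewrite /on_line; elim/mpoly_ringind: f => [c|i|g h Hg Hh|g h Hg Hh].
- by rewrite mmapC hornerC mevalC.
- by rewrite mmapX mmap1U mevalXU !hornerE.
- by rewrite mmapD hornerD mevalD -Hg -Hh.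
- by rewrite rmorphM hornerM mevalM -Hg -Hh.
Qed.

Lemma deriv_on_line w v f : (on_line w v f)^`() = on_line w v (dderiv v f).
Proof.
rewrite /on_line; elim/mpoly_ringind: f => [c|i|g h Hg Hh|g h Hg Hh].
- by rewrite dderivC mmap0 mmapC derivC.
- by rewrite dderivX mmapC mmapX mmap1U derivD derivC add0r derivZ derivX alg_polyC.
- by rewrite dderivD !mmapD derivD; congr (_ + _).
- by rewrite dderivM mmapD !rmorphM derivM; congr (_ * _ + _ * _).
Qed.

End DirectionalDerivative.

Section PartialsIndependent.
Variables (k : closedFieldType) (r t n d mu : nat).
Hypothesis char0 : [pchar k] =i pred0.
Hypotheses (ht1 : (1 <= t)%N) (htr : (t.+2 <= r)%N) (hn : (1 <= n)%N) (hnd : (n < d)%N).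
Hypotheses (hmu0 : (0 < mu)%N) (hmu : (mu * n <= d)%N).
Local Notation X := (@pdata_wf k r t mu n d).
Local Notation coords := (@pdata_coef k r t mu).
Implicit Types D : pdata k r t mu.

Definition partials_independent m (f : {mpoly k[m]}) :=
  forall v, dderiv v f = 0 -> forall i, v i = 0.

Lemma open_partials_independent D0 : X D0 -> partials_independent (permutti D0) ->
  exists h, [/\ polyfun coords h, h D0 != 0 &
    forall D, X D -> h D != 0 -> partials_independent (permutti D)].
Proof.
move=> XD0 H0.
pose b (w : 'I_r.+1 -> k) D (i : 'I_r.+1) := ((permutti D)^`M(i)).@[w].
have bE D v w : \sum_i b w D i * v i = (dderiv v (permutti D)).@[w].
  by rewrite raddf_sum /=; apply: eq_bigr => i _; rewrite mevalZ mulrC.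
have [w i||h [ph h0 hP]] := @open_trivial_kernel k _ _ coords X _ _ b D0 _ XD0.
- by apply: polyfunm_meval; apply: polyfunm_mderiv; apply: polyfunm_permutti.
- by move=> v Hv; apply: H0; apply: (mpoly_ext0 char0) => w; rewrite -bE.
exists h; split=> // D XD hD v Hv; apply: (hP D XD hD) => w.
by rewrite bE Hv meval0.
Qed.

Lemma outer_mderiv i (p : {mpoly k[r.+1]}) : outer_vars t p -> outer_vars t p^`M(i).
Proof.
move=> op mm; rewrite mcoeff_msupp mcoeff_deriv => m0 j le_j.
have : (mm + U_(i))%MM \in msupp p.
  by rewrite mcoeff_msupp; apply: contraNneq m0 => ->; rewrite mul0rn.
by move/op => /(_ j le_j); rewrite mnmDE => /eqP; rewrite addn_eq0 => /andP[/eqP].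
Qed.

Lemma outer_dderiv v (p : {mpoly k[r.+1]}) : outer_vars t p -> outer_vars t (dderiv v p).
Proof.
move=> op; apply: (big_ind (outer_vars (r := r) t)); first exact: outer_vars0.
  exact: outer_varsD.
by move=> i _; apply/outer_varsZ/outer_mderiv.
Qed.

Lemma outer_dderiv0 v (p : {mpoly k[r.+1]}) : outer_vars t p ->
  (forall i : 'I_r.+1, (t < i)%N -> v i = 0) -> dderiv v p = 0.
Proof.
move=> op v0; rewrite /dderiv big1 // => i _; have [lt_i|le_i] := ltnP t i.
  by rewrite v0 // scale0r.
suff -> : p^`M(i) = 0 by rewrite scaler0.
apply/mpolyP => mm; rewrite mcoeff_deriv mcoeff0.
have [Hm|Hm] := boolP ((mm + U_(i))%MM \in msupp p); last by rewrite memN_msupp_eq0 // mul0rn.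
by have := op _ Hm i le_i; rewrite mnmDE mnm1E eqxx addn1.
Qed.

Lemma outer_ext (p : {mpoly k[r.+1]}) : outer_vars t p -> (forall w, inner0 t w -> p.@[w] = 0) -> p = 0.
Proof.
move=> op H; apply: (mpoly_ext0 char0) => v.
rewrite (meval_outer (v' := fun i => if (i <= t)%N then 0 else v i) op) => [|i lt_i].
  by apply: H => i le_i; rewrite le_i.
by rewrite leqNgt lt_i.
Qed.

(** The part of the derivative of Q along v that comes from differentiating x_0, ..., x_t. *)
Definition core_form (M : 'I_t.+1 -> {mpoly k[r.+1]}) (v : 'I_r.+1 -> k) : {mpoly k[r.+1]} :=
  \sum_(i < t.+1) v (inord i) *: M i.

Lemma dderiv_Qform D v :
  dderiv v (Qform D) = core_form (coreM D) v + \sum_(i < t.+1) dderiv v (coreM D i) * 'X_(inord i).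
Proof.
rewrite /Qform dderiv_sum -big_split; apply: eq_bigr => i _.
by rewrite dderivM dderivX addrC mulrC mul_mpolyC.
Qed.

Lemma core_form_indep D v : ~ lin_dependent (coreM D) -> core_form (coreM D) v = 0 ->
  forall i : 'I_r.+1, (i <= t)%N -> v i = 0.
Proof.
move=> ML E i le_i; apply: NNPP => /eqP vi; apply: ML.
exists (fun j : 'I_t.+1 => v (inord j)) => //; exists (inord i).
have E' : (inord i : 'I_t.+1) = i :> nat by rewrite inordK ?ltnS.
by rewrite E' inord_val.
Qed.

Lemma outer_core_form D v : X D -> outer_vars t (core_form (coreM D) v).
Proof.
move=> [HM _ _]; apply: (big_ind (outer_vars (r := r) t)); first exact: outer_vars0.
  exact: outer_varsD.
by move=> i _; apply: outer_varsZ; case: (HM i).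
Qed.


Let ht : (t <= r)%N. Proof. by lia. Qed.
Let htr1 : (t < r)%N. Proof. by lia. Qed.
Let htr2 : (t < r.-1)%N. Proof. by lia. Qed.
Local Notation inner0 := (@inner0 k r t).

Definition power_sum : {mpoly k[r.+1]} := \sum_(j < r.+1 | (t < j)%N) 'X_j ^+ d.

Lemma power_sum_wf : power_sum \is d.-homog /\ outer_vars t power_sum.
Proof.
split.
  apply: rpred_sum => j _.
  have := dhomogMn d (_ : ('X_j : {mpoly k[r.+1]}) \is 1.-homog).
  by rewrite mul1n; apply; rewrite dhomogX /= mdeg1.
apply: (big_ind (outer_vars (r := r) t)); first exact: outer_vars0; first exact: outer_varsD.
by move=> j lt_j; apply/outer_varsXn/outer_varsX.
Qed.

(** With weights, power sums are stable under directional derivatives, and the value at a coordinate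
    point reads off one weight. *)
Definition weighted_power_sum (c : 'I_r.+1 -> k) e : {mpoly k[r.+1]} :=
  \sum_(j < r.+1 | (t < j)%N) c j *: 'X_j ^+ e.

Lemma dderiv_weighted_power_sum v c e :
  dderiv v (weighted_power_sum c e) = weighted_power_sum (fun j => e%:R * v j * c j) e.-1.
Proof.
rewrite /weighted_power_sum dderiv_sum; apply: eq_bigr => j _.
rewrite dderivZ dderiv_exp dderivX mulrC mul_mpolyC -mpolyC_nat mul_mpolyC !scalerA.
by congr (_ *: _); ring.
Qed.

Lemma meval_weighted_power_sum c e (j : 'I_r.+1) : (t < j)%N -> (0 < e)%N ->
  (weighted_power_sum c e).@[fun i => (i == j)%:R] = c j.
Proof.
move=> lt_j e0.
have E i : (c i *: ('X_i : {mpoly k[r.+1]}) ^+ e).@[fun i => (i == j)%:R] = c i * (i == j)%:R ^+ e.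
  by rewrite mevalZ rmorphXn /= mevalXU.
rewrite /weighted_power_sum raddf_sum (bigD1 j) //= big1 => [|i /andP[_ /negPf ij]].
  by rewrite (E j) eqxx expr1n mulr1 addr0.
by rewrite (E i) ij expr0n gtn_eqF // mulr0.
Qed.

Lemma power_sumE : power_sum = weighted_power_sum (fun=> 1) d.
Proof. by apply: eq_bigr => j _; rewrite scale1r. Qed.

Lemma meval_dderiv_power_sum v (j : 'I_r.+1) : (t < j)%N -> (1 < d)%N ->
  (dderiv v power_sum).@[fun i => (i == j)%:R] = d%:R * v j.
Proof.
move=> lt_j d1; rewrite power_sumE dderiv_weighted_power_sum meval_weighted_power_sum ?mulr1 //.
by rewrite -ltnS prednK // ltnW.
Qed.

Lemma meval_dderiv2_power_sum v (j : 'I_r.+1) : (t < j)%N -> (2 < d)%N ->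
  (dderiv v (dderiv v power_sum)).@[fun i => (i == j)%:R] = d.-1%:R * v j * (d%:R * v j).
Proof.
move=> lt_j d2; rewrite power_sumE !dderiv_weighted_power_sum meval_weighted_power_sum ?mulr1 //.
by move: d2; case: d => [|[|[|d']]].
Qed.

(** The sample is Q^mu l^e plus a Fermat form in the outer variables. The Fermat form forces the
    outer part of v to vanish; what is left of the equation is [core_form] times nonzero factors,
    and independence of the M_i kills the inner part. *)
Lemma partials_sample D : X D -> ~ lin_dependent (coreM D) ->
  exists P', (forall l : 'I_mu.+1, P' l \is (d - l * n).-homog /\ outer_vars t (P' l)) /\
   partials_independent (permutti (PData (coreM D) P')).
Proof.
move=> XD ML; have [HM AD HP] := XD.
(* For n = 1 the M_i are constants, hence dependent. So n >= 2 and d >= 3, which the second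
   derivative of the Fermat form requires at the end. *)
have n2 : (1 < n)%N.
  rewrite ltn_neqAle hn andbT; apply/eqP => n1; apply: ML.
  apply: (@lin_dependent_const k r t (n - 1)) => //; last by rewrite -n1.
  by move=> i; case: (HM i).
have d3 : (2 < d)%N by apply: leq_ltn_trans hnd.
have M0 : coreM D ord0 != 0.
  apply/eqP => M0; apply: ML; exists (fun i => (i == ord0)%:R); first by exists ord0; rewrite eqxx oner_eq0.
  rewrite (bigD1 ord0) //= big1 => [|i /negPf->]; last by rewrite scale0r.
  by rewrite M0 scaler0 addr0.
have [_ oM] := HM ord0.
have [y] : exists v, (coreM D ord0 * 'X_ord_max).@[v] != 0.
  by apply: (mpoly_neq0P char0); rewrite mulf_neq0 // -msupp_eq0 msuppX.
rewrite mevalM mevalXU mulf_eq0 negb_or => /andP[My ymax].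
pose j1 : 'I_r.+1 := inord r.-1.
have j1E : j1 = r.-1 :> nat by rewrite inordK // (leq_ltn_trans (leq_pred r)).
have r0 : (0 < r)%N by apply: leq_ltn_trans htr1.
have j1m : j1 != ord_max by rewrite -val_eqE /= j1E neq_ltn prednK // leqnn.
(* If mu = 1 it matters that l vanishes at a point y where M_0 does not. *)
pose l : {mpoly k[r.+1]} := y ord_max *: 'X_j1 - y j1 *: 'X_ord_max.
have X1 (j : 'I_r.+1) : ('X_j : {mpoly k[r.+1]}) \is 1.-homog by rewrite dhomogX /= mdeg1.
have hl : l \is 1.-homog by rewrite dhomogD // ?dhomogN dhomogZ.
have ol : outer_vars t l.
  apply: outer_varsD; first by apply/outer_varsZ/outer_varsX; rewrite j1E.
  by rewrite -scaleN1r; apply/outer_varsZ/outer_varsZ/outer_varsX.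
have l0 : l != 0.
  apply: contraNneq ymax => /(congr1 (mcoeff U_(j1))).
  rewrite mcoeffB !mcoeffZ !mcoeffXU mcoeff0 eqxx eq_sym (negPf j1m) mulr1 mulr0 subr0.
  by move=> ->.
have ly : l.@[y] = 0 by rewrite mevalB !mevalZ !mevalXU mulrC subrr.
pose e := (d - mu * n)%N; pose Pm := l ^+ e.
have oPm : outer_vars t Pm by apply: outer_varsXn.
have Pm0 : Pm != 0 by rewrite expf_neq0.
have [hS oS] := power_sum_wf.
pose P' (i : 'I_mu.+1) : {mpoly k[r.+1]} :=
  if i == ord_max then Pm else if i == ord0 then power_sum else 0.
have wfP (i : 'I_mu.+1) : P' i \is (d - i * n).-homog /\ outer_vars t (P' i).
  rewrite /P'; case: eqP => [->|_] /=.
    by split=> //; have := dhomogMn e hl; rewrite mul1n.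
  case: eqP => [->|_] /=; last by split; [exact: dhomog0|exact: outer_vars0].
  by rewrite mul0n subn0.
exists P'; split=> // v; pose Q := Qform D.
have o0 : ord0 != ord_max :> 'I_mu.+1 by rewrite -val_eqE /= eq_sym -lt0n.
have Ef : permutti (PData (coreM D) P') = Q ^+ mu * Pm + power_sum.
  rewrite /permutti (bigD1 ord_max) //= (bigD1 ord0) //= big1 ?addr0.
    by rewrite /P' eqxx (negPf o0) eqxx expr0 mul1r.
  by move=> i /andP[/negPf im /negPf i0]; rewrite /P' im i0 mulr0.
pose core := core_form (coreM D) v.
have oc : outer_vars t core by apply: outer_core_form XD.
rewrite Ef dderivD dderivM dderiv_exp => E.
suff v0 : forall j : 'I_r.+1, (t < j)%N -> v j = 0.
  have Q0 : Q != 0.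
    have y0 : inner0 (fun i => if (i <= t)%N then 0 else y i) by move=> i ->.
    apply: contraNneq My => Q0; have := meval_Qform_dir0 ht D 1 y0.
    rewrite -/Q Q0 meval0 mulr1 (outer_dir0 _ _ oM) (meval_outer (v' := y) oM) => [->//|i lt_i].
    by rewrite leqNgt lt_i.
  have c0 : core = 0.
    move: E; rewrite dderiv_Qform (outer_dderiv0 oPm v0) (outer_dderiv0 oS v0).
    rewrite big1 => [|i _]; last by have [_ oMi] := HM i; rewrite (outer_dderiv0 oMi v0) mul0r.
    rewrite mulr0 !addr0 -/core => /eqP; rewrite !mulf_eq0 (negPf Pm0) expf_eq0 (negPf Q0) andbF !orbF.
    by rewrite -mpolyC_nat mpolyC_eq0 natr_eq0 // gtn_eqF //= => /eqP.
  move=> i; have [/v0//|le_i] := ltnP t i.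
  exact: (core_form_indep ML c0).
have finish : dderiv v power_sum = 0 -> forall j : 'I_r.+1, (t < j)%N -> v j = 0.
  move=> S0 j lt_j; have := meval_dderiv_power_sum v lt_j (ltnW d3).
  rewrite S0 meval0 => /esym/eqP; rewrite mulf_eq0 natr_eq0 // gtn_eqF ?(ltn_trans _ d3) //=.
  by move/eqP.
(* For mu >= 2 every term from Q^mu l^e still contains Q, which vanishes where x_0 = ... = x_t = 0,
   so only the derivative of the Fermat form remains there. For mu = 1 the [core_form] term
   survives. *)
have [mu2|mu1] := ltnP 1 mu.
  apply: finish; apply: (outer_ext (outer_dderiv (v := v) oS)) => w w0.
  have := congr1 (meval w) E; rewrite meval0 !(mevalD, mevalM) !rmorphXn /= (Qform_inner0 ht D w0).
  rewrite !expr0n; have [-> ->] : (mu == 0)%N = false /\ (mu.-1 == 0)%N = false.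
    by move: mu2; clear; case: mu => [|[|m]].
  by rewrite mulr0 !mul0r !add0r.
have {mu1} mu1 : mu = 1%N by apply/eqP; rewrite eqn_leq mu1.
move: E; rewrite mu1 /= expr0 expr1 mulr1 mul1r dderiv_Qform -/core => E.
have ES w : (\sum_(i < t.+1) dderiv v (coreM D i) * 'X_(inord i)).@[w] =
    \sum_(i < t.+1) (dderiv v (coreM D i)).@[w] * w (inord i).
  by rewrite raddf_sum; apply: eq_bigr => i _; rewrite /= mevalM mevalXU.
(* For mu = 1 the equation is affine in x_0, ..., x_t. E1 is its constant term and E2 its
   coefficient of x_i, extracted by setting these variables to 0 and to a unit vector. *)
have E1 : core * Pm + dderiv v power_sum = 0.
  apply: (outer_ext) => [|w w0].
    by apply: outer_varsD; [exact: outer_varsM|exact: outer_dderiv].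
  have := congr1 (meval w) E; rewrite meval0 !(mevalD, mevalM) (Qform_inner0 ht D w0) => <-.
  rewrite ES big1 => [|i _]; last by rewrite w0 ?mulr0 ?inord_le.
  by rewrite addr0 mul0r addr0.
have E2 i : dderiv v (coreM D i) * Pm + coreM D i * dderiv v Pm = 0.
  have [_ oMi] := HM i.
  apply: (outer_ext) => [|w w0].
    by apply: outer_varsD; apply: outer_varsM => //; apply: outer_dderiv.
  pose w' (j : 'I_r.+1) := w j + (j == inord i)%:R.
  have w'o p : outer_vars t p -> p.@[w'] = p.@[w].
    move=> op; apply: (meval_outer op) => j lt_j; rewrite /w'.
    case: eqP => [Ej|_]; last by rewrite addr0.
    by move: lt_j; rewrite Ej ltnNge inord_le.
  have w'i (j : 'I_t.+1) : w' (inord j) = (j == i)%:R.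
    rewrite /w' w0 ?inord_le // add0r -!val_eqE /= !inordK // (leq_trans (ltn_ord _)) //.
  have := congr1 (meval w') (etrans E (esym E1)).
  have S1 F : \sum_(j < t.+1) F j * w' (inord j) = F i.
    rewrite (bigD1 i) //= big1 => [|j /negPf ji]; last by rewrite w'i ji mulr0.
    by rewrite w'i eqxx mulr1 addr0.
  rewrite !(mevalD, mevalM) ES -/Q (meval_Qform D) !S1.
  have oDi : outer_vars t (dderiv v (coreM D i)) by apply: outer_dderiv.
  have oDm : outer_vars t (dderiv v Pm) by apply: outer_dderiv.
  have oDS : outer_vars t (dderiv v power_sum) by apply: outer_dderiv.
  rewrite !w'o //.
  move=> E3; apply: (addrI (core.@[w] * Pm.@[w] + (dderiv v power_sum).@[w])).
  by rewrite addr0 -[RHS]E3; ring.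
have e0 : (0 < e)%N by rewrite /e mu1 mul1n subn_gt0.
have [c lc] : exists c, dderiv v l = c%:MP.
  exists (y ord_max * v j1 - y j1 * v ord_max).
  by rewrite /l dderivD dderivN !dderivZ !dderivX -!mul_mpolyC -!mpolyCM -mpolyCB.
have c0 : c = 0.
  (* After division by l^(e-1) the relation reads l dM_0 + e c M_0 = 0; at y only the second term is
     left, and M_0 is nonzero there. *)
  have := E2 ord0; rewrite /Pm dderiv_exp lc -(prednK e0) /= exprS => E3.
  have : l * dderiv v (coreM D ord0) + e%:R * c%:MP * coreM D ord0 = 0.
    apply: (mulfI (expf_neq0 e.-1 l0)); rewrite mulr0 -[RHS]E3 prednK //; ring.
  move/(congr1 (meval y)); rewrite mevalD !mevalM ly mul0r add0r meval0 mevalC rmorph_nat => /eqP.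
  by rewrite !mulf_eq0 (negPf My) orbF natr_eq0 // gtn_eqF //= => /eqP.
have Pm1 : dderiv v Pm = 0 by rewrite /Pm dderiv_exp lc c0 mpolyC0 mulr0.
have M1 i : dderiv v (coreM D i) = 0.
  by have /eqP := E2 i; rewrite Pm1 mulr0 addr0 mulf_eq0 (negPf Pm0) orbF => /eqP.
(* The M_i and l^e are now constant along v, so differentiating E1 once more leaves the second
   derivative of the Fermat form, whose value at a coordinate point is d (d - 1) v_j^2. *)
move=> j lt_j; have := congr1 (dderiv v) E1; rewrite dderivD dderivM Pm1 mulr0 dderiv0.
have -> : dderiv v core = 0.
  by rewrite /core /core_form dderiv_sum big1 // => i _; rewrite dderivZ M1 scaler0.
rewrite mul0r !add0r => S2; have := meval_dderiv2_power_sum v lt_j d3.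
rewrite S2 meval0 => /esym/eqP; rewrite !mulf_eq0 !natr_eq0 //.
have -> : (d.-1 == 0)%N = false by move: d3; clear; case: d => [|[|d']].
have -> : (d == 0)%N = false by rewrite gtn_eqF ?(ltn_trans _ d3).
by rewrite /= orbb => /eqP.
Qed.

(** The alternative is unavoidable: the M_i may be dependent throughout an open piece of X. In that
    case an equation of the piece is itself the witness; otherwise a member with independent M_i is
    deformed to the sample. *)
Lemma generically_partials : generically_in coords X
  (fun D => lin_dependent (coreM D) \/ partials_independent (permutti D)).
Proof.
apply: generically_intro => D0 W XD0 oW WD0.
have [[D1 [X1 W1 M1]]|H] := classic (exists D1, [/\ X D1, W D1 & ~ lin_dependent (coreM D1)]); last first.
  have [h [ph h0 hW]] := zopen_polyfun oW WD0.
  exists D0; split=> //; exists h; split=> // D XD hD; left; apply: NNPP => M1.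
  by apply: H; exists D; split=> //; apply: hW.
have [P' [wfP HP]] := partials_sample X1 M1.
have [HM AD _] := X1.
have XD2 : X (PData (coreM D1) P') by [].
have [h [ph hD2 HG]] := open_partials_independent XD2 HP.
have [D2 [X2 W2 h2 _]] := move_coefP char0 X1 oW W1 wfP ph hD2.
by exists D2; split=> //; exists h; split=> // D XD hD; right; apply: HG.
Qed.

End PartialsIndependent.

(** * Irreducible hypersurfaces *)

Section OnLine.
Variables (k : fieldType) (m : nat).
Implicit Types (f : {mpoly k[m]}) (w v : 'I_m -> k).

Lemma on_line_monomial w v (mm : 'X_{1..m}) :
  let P := on_line w v 'X_[mm] in (size P <= (mdeg mm).+1)%N /\ P`_(mdeg mm) = 'X_[mm].@[v].
Proof.
rewrite /on_line mmapX mevalX mdegE /mmap1 /=.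
apply: (big_rec3 (fun (P : {poly k}) e c => (size P <= e.+1)%N /\ P`_e = c)).
  by rewrite size_poly1 coef1.
move=> i x e P _ [sP cP].
have [sQ cQ] : (size (((w i)%:P + v i *: 'X) ^+ mm i)%R <= (mm i).+1)%N /\
    (((w i)%:P + v i *: 'X) ^+ mm i)`_(mm i) = v i ^+ mm i.
  elim: (mm i) => [|l [IH1 IH2]]; first by rewrite !expr0 size_poly1 coef1.
  have s1 : (size ((w i)%:P + v i *: 'X)%R <= 2)%N.
    apply: leq_trans (size_polyD _ _) _; rewrite geq_max (leq_trans (size_polyC_leq1 _)) //=.
    by apply: leq_trans (size_scale_leq _ _) _; rewrite size_polyX.
  rewrite !exprS; split.
    apply: leq_trans (size_polyMleq _ _) _.
    by move: s1 IH1; move: (size _) (size _) => x1 x2; lia.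
  rewrite -[l.+1]add1n (coefM_top s1 IH1) IH2; congr (_ * _).
  by rewrite coefD coefC coefZ coefX add0r mulr1.
split; last by rewrite (coefM_top sQ sP) cQ cP.
apply: leq_trans (size_polyMleq _ _) _.
by move: sQ sP; move: (size _) (size _) => x1 x2; lia.
Qed.

Lemma on_line_homog w v f d : f \is d.-homog ->
  (size (on_line w v f) <= d.+1)%N /\ (on_line w v f)`_d = f.@[v].
Proof.
move=> hf; have E : on_line w v f = \sum_(mm <- msupp f) (f@_mm)%:P * on_line w v 'X_[mm].
  rewrite {1}[f]mpolyE /on_line raddf_sum /=; apply: eq_bigr => mm _.
  by rewrite mmapZ.
rewrite E big_seq; split.
  apply: leq_trans (size_sum _ _ _) _; apply/bigmax_leqP_seq => mm _ Hm.
  rewrite mul_polyC; apply: leq_trans (size_scale_leq _ _) _.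
  by have [s _] := on_line_monomial w v mm; rewrite -(dhomog_mf hf Hm).
rewrite [in RHS](mpolyE f) coef_sum raddf_sum /= [in RHS]big_seq; apply: eq_bigr => mm Hm.
by rewrite coefCM -(dhomog_mf hf Hm) (on_line_monomial w v mm).2 mevalZ.
Qed.

End OnLine.

Section LinChange.
Variables (k : fieldType) (r : nat).
Hypothesis char0 : [pchar k] =i pred0.
Implicit Types (f g : {mpoly k[r.+1]}) (A : 'M[k]_r.+1) (w : 'rV[k]_r.+1).

Lemma meval_lin_change A f w : (lin_change A f).@[w 0] = f.@[(w *m A) 0].
Proof.
rewrite /lin_change comp_mpoly_meval; apply: meval_eq => i.
rewrite tnth_mktuple raddf_sum mxE; apply: eq_bigr => j _.
by rewrite /= mevalZ mevalXU mulrC.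
Qed.

Lemma meval_row f v : f.@[v] = f.@[(\row_i v i) 0].
Proof. by apply: meval_eq => i; rewrite mxE. Qed.

Lemma mpoly_row_ext f g : (forall w : 'rV[k]_r.+1, f.@[w 0] = g.@[w 0]) -> f = g.
Proof. by move=> H; apply: (mpoly_ext char0) => v; rewrite !(meval_row _ v) H. Qed.

Lemma lin_changeM A f g : lin_change A (f * g) = lin_change A f * lin_change A g.
Proof. exact: rmorphM. Qed.

Lemma lin_changeK A f : A \in unitmx -> lin_change A (lin_change (invmx A) f) = f.
Proof. by move=> uA; apply: mpoly_row_ext => w; rewrite !meval_lin_change -mulmxA mulmxV ?mulmx1. Qed.

Lemma lin_changeVK A f : A \in unitmx -> lin_change (invmx A) (lin_change A f) = f.
Proof. by move=> uA; apply: mpoly_row_ext => w; rewrite !meval_lin_change -mulmxA mulVmx ?mulmx1. Qed.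

Lemma lin_change_homog A f d : f \is d.-homog -> lin_change A f \is d.-homog.
Proof.
move=> hf; rewrite /lin_change comp_mpolyE big_seq; apply: rpred_sum => mm Hm.
apply: dhomogZ; have -> : d = mdeg mm by rewrite -(dhomog_mf hf Hm).
rewrite mdegE.
apply: (big_ind2 (fun (p : {mpoly k[r.+1]}) e => p \is e.-homog)).
- exact: dhomog1.
- by move=> p e q e' Hp Hq; apply: dhomogM.
move=> i _; have := @dhomogMn _ _ mdeg 1 (tnth [tuple \sum_(j < r.+1) A j i *: 'X_j | i < r.+1] i) (mm i).
rewrite mul1n; apply; rewrite tnth_mktuple; apply: rpred_sum => j _.
by rewrite dhomogZ // dhomogX /= mdeg1.
Qed.

Lemma unit_msize f : f != 0 -> (f \is a GRing.unit) = (msize f <= 1)%N.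
Proof.
move=> f0; apply/idP/idP => [/unitrP[g [gf _]]|/msize1_polyC Ef].
  have g0 : g != 0 by apply: contraTneq (oner_neq0 {mpoly k[r.+1]}) => E; rewrite -gf E mul0r eqxx.
  have := congr1 (fun p : {mpoly k[r.+1]} => msize p) gf; rewrite msizeM // msize1.
  have := g0; have := f0; rewrite -!msize_poly_eq0; move: (mmeasure _ f) (mmeasure _ g) => x y; lia.
rewrite Ef; apply: rmorph_unit; rewrite unitfE; apply: contraNneq f0 => E.
by rewrite Ef E mpolyC0.
Qed.

Lemma lin_change_unit A f : A \in unitmx -> (lin_change A f \is a GRing.unit) = (f \is a GRing.unit).
Proof.
move=> uA; apply/idP/idP => [|H]; last exact: (rmorph_unit _ H).
by move=> H; rewrite -(lin_changeVK f uA); apply: (rmorph_unit _ H).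
Qed.

Lemma irreducible_lin_change A f : A \in unitmx -> irreducible_elt f -> irreducible_elt (lin_change A f).
Proof.
move=> uA [f0 fu fI]; split.
- by apply: contraNneq f0 => E; rewrite -(lin_changeVK f uA) E /lin_change comp_mpoly0.
- by rewrite lin_change_unit.
move=> g h E.
have : f = lin_change (invmx A) g * lin_change (invmx A) h by rewrite -lin_changeM -E lin_changeVK.
by move/fI; rewrite !lin_change_unit ?unitmx_inv.
Qed.

Lemma unit_matrix_last_row (u : 'rV[k]_r.+1) : u 0 ord_max != 0 ->
  exists2 A : 'M[k]_r.+1, A \in unitmx & delta_mx 0 ord_max *m A = u.
Proof.
move=> u0; pose A : 'M[k]_r.+1 := \matrix_(i, j) if i == ord_max then u 0 j else (i == j)%:R.
exists A; last by rewrite -rowE; apply/rowP => j; rewrite !mxE eqxx.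
have tA : is_trig_mx A.
  apply/is_trig_mxP => i j lt_ij; rewrite mxE; case: eqP => [Ei|_].
    by move: lt_ij; rewrite Ei ltnNge -ltnS ltn_ord.
  by rewrite -val_eqE /= ltn_eqF.
rewrite unitmxE (det_trig tA) unitfE; apply/prodf_neq0 => i _.
by rewrite mxE; case: (i =P ord_max) => [->//|_]; rewrite eqxx oner_eq0.
Qed.

End LinChange.

Section Hypersurface.
Variables (k : closedFieldType) (r : nat).
Hypothesis char0 : [pchar k] =i pred0.
Hypothesis r1 : (1 <= r)%N.
Implicit Types (f g h : {mpoly k[r.+1]}).

(** As f is nonzero at the last coordinate point, its degree in the last variable is d for all
    values of the others. If f did not divide h, a Bezout relation x1 f + x2 h = y with y free of
    the last variable would fail at a zero of f lying over a point where y is nonzero. *)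
Lemma nullstellensatz_last f h d : irreducible_elt f -> f \is d.-homog -> (0 < d)%N ->
  f.@[fun i => (i == ord_max)%:R] != 0 ->
  (forall w, (exists i, w i != 0) -> f.@[w] = 0 -> h.@[w] = 0) -> divides f h.
Proof.
move=> fI hf d0 fe Hh; apply: NNPP => ndiv.
have [f0 fu fP] := irreducible_prime (@factorial_mpoly k r.+1) fI.
pose F := muni f.
have divF g g' : divides (muni g) (muni g') -> divides g g'.
  case=> q E; exists (of_muni q); apply: (can_inj (@muniK r k)).
  by rewrite muniM of_muniK.
have FP a b : divides F (a * b) -> divides F a \/ divides F b.
  move=> [q E]; have [|[c Ec]|[c Ec]] := fP (of_muni a) (of_muni b).
  - by apply: divF; exists q; rewrite muniM !of_muniK.
  - by left; exists (muni c); rewrite -[a]of_muniK Ec muniM.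
  - by right; exists (muni c); rewrite -[b]of_muniK Ec muniM.
pose pt (v : 'I_r -> k) x (i : 'I_r.+1) := if unlift ord_max i is Some j then v j else x.
have evE g v x : (map_poly (meval v) (muni g)).[x] = g.@[pt v x].
  rewrite meval_muni {2}/pt unlift_none; congr (_.[_]); apply: eq_map_poly => q.
  apply: meval_eq => j /=; rewrite /pt.
  have -> : widen_ord (leqnSn r) j = lift ord_max j by apply/val_inj; exact/esym/lift_max.
  by rewrite liftK.
have szE v : size (map_poly (meval v) F) = d.+1.
  have -> : map_poly (meval v) F = on_line (pt v 0) (fun i => (i == ord_max)%:R) f.
    apply: (poly_ext char0) => x; rewrite evE horner_on_line; apply: meval_eq => i.
    rewrite /pt; case: unliftP => [j ->|->]; last by rewrite eqxx mul1r add0r.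
    by rewrite eq_sym (negPf (neq_lift _ _)) mul0r addr0.
  have [s c] := on_line_homog (pt v 0) (fun i => (i == ord_max)%:R) hf.
  apply/eqP; rewrite eqn_leq s /= ltnNge; apply: contra fe => s'.
  by rewrite -c nth_default.
have sF : (1 < size F)%N.
  have : (size (map_poly (meval (fun=> 0)) F)%R <= size F)%N by apply: size_poly.
  by rewrite szE; apply: leq_trans; rewrite ltnS.
have [x1 [x2 [y [y0 Ed]]]] := prime_bezout FP sF (fun X => ndiv (divF _ _ X)).
(* The extra variable makes the resulting zero of f a nonzero vector, so that the hypothesis on h
   applies to it. *)
have [v] : exists v, (y * 'X_(Ordinal r1)).@[v] != 0.
  by apply: (mpoly_neq0P char0); rewrite !mulf_neq0 // -msupp_eq0 msuppX.
rewrite mevalM mevalXU mulf_eq0 negb_or => /andP[yv v0].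
have [x rx] : exists x, root (map_poly (meval v) F) x.
  by apply/closed_rootP; rewrite szE eqSS -lt0n.
have fx : f.@[pt v x] = 0 by rewrite -evE; apply/rootP.
have hx : h.@[pt v x] = 0.
  apply: Hh fx; exists (lift ord_max (Ordinal r1)); by rewrite /pt liftK.
have evF : (map_poly (meval v) F).[x] = 0 by rewrite -fx; exact: evE.
have evH : (map_poly (meval v) (muni h)).[x] = 0 by rewrite -hx; exact: evE.
clearbody F; have := congr1 (fun p => (map_poly (meval v) p).[x]) Ed.
rewrite rmorphD !rmorphM /= map_polyC hornerD !hornerM hornerC /=.
by rewrite evF evH !mulr0 addr0 => /esym/eqP; rewrite (negPf yv).
Qed.

(** A linear change moves a point u off V(f) to the last coordinate point; u is chosen with nonzero
    last coordinate so that replacing the last row of the identity matrix by u is invertible. *)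
Lemma nullstellensatz f h d : irreducible_elt f -> f \is d.-homog -> (0 < d)%N ->
  (forall w : 'rV[k]_r.+1, w != 0 -> f.@[w 0] = 0 -> h.@[w 0] = 0) -> divides f h.
Proof.
move=> fI hf d0 Hh; have [f0 _ _] := fI.
have [u] : exists u, (f * 'X_ord_max).@[u] != 0.
  by apply: (mpoly_neq0P char0); rewrite mulf_neq0 // -msupp_eq0 msuppX.
rewrite mevalM mevalXU mulf_eq0 negb_or => /andP[fu u0].
have [|A uA Au] := @unit_matrix_last_row k r (\row_i u i); first by rewrite mxE.
have [|||||q Eq] := @nullstellensatz_last (lin_change A f) (lin_change A h) d.
- exact: irreducible_lin_change.
- exact: lin_change_homog.
- by [].
- rewrite meval_row meval_lin_change.
  have -> : \row_(i < r.+1) (i == ord_max)%:R = delta_mx 0 ord_max :> 'rV[k]_r.+1.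
    by apply/rowP => i; rewrite !mxE eqxx.
  by rewrite Au -meval_row.
- move=> w [i wi]; rewrite !(meval_row _ w) !meval_lin_change; apply: Hh.
  apply: contraNneq wi => E; have : \row_i w i = 0 :> 'rV[k]_r.+1.
    by rewrite -[LHS]mulmx1 -(mulmxV uA) mulmxA E mul0mx.
  by move/rowP/(_ i); rewrite !mxE => ->.
by exists (lin_change (invmx A) q); rewrite -[f](lin_changeVK char0 _ uA) -lin_changeM -Eq lin_changeVK.
Qed.

(** If neither closed set contained V(f), each would have an equation not divisible by f; their
    product vanishes on V(f), against primality of f. *)
Lemma irreducible_zeros f d : irreducible_elt f -> f \is d.-homog -> (0 < d)%N ->
  irreducible_set (zeros f).
Proof.
move=> fI hf d0; have [_ fu _] := fI.
have [_ _ fP] := irreducible_prime (@factorial_mpoly k r.+1) fI.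
split.
  apply: NNPP => H; case/negP: fu; have [|q Eq] := nullstellensatz (h := 1) fI hf d0.
    by move=> w w0 fw; case: H; exists w.
  by apply/unitrPr; exists q.
move=> Z1 Z2 [S1 [_ HZ1]] [S2 [_ HZ2]] H; apply: NNPP => H'.
have key (Z : 'rV[k]_r.+1 -> Prop) S : (forall w, Z w <-> forall g, S g -> zeros g w) ->
    ~ (forall w, w != 0 -> zeros f w -> Z w) ->
    exists g, S g /\ ~ divides f g.
  move=> HZ nZ; apply: NNPP => nS; apply: nZ => w w0 fw; apply/HZ => g Sg.
  have [q ->] : divides f g by apply: NNPP => nd; apply: nS; exists g.
  by rewrite /zeros mevalM fw mul0r.
have [g1 [Sg1 n1]] := key Z1 S1 HZ1 (fun X => H' (or_introl X)).
have [g2 [Sg2 n2]] := key Z2 S2 HZ2 (fun X => H' (or_intror X)).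
case: (fP g1 g2) => //; apply: (nullstellensatz fI hf d0) => w w0 fw; rewrite mevalM.
by case: (H w w0 fw) => [/HZ1/(_ _ Sg1)->|/HZ2/(_ _ Sg2)->]; rewrite ?mul0r ?mulr0.
Qed.

(** For a vertex v the translate f(w + a v) vanishes on V(f), hence is a multiple of f, by a
    constant c(a) for degree reasons. A root of c would make f zero, so c is constant and equal to
    1, and f is invariant along v. *)
Lemma cone_dderiv f d : irreducible_elt f -> f \is d.-homog -> (0 < d)%N ->
  is_cone (zeros f) -> exists2 v, (exists i, v i != 0) & dderiv v f = 0.
Proof.
move=> fI hf d0 [v [v0 fv Hv]]; have [f0 _ _] := fI.
exists (v 0).
  apply: NNPP => H; case/eqP: v0; apply/rowP => i; rewrite mxE; apply: NNPP => /eqP vi.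
  by apply: H; exists i.
have shiftE a : exists c, forall w, f.@[fun i => w i + v 0 i * a] = c * f.@[w].
  pose h := f \mPo [tuple 'X_i + (v 0 i * a)%:MP | i < r.+1].
  have hE w : h.@[w] = f.@[fun i => w i + v 0 i * a].
    rewrite comp_mpoly_meval; apply: meval_eq => i.
    by rewrite tnth_mktuple mevalD mevalXU mevalC.
  have [w w0 fw|q Eq] := nullstellensatz (h := h) fI hf d0.
    rewrite hE -[RHS](Hv w fw a 1); apply: meval_eq => i.
    by rewrite !mxE mul1r addrC mulrC.
  suff qc w : q.@[w] = q.@[fun=> 0] by exists (q.@[fun=> 0]) => w; rewrite -hE Eq mevalM qc mulrC.
  suff : f * (q - (q.@[fun=> 0])%:MP) = 0.
    by move/eqP; rewrite mulf_eq0 (negPf f0) subr_eq0 => /eqP ->; rewrite !mevalC.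
  apply: (mpoly_ext0 char0) => u; rewrite mevalM mevalB mevalC.
  have [->|fu] := eqVneq (f.@[u]) 0; first by rewrite mul0r.
  (* On the line through 0 and u, f has degree exactly d and its translate at most d, so the
     quotient q is constant there. *)
  have [_ lf] := on_line_homog (fun=> 0) u hf.
  have [sh _] := on_line_homog (fun i => v 0 i * a) u hf.
  have E : on_line (fun i => v 0 i * a) u f = on_line (fun=> 0) u f * on_line (fun=> 0) u q.
    apply: (poly_ext char0) => x; rewrite hornerM !horner_on_line -mevalM -Eq hE.
    by apply: meval_eq => i; rewrite add0r addrC.
  have sf : (d < size (on_line (fun=> 0%R) u f))%N.
    by rewrite ltnNge; apply: contra fu => s; rewrite -lf nth_default.
  have sq : (size (on_line (fun=> 0%R) u q) <= 1)%N.
    have [->|q0] := eqVneq (on_line (fun=> 0) u q) 0; first by rewrite size_poly0.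
    have f1 : on_line (fun=> 0) u f != 0 by rewrite -size_poly_gt0 (leq_trans _ sf).
    move: sh; rewrite E size_mul //; move: sf; clear.
    by move: (size _) (size _) => x y; lia.
  have Eu b : (on_line (fun=> 0) u q).[b] = q.@[fun i => u i * b].
    by rewrite horner_on_line; apply: meval_eq => i; rewrite add0r.
  have -> : q.@[u] = q.@[fun=> 0].
    transitivity (on_line (fun=> 0) u q).[1]; first by rewrite Eu; apply: meval_eq => i; rewrite mulr1.
    transitivity (on_line (fun=> 0) u q).[0]; last by rewrite Eu; apply: meval_eq => i; rewrite mulr0.
    by rewrite (size1_polyC sq) !hornerC.
  by rewrite subrr mulr0.
have [w0 fw0] := mpoly_neq0P char0 f0.
have c1 a w : f.@[fun i => w i + v 0 i * a] = f.@[w].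
  have s1 : (size (on_line w0 (v 0%R) f) <= 1)%N.
    rewrite leqNgt; apply/negP => s.
    have [|b /rootP] := @closed_rootP k (on_line w0 (v 0) f) _; first by rewrite gtn_eqF.
    rewrite horner_on_line; have [c Ec] := shiftE b; rewrite Ec => /eqP.
    rewrite mulf_eq0 (negPf fw0) orbF => /eqP c0; case/eqP: f0; apply: (mpoly_ext0 char0) => u.
    have := Ec (fun i => u i - v 0 i * b); rewrite c0 mul0r => <-.
    by apply: meval_eq => i; rewrite subrK.
  have [c Ec] := shiftE a; rewrite Ec; suff -> : c = 1 by rewrite mul1r.
  apply: (mulIf fw0); rewrite mul1r -Ec -horner_on_line (size1_polyC s1) hornerC -horner_coef0.
  by rewrite horner_on_line; apply: meval_eq => i; rewrite mulr0 addr0.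
apply: (mpoly_ext0 char0) => w.
have E : on_line w (v 0) f = (f.@[w])%:P.
  by apply: (poly_ext char0) => a; rewrite horner_on_line hornerC c1.
have := congr1 (fun P : {poly k} => P^`().[0]) E; rewrite deriv_on_line derivC horner0 => <-.
by rewrite horner_on_line; apply: meval_eq => i; rewrite mulr0 addr0.
Qed.

End Hypersurface.

(** * Multiplicity along the core *)

Lemma mcoeff_pihomog (k : fieldType) m (p : {mpoly k[m]}) e mm : mdeg mm = e ->
  (pihomog mdeg e p)@_mm = p@_mm.
Proof.
move=> Em; rewrite [in RHS](mpolyE p) pihomogE !raddf_sum /= big_mkcond.
apply: eq_bigr => m' _; rewrite mcoeffZ mcoeffX; case: eqP => //= ne.
by case: eqP => [E|_]; rewrite ?mulr0 //; case: ne; rewrite E.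
Qed.

Lemma meval_scaled_pihomog (k : fieldType) m (p : {mpoly k[m]}) N w : (msize p <= N)%N ->
  forall a, p.@[fun i => a * w i] = (\sum_(e < N) (pihomog mdeg e p).@[w] *: 'X^e).[a].
Proof.
move=> sp a; rewrite {1}(pihomog_partitionE (mf := mdeg) sp) raddf_sum /= -[RHS]/(horner_eval a _) raddf_sum.
apply: eq_bigr => e _; rewrite /= /horner_eval (meval_homog _ _ (pihomogP _ _ _)).
by rewrite hornerZ hornerXn mulrC.
Qed.

Section Core.
Variables (k : fieldType) (r t : nat) (A : 'M[k]_r.+1).
Hypothesis uA : A \in unitmx.
Hypothesis ht : (t <= r)%N.

Lemma mem_core (w : 'rV[k]_r.+1) :
  reflect (forall j : 'I_r.+1, (t < j)%N -> (w *m A) 0 j = 0) (w \in core t A).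
Proof.
have E j : (w \in lker (linfun (mulmxr (col j A)))) = ((w *m A) 0 j == 0).
  have Ec : (w *m col j A) 0 0 = (w *m A) 0 j.
    by rewrite !mxE; apply: eq_bigr => l _; rewrite mxE.
  rewrite memv_ker lfunE /=; apply/eqP/eqP => [E|E]; first by rewrite -Ec E mxE.
  by apply/rowP => i; rewrite (ord1 i) Ec E mxE.
rewrite memvE; apply: (iffP subv_bigcapP) => H j lt_j.
  by apply/eqP; rewrite -E memvE; apply: H.
by rewrite -memvE E; apply/eqP/H.
Qed.

End Core.

Lemma polyfun_meval (k : fieldType) m (g : {mpoly k[m]}) :
  polyfun (@xcoord k m) (fun p : 'rV[k]_m => g.@[p 0]).
Proof. by exists m, id, g. Qed.

Section PermuttiGeometry.
Variables (k : closedFieldType) (r t n d mu : nat).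
Hypothesis char0 : [pchar k] =i pred0.
Hypotheses (ht1 : (1 <= t)%N) (htr : (t.+2 <= r)%N) (hn : (1 <= n)%N) (hnd : (n < d)%N).
Hypotheses (hmu0 : (0 < mu)%N) (hmu : (mu * n <= d)%N).
Local Notation X := (@pdata_wf k r t mu n d).
Variable D : pdata k r t mu.
Hypothesis XD : X D.
Variable A : 'M[k]_r.+1.
Hypothesis uA : A \in unitmx.

Let ht : (t <= r)%N. Proof. exact: ltnW (ltnW htr). Qed.

Definition Lform (y x : 'I_r.+1 -> k) : k := \sum_(i < t.+1) (coreM D i).@[y] * x (inord i).

(** The l-th term acquires a^((n - 1) l) from Q^l and a^(d - l n) from P_l, in total a^(d - l) =
    a^(d - mu) a^(mu - l). Parts (i) and (ii) and the cone criterion all rest on this formula. *)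
Lemma meval_permutti_outer (x y : 'I_r.+1 -> k) a :
  (forall j : 'I_r.+1, (t < j)%N -> x j = a * y j) ->
  (permutti D).@[x] =
  a ^+ (d - mu) * \sum_(l < mu.+1) a ^+ (mu - l) * Lform y x ^+ l * (coefP D l).@[y].
Proof.
move=> Ex; have [HM _ HP] := XD.
have Eo p e : outer_vars t p -> p \is e.-homog -> p.@[x] = a ^+ e * p.@[y].
  by move=> op hp; rewrite -(meval_homog _ _ hp); apply: (meval_outer op).
have EQ : (Qform D).@[x] = a ^+ (n - 1) * Lform y x.
  rewrite meval_Qform mulr_sumr; apply: eq_bigr => i _; have [h o] := HM i.
  by rewrite (Eo _ _ o h) mulrA.
rewrite meval_permutti mulr_sumr; apply: eq_bigr => l _; have [h o] := HP l.
rewrite EQ (Eo _ _ o h) exprMn -exprM mulrACA -exprD.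
transitivity (a ^+ (d - mu + (mu - l)) * (Lform y x ^+ l * (coefP D l).@[y])); last first.
  by rewrite exprD; ring.
congr (a ^+ _ * _); have := ltn_ord l; move: hmu hn hnd (l : nat); clear => h1 h2 h3 l' h4.
have : (l' * n <= mu * n)%N by rewrite leq_mul2r; apply/orP; right; lia.
have -> : ((n - 1) * l' = l' * n - l')%N by rewrite mulnC mulnBr muln1.
have : (l' <= l' * n)%N by rewrite leq_pmulr.
have : (mu <= mu * n)%N by rewrite leq_pmulr.
by lia.
Qed.

Lemma Lform_D y x x' a : Lform y (fun i => x i + a * x' i) = Lform y x + a * Lform y x'.
Proof.
by rewrite /Lform mulr_sumr -big_split; apply: eq_bigr => i _; rewrite /= mulrDr mulrCA.
Qed.

Definition Lmpoly y : {mpoly k[r.+1]} := \sum_(i < t.+1) (coreM D i).@[y] *: 'X_(inord i).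

Lemma meval_Lmpoly y x : (Lmpoly y).@[x] = Lform y x.
Proof. by rewrite raddf_sum; apply: eq_bigr => i _; rewrite /= mevalZ mevalXU. Qed.

Lemma Lmpoly_homog y : Lmpoly y \is 1.-homog.
Proof. by apply: rpred_sum => i _; rewrite dhomogZ // dhomogX /= mdeg1. Qed.

Lemma Lform_dir0 y : Lform y (@dir0 k r) = (coreM D ord0).@[y].
Proof.
rewrite /Lform (bigD1 ord0) //= big1 ?addr0 => [|i /negPf i0].
  have -> : inord 0 = ord0 :> 'I_r.+1 by apply/val_inj; rewrite /= inordK.
  by rewrite /dir0 eqxx mulr1.
by rewrite /dir0 (inord_eq0 ht) i0 mulr0.
Qed.

Definition row_dir0 : 'rV[k]_r.+1 := delta_mx 0 ord0 *m invmx A.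

Lemma row_dir0A : row_dir0 *m A = \row_i (@dir0 k r) i.
Proof. by rewrite mulmxKV //; apply/rowP => i; rewrite !mxE eqxx. Qed.

Lemma row_dir0_core : row_dir0 \in core t A.
Proof.
apply/mem_core => j lt_j; rewrite row_dir0A mxE /dir0 -val_eqE /=.
by rewrite gtn_eqF // (leq_ltn_trans _ lt_j).
Qed.

Local Notation f := (lin_change A (permutti D)).

(** For p in the core, f(p + a w) = a^(d - mu) K_w(a). So the homogeneous parts of the Taylor
    expansion below degree d - mu vanish, and the part of degree d - mu takes the value K_w(0),
    which is L^mu P_mu at w. *)
Lemma multiplicity_core (p : 'rV[k]_r.+1) y : p \in core t A -> Lform y ((p *m A) 0) != 0 ->
  (coefP D ord_max).@[y] != 0 -> multiplicity f p (d - mu).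
Proof.
move=> /mem_core pc Ly Py; rewrite /multiplicity.
set fp := _ \mPo _.
have fpE (w : 'rV[k]_r.+1) : fp.@[w 0] = f.@[(w + p) 0].
  rewrite comp_mpoly_meval; apply: meval_eq => i.
  by rewrite tnth_mktuple mevalD mevalXU mevalC mxE.
have EsA (w : 'rV[k]_r.+1) a j : ((a *: w + p) *m A) 0 j = (p *m A) 0 j + a * (w *m A) 0 j.
  by rewrite mulmxDl -scalemxAl [LHS]mxE [X in X + _ = _]mxE addrC.
pose K (w : 'rV[k]_r.+1) : {poly k} := \sum_(l < mu.+1) 'X^(mu - l) *
  ((Lform ((w *m A) 0) ((p *m A) 0))%:P + (Lform ((w *m A) 0) ((w *m A) 0)) *: 'X) ^+ l *
  ((coefP D l).@[(w *m A) 0])%:P.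
have EK (w : 'rV[k]_r.+1) : \sum_(e < msize fp) (pihomog mdeg e fp).@[w 0] *: 'X^e = 'X^(d - mu) * K w.
  apply: (poly_ext char0) => a; rewrite -(meval_scaled_pihomog _ (leqnn _)).
  transitivity (fp.@[(a *: w) 0]); first by apply: meval_eq => i; rewrite mxE.
  rewrite fpE meval_lin_change (@meval_permutti_outer _ ((w *m A) 0) a); last first.
    by move=> j lt_j; rewrite EsA pc // add0r.
  rewrite hornerM hornerXn /K -[(\sum_(l < _) _).[a]]/(horner_eval a _) raddf_sum; congr (_ * _).
  apply: eq_bigr => l _; rewrite /= /horner_eval !hornerM !horner_exp hornerD hornerZ !hornerC hornerX.
  congr (_ * _ ^+ _ * _); rewrite [_ * a]mulrC -Lform_D; apply: eq_bigr => i _; congr (_ * _).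
  by rewrite EsA.
have cE (w : 'rV[k]_r.+1) e : (e < msize fp)%N ->
    (pihomog mdeg e fp).@[w 0] = if (e < d - mu)%N then 0 else (K w)`_(e - (d - mu)).
  move=> lt_e; have := congr1 (fun q : {poly k} => q`_e) (EK w).
  rewrite coefXnM => <-; rewrite coef_sum (bigD1 (Ordinal lt_e)) //= coefZ coefXn eqxx mulr1.
  rewrite big1 ?addr0 // => l ne; rewrite coefZ coefXn.
  by case: eqP => [E|_]; rewrite ?mulr0 //; case/eqP: ne; apply/val_inj.
split=> [mon Hm|].
  rewrite leqNgt; apply/negP => lt_m; have := msize_mdeg_lt Hm => lt_s.
  move: Hm; rewrite mcoeff_msupp -(mcoeff_pihomog fp (erefl (mdeg mon))).
  suff -> : pihomog mdeg (mdeg mon) fp = 0 by rewrite mcoeff0 eqxx.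
  apply: (mpoly_row_ext char0) => w; rewrite meval0 cE // lt_m //.
pose wy : 'rV[k]_r.+1 := (\row_i y i) *m invmx A.
have wyA : wy *m A = \row_i y i by rewrite mulmxKV.
have Ky : (K wy)`_0 != 0.
  rewrite -horner_coef0 /K -[(\sum_(l < _) _).[0]]/(horner_eval 0 _) raddf_sum (bigD1 ord_max) //= big1.
    rewrite addr0 /horner_eval !hornerM hornerXn subnn expr0 mul1r horner_exp hornerD hornerZ !hornerC hornerX.
    rewrite mulr0 addr0 wyA mulf_neq0 ?expf_neq0 //.
      apply: contraNneq Ly => E; apply/eqP; rewrite -[RHS]E; apply: eq_bigr => i _; congr (_ * _).
      by rewrite meval_row.
    by rewrite -meval_row.
  move=> l lm; rewrite /horner_eval !hornerM hornerXn expr0n subn_eq0 leqNgt.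
  have -> /= : (l < mu)%N.
    rewrite ltn_neqAle -ltnS ltn_ord andbT; apply: contra lm => /eqP E; apply/eqP/val_inj; exact: E.
  by rewrite !mul0r.
have lt_s : (d - mu < msize fp)%N.
  rewrite ltnNge; apply/negP => le_s; have := congr1 (fun q : {poly k} => q`_(d - mu)) (EK wy).
  rewrite coefXnM ltnn subnn => E; move: Ky; rewrite -E coef_sum big1 ?eqxx // => l _.
  by rewrite coefZ coefXn gtn_eqF ?mulr0 // (leq_trans (ltn_ord l)).
have := cE wy _ lt_s; rewrite ltnn subnn => E.
have ph0 : pihomog mdeg (d - mu) fp != 0 by apply: contraNneq Ky => E0; rewrite -E E0 meval0.
have Hs := mlead_supp ph0; have Em := dhomog_mf (pihomogP _ _ _) Hs.
exists (mlead (pihomog mdeg (d - mu) fp)) => //.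
by rewrite mcoeff_msupp -(mcoeff_pihomog fp Em) mleadc_eq0.
Qed.

Lemma generically_multiplicity : (exists y, (coreM D ord0).@[y] != 0 /\ (coefP D ord_max).@[y] != 0) ->
  generically_in (@xcoord k r.+1) (fun p => p \in core t A /\ p != 0)
    (fun p => multiplicity f p (d - mu)).
Proof.
move=> [y [My Py]]; apply: generically_intro => p0 W [p0c p00] oW Wp0.
have [w [pw w0 wW]] := zopen_polyfun oW Wp0.
pose h (p : 'rV[k]_r.+1) := (lin_change A (Lmpoly y)).@[p 0].
have hE p : h p = Lform y ((p *m A) 0) by rewrite /h meval_lin_change meval_Lmpoly.
(* Moving along the first coordinate direction stays in the core and changes h by c M_0(y), so h
   becomes nonzero on this line. *)
pose L c := p0 + c *: row_dir0.
have hL c : h (L c) = h p0 + c * (coreM D ord0).@[y].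
  rewrite !hE -Lform_dir0 -Lform_D; apply: eq_bigr => i _; congr (_ * _).
  by rewrite /L mulmxDl -scalemxAl row_dir0A !mxE.
have [c' hc'] : exists c', h (L c') != 0.
  have [E|E] := eqVneq (h p0) 0; first by exists 1; rewrite hL E add0r mul1r.
  by exists 0; rewrite hL mul0r addr0.
have HL j : exists p : {poly k}, forall c, xcoord j (L c) = p.[c].
  exists ((p0 0 j)%:P + (row_dir0 0 j)%:P * 'X) => c.
  by rewrite /xcoord !mxE !hornerE mulrC.
have [|e [we he]] := line_meets (c := 0) (c' := c') char0 HL pw (polyfun_meval _) _ hc'.
  by rewrite /L scale0r addr0.
have Lc : L e \in core t A by rewrite memvD ?memvZ ?row_dir0_core.
have h_neq0 p : h p != 0 -> p != 0.
  apply: contraNneq => ->; rewrite hE /Lform big1 // => i _.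
  by rewrite mul0mx mxE mulr0.
exists (L e); split; [split=> //; exact: h_neq0|exact: wW|].
exists h; split=> //; first exact: polyfun_meval.
by move=> p [pc _]; rewrite hE => hp; apply: (multiplicity_core pc hp).
Qed.

End PermuttiGeometry.

(** * Sections through the core *)

Lemma poly_split_homog (k : fieldType) m (c : 'I_m.+1 -> k) (rs : seq k) a :
  (0 < m)%N ->
  \poly_(l < m.+1) c (inord l) = a *: \prod_(z <- rs) ('X - z%:P) -> size rs = m ->
  forall z s, \sum_(l < m.+1) c l * s ^+ (m - l) * z ^+ l = a * \prod_(x <- rs) (z - x * s).
Proof.
move=> m0 E sr z s; have [->|s0] := eqVneq s 0.
  rewrite (bigD1 ord_max) //= subnn expr0 mulr1 big1 => [|l lm]; last first.
    rewrite expr0n subn_eq0 leqNgt; have -> /= : (l < m)%N; last by rewrite mulr0 mul0r.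
    rewrite ltn_neqAle -ltnS ltn_ord andbT; apply: contra lm => /eqP E'; exact/eqP/val_inj.
  have -> : \prod_(x <- rs) (z - x * 0) = z ^+ m.
    under eq_bigr => x _ do rewrite mulr0 subr0.
    by rewrite big_const_seq count_predT sr; elim: (m) => //= i ->; rewrite exprS.
  have := congr1 (fun p : {poly k} => p`_m) E; rewrite coef_poly ltnSn coefZ.
  have -> : inord m = ord_max :> 'I_m.+1 by apply/val_inj; rewrite /= inordK.
  have /monicP : \prod_(z <- rs) ('X - z%:P) \is monic by apply: monic_prod_XsubC.
  by rewrite lead_coefE size_prod_XsubC sr /= => ->; rewrite mulr1 addr0 => ->.
have Ep : s ^+ m * (\prod_(x <- rs) ('X - x%:P)).[z / s] = \prod_(x <- rs) (z - x * s).
  rewrite horner_prod -sr; elim: rs {E sr} => [|x rs IH]; first by rewrite !big_nil mulr1.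
  rewrite !big_cons /= exprS hornerXsubC -IH mulrACA; congr (_ * _).
  by rewrite mulrBr mulrCA divff // mulr1 [s * x]mulrC.
have := congr1 (fun p : {poly k} => s ^+ m * p.[z / s]) E.
rewrite horner_poly hornerZ [RHS]mulrCA Ep mulr_sumr => <-.
apply: eq_bigr => l _; rewrite inord_val.
have le_l : (l <= m)%N by rewrite -ltnS.
have -> : s ^+ m = s ^+ (m - l) * s ^+ l by rewrite -exprD subnK.
rewrite expr_div_n.
have : s ^+ l != 0 by rewrite expf_neq0.
move: (s ^+ l) (s ^+ (m - l)) (z ^+ l) => x y w x0; by field.
Qed.

Section Hyperplane.
Variables (k : fieldType) (m : nat).
Implicit Types (U : {vspace 'rV[k]_m}) (c : 'cV[k]_m).

Definition covector c : 'Hom('rV[k]_m, 'rV[k]_1) := linfun (mulmxr c).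

Lemma mem_lker_covector c w : (w \in lker (covector c)) = ((w *m c) 0 0 == 0).
Proof.
rewrite memv_ker lfunE /=; apply/eqP/eqP => [->|E]; first by rewrite mxE.
by apply/rowP => i; rewrite (ord1 i) E mxE.
Qed.

Lemma dim_cap_covector U c u : u \in U -> (u *m c) 0 0 != 0 ->
  \dim (U :&: lker (covector c)) = (\dim U).-1.
Proof.
move=> uU uc; rewrite -(limg_ker_dim (covector c) U).
suff -> : \dim (covector c @: U) = 1%N by rewrite addn1.
apply/eqP; rewrite eqn_leq; apply/andP; split.
  by apply: leq_trans (dimvS (subvf _)) _; rewrite dimvf /dim /= mul1n.
rewrite lt0n dimv_eq0; apply: contra uc => /eqP E.
by rewrite -mem_lker_covector memv_ker -memv0 -E memv_img.
Qed.

End Hyperplane.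

Section CoreDim.
Variables (k : fieldType) (r t : nat) (A : 'M[k]_r.+1).
Hypothesis uA : A \in unitmx.
Hypothesis ht : (t <= r)%N.

Lemma dim_core : \dim (core t A) = t.+1.
Proof.
pose E : 'M[k]_(t.+1, r.+1) := \matrix_(i, j) (inord i == j)%:R.
pose F : 'Hom('rV[k]_t.+1, 'rV[k]_r.+1) := linfun (mulmxr (E *m invmx A)).
have FA u j : (F u *m A) 0 j = \sum_i u 0 i * (inord i == j)%:R.
  rewrite lfunE /= mulmxA mulmxKV // mxE; apply: eq_bigr => i _; by rewrite mxE.
have inj (i i' : 'I_t.+1) : (inord i == inord i' :> 'I_r.+1) = (i == i').
  by rewrite -!val_eqE /= !inordK // (leq_trans (ltn_ord _)).
have FAi u (i : 'I_t.+1) : (F u *m A) 0 (inord i) = u 0 i.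
  rewrite FA (bigD1 i) //= eqxx mulr1 big1 ?addr0 // => i' /negPf ne.
  by rewrite inj ne mulr0.
suff -> : core t A = (F @: fullv)%VS.
  rewrite limg_dim_eq ?dimvf /dim /= ?mul1n //.
  apply/eqP; rewrite -subv0; apply/subvP => u; rewrite memv_cap memv_ker => /andP[_ /eqP Fu].
  by rewrite memv0; apply/eqP/rowP => i; rewrite -FAi Fu mul0mx !mxE.
apply/eqP; rewrite eqEsubv; apply/andP; split; apply/subvP => w.
  move=> /mem_core wc; have -> : w = F (\row_i (w *m A) 0 (inord i)).
    apply: (can_inj (mulmxK uA)); apply/rowP => j; rewrite FA.
    have [lt_j|le_j] := ltnP t j.
      rewrite wc // big1 // => i _; case: eqP => [Ej|_]; last by rewrite mulr0.
      by move: lt_j; rewrite -Ej ltnNge (inord_le ht).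
    rewrite (bigD1 (inord j)) //= big1 => [|i ne].
      by rewrite mxE inordK ?ltnS // inord_val eqxx mulr1 addr0.
    case: eqP => [Ej|_]; last by rewrite mulr0.
    by case/eqP: ne; apply/val_inj; rewrite /= inordK ?ltnS // -Ej inordK // (leq_trans (ltn_ord i)).
  exact: memv_img (memvf _).
case/memv_imgP => u _ ->; apply/mem_core => j lt_j; rewrite FA big1 // => i _.
case: eqP => [Ej|_]; last by rewrite mulr0.
by move: lt_j; rewrite -Ej ltnNge (inord_le ht).
Qed.

Lemma dim_core_line v : v \notin core t A -> \dim (core t A + <[v]>) = t.+2.
Proof.
move=> vc; have [E|vn0] := eqVneq v 0; first by rewrite E mem0v in vc.
rewrite dimv_disjoint_sum ?dim_core ?dim_vline ?vn0 ?addn1 //.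
apply/eqP; rewrite -subv0; apply/subvP => w; rewrite memv_cap memv0 => /andP[wc /vlineP[a Ew]].
have [a0|a0] := eqVneq a 0; first by rewrite Ew a0 scale0r.
by case/negP: vc; rewrite -[v](scalerK a0) -Ew memvZ.
Qed.

Lemma mem_core_line v w : (w \in (core t A + <[v]>)%VS) <-> exists p a, p \in core t A /\ w = p + a *: v.
Proof.
split=> [/memv_addP[p pc [_ /vlineP[a ->] ->]]|[p [a [pc ->]]]]; first by exists p, a.
by rewrite memv_add // memvZ // memv_line.
Qed.

End CoreDim.

Lemma polyfun_xcoordP (k : fieldType) m (h : 'rV[k]_m -> k) :
  polyfun (@xcoord k m) h -> exists p : {mpoly k[m]}, forall v, h v = p.@[v 0].
Proof.
move=> [s [c [p Ep]]]; exists (p \mPo [tuple 'X_(c l) | l < s]) => v.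
rewrite Ep comp_mpoly_meval; apply: meval_eq => l; by rewrite tnth_mktuple mevalXU.
Qed.

Lemma separable_uniq_roots (k : closedFieldType) (p : {poly k}) : coprimep p p^`() ->
  exists2 rs : seq k, uniq rs & p = lead_coef p *: \prod_(z <- rs) ('X - z%:P).
Proof.
move=> cop; have [rs E] := closed_field_poly_normal p; exists rs => //.
have sep : separable_poly p by rewrite unlock.
have l0 : lead_coef p != 0 by rewrite lead_coef_eq0 separable_poly_neq0.
move: sep; rewrite E unlock derivZ coprimepZl // coprimepZr // => cop'.
by rewrite -separable_prod_XsubC unlock.
Qed.

Section Fibre.
Variables (k : closedFieldType) (r t n d mu : nat).
Hypothesis char0 : [pchar k] =i pred0.
Hypotheses (ht1 : (1 <= t)%N) (htr : (t.+2 <= r)%N) (hn : (1 <= n)%N) (hnd : (n < d)%N).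
Hypotheses (hmu0 : (0 < mu)%N) (hmu : (mu * n <= d)%N).
Local Notation X := (@pdata_wf k r t mu n d).
Variable D : pdata k r t mu.
Hypothesis XD : X D.

Let ht : (t <= r)%N. Proof. exact: ltnW (ltnW htr). Qed.

(** It implies that M_0(y) and P_mu(y) are nonzero, and says that the binary form cut out over y has
    mu distinct roots. *)
Definition z_split (y : 'I_r.+1 -> k) :=
  size (z_line D y) = mu.+1 /\ coprimep (z_line D y) (z_line D y)^`().

Lemma z_split_open b : z_split b -> exists Delta : {mpoly k[r.+1]},
  Delta.@[b] != 0 /\ forall y, Delta.@[y] != 0 -> z_split y.
Proof.
move=> [sb cb].
pose p (w : 'rV[k]_r.+1) := z_line D (w 0).
have pfp : polyfun1 (@xcoord k r.+1) (fun=> True) p.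
  move=> i; rewrite /p /z_line; have [lt_i|le_i] := ltnP i mu.+1.
    apply: (polyfun_on_ext (h1 := fun w : 'rV[k]_r.+1 => (coreM D ord0 ^+ i * coefP D (inord i)).@[w 0])).
      by move=> w _; rewrite coef_poly lt_i mevalM rmorphXn.
    exact/polyfun_onW/polyfun_meval.
  apply: (polyfun_on_ext (h1 := fun=> 0)); last exact: polyfun_on_const.
  by move=> w _; rewrite coef_poly ltnNge le_i.
have Ep v : p (\row_i v i) = z_line D v.
  by rewrite /p /z_line; apply/polyP => i; rewrite !coef_poly -!meval_row.
have [||| h [ph h0 hD]] := open_separable (m := mu) (D0 := \row_i b i) pfp I _ hmu0.
- by move=> w _; apply: size_poly.
- by rewrite Ep.
- by rewrite Ep.
have [Delta ED] := polyfun_xcoordP ph.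
exists Delta; split; first by rewrite meval_row -ED.
by move=> y; rewrite meval_row -ED => /(hD _ I); rewrite Ep.
Qed.

Lemma z_splitP y : z_split y -> exists rs : seq k,
  [/\ (coreM D ord0).@[y] != 0, (coefP D ord_max).@[y] != 0, uniq rs, size rs = mu &
   forall z s, \sum_(l < mu.+1) ((coreM D ord0).@[y] ^+ l * (coefP D l).@[y]) * s ^+ (mu - l) * z ^+ l =
     lead_coef (z_line D y) * \prod_(x <- rs) (z - x * s)].
Proof.
move=> [sz cop]; have [rs urs E] := separable_uniq_roots cop.
have l0 : lead_coef (z_line D y) != 0 by rewrite lead_coef_eq0 -size_poly_eq0 sz.
have : lead_coef (z_line D y) = (coreM D ord0).@[y] ^+ mu * (coefP D ord_max).@[y].
  rewrite lead_coefE sz coef_poly ltnSn; congr (_ * (coefP D _).@[_]).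
  by apply/val_inj; rewrite /= inordK.
move=> El; move: (l0); rewrite El mulf_eq0 negb_or expf_eq0 hmu0 /= => /andP[M0 P0].
have srs : size rs = mu.
  by apply/succn_inj; rewrite -sz E size_scale // size_prod_XsubC.
exists rs; split=> //; apply: (poly_split_homog (c := fun l : 'I_mu.+1 => (coreM D ord0).@[y] ^+ l * (coefP D l).@[y])) => //.
rewrite -El -{}E /z_line.
by apply/polyP => i; rewrite !coef_poly; case: ltnP => // lt_i; rewrite inordK.
Qed.

Lemma Lform_scale_base y y' c x : (forall j : 'I_r.+1, (t < j)%N -> y' j = c * y j) ->
  Lform D y' x = c ^+ (n - 1) * Lform D y x.
Proof.
move=> Ey; have [HM _ _] := XD; rewrite /Lform mulr_sumr; apply: eq_bigr => i _.
have [h o] := HM i; rewrite mulrA -(meval_homog _ _ h).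
by congr (_ * _); apply: (meval_outer o).
Qed.

Variable A : 'M[k]_r.+1.
Hypothesis uA : A \in unitmx.
Local Notation Pi := (core t A).
Local Notation f := (lin_change A (permutti D)).
Local Notation e0 := (@row_dir0 k r A).

Definition Lcol y : 'cV[k]_r.+1 := \sum_(i < t.+1) (coreM D i).@[y] *: delta_mx (inord i) 0.

Lemma mulmx_delta_col (w : 'rV[k]_r.+1) (j : 'I_r.+1) : (w *m delta_mx j (0 : 'I_1)) 0 0 = w 0 j.
Proof.
rewrite mxE (bigD1 j) //= mxE !eqxx mulr1 big1 ?addr0 // => i /negPf ne.
by rewrite mxE ne mulr0.
Qed.

Lemma mulmx_Lcol y (x : 'rV[k]_r.+1) : (x *m Lcol y) 0 0 = Lform D y (x 0).
Proof.
rewrite mulmx_sumr summxE; apply: eq_bigr => i _.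
by rewrite -scalemxAr [LHS]mxE mulmx_delta_col.
Qed.

Definition gam_of y : {vspace 'rV[k]_r.+1} := (Pi :&: lker (covector (A *m Lcol y)))%VS.

Lemma mem_gam_of y u : (u \in gam_of y) = (u \in Pi) && (Lform D y ((u *m A) 0) == 0).
Proof. by rewrite memv_cap mem_lker_covector mulmxA mulmx_Lcol. Qed.

Lemma Lform_row_dir0 y : Lform D y ((e0 *m A) 0) = (coreM D ord0).@[y].
Proof.
rewrite row_dir0A // -(@Lform_dir0 k r t mu htr); apply: eq_bigr => i _.
by rewrite mxE.
Qed.

Lemma dim_gam_of y : (coreM D ord0).@[y] != 0 -> \dim (gam_of y) = t.
Proof.
move=> M0; rewrite (@dim_cap_covector _ _ _ _ e0) ?dim_core ?row_dir0_core //.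
by rewrite mulmxA mulmx_Lcol Lform_row_dir0.
Qed.

(* A point of W off Pi is determined up to scaling and translation by Pi, and
   neither changes [gam_of]. *)
Definition Gam (W : {vspace 'rV[k]_r.+1}) := gam_of ((vpick (W :\: Pi)%VS *m A) 0).

Lemma Gam_line v : v \notin Pi -> Gam (Pi + <[v]>) = gam_of ((v *m A) 0).
Proof.
move=> vc; set u := vpick (((Pi + <[v]>) :\: Pi)%VS).
have uW : u \in ((Pi + <[v]>) :\: Pi)%VS by apply: memv_pick.
have u0 : u != 0.
  rewrite vpick0 diffv_eq0; apply: contra vc => /subvP; apply.
  by apply: subvP (addvSr _ _) _ (memv_line _).
have /mem_core_line[p [a [pc Eu]]] := subvP (diffvSl _ _) _ uW.
have a0 : a != 0.
  apply: contraNneq u0 => a0; rewrite -memv0 -(capv_diff (Pi + <[v]>) Pi) memv_cap uW.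
  by rewrite Eu a0 scale0r addr0.
have Ey (j : 'I_r.+1) : (t < j)%N -> (u *m A) 0 j = a * (v *m A) 0 j.
  move=> lt_j; rewrite Eu mulmxDl -scalemxAl [LHS]mxE [X in _ + X = _]mxE.
  by move/mem_core: pc => ->; rewrite // add0r.
apply/vspaceP => w; rewrite /Gam -/u.
apply: (etrans (mem_gam_of _ w)); apply: (etrans _ (esym (mem_gam_of _ w))).
by rewrite (Lform_scale_base ((w *m A) 0) Ey) mulf_eq0 expf_eq0 (negPf a0) andbF.
Qed.

Lemma mem_core_neq v : v \notin Pi -> exists2 j : 'I_r.+1, (t < j)%N & (v *m A) 0 j != 0.
Proof.
move=> vc; apply: NNPP => H; case/negP: vc; apply/mem_core => j lt_j.
by apply/eqP; apply: NNPP => E; apply: H; exists j => //; apply/negP.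
Qed.

(** On Pi' the two linear forms s and L are independent and the residual equation g is a binary form
    in them. Each of its roots gives one hyperplane of Pi' through Gamma, which is where s = L =
    0. *)
Lemma cuts_cone v : v \notin Pi -> z_split ((v *m A) 0) ->
  cuts_cone_off f (Pi + <[v]>) Pi t mu (Gam (Pi + <[v]>)).
Proof.
move=> vc good; rewrite Gam_line //.
have [j1 lt_j1 yj1] := mem_core_neq vc.
have [y Ey] : exists y, y = (v *m A) 0 by exists ((v *m A) 0).
rewrite -Ey in good yj1 *.
have [rs [M0 Pmu urs srs Esplit]] := z_splitP good.
have [W EW] : exists W, W = (Pi + <[v]>)%VS by exists (Pi + <[v]>)%VS.
rewrite -EW.
(* s vanishes on Pi and is normalized by an outer coordinate of v, so that p + a v with p in Pi has
   s = a. *)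
have [s [sE sH]] : exists s : {mpoly k[r.+1]},
    (forall w : 'rV[k]_r.+1, s.@[w 0] = (y j1)^-1 * (w *m A) 0 j1) /\ s \is 1.-homog.
  exists (lin_change A ((y j1)^-1 *: 'X_j1)); split=> [w|].
    by rewrite meval_lin_change mevalZ mevalXU.
  by apply: lin_change_homog; rewrite dhomogZ // dhomogX /= mdeg1.
have [L [LE LH]] : exists L : {mpoly k[r.+1]},
    (forall w : 'rV[k]_r.+1, L.@[w 0] = Lform D y ((w *m A) 0)) /\ L \is 1.-homog.
  exists (lin_change A (Lmpoly D y)); split=> [w|].
    by rewrite meval_lin_change meval_Lmpoly.
  by apply: lin_change_homog; apply: Lmpoly_homog.
pose g := \sum_(l < mu.+1) (coefP D l).@[y] *: (s ^+ (mu - l) * L ^+ l).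
have coreA (p : 'rV[k]_r.+1) : p \in Pi -> forall j : 'I_r.+1, (t < j)%N -> (p *m A) 0 j = 0 by move/mem_core.
have s_core (p : 'rV[k]_r.+1) : p \in Pi -> s.@[p 0] = 0 by move=> /coreA pc; rewrite sE pc ?mulr0.
have s_line (p : 'rV[k]_r.+1) a : p \in Pi -> s.@[(p + a *: v) 0] = a.
  move=> /coreA pc; rewrite sE mulmxDl -scalemxAl mxE [X in _ + X]mxE pc // add0r -Ey.
  by rewrite mulrCA mulVf // mulr1.
have L_lin a b (u w : 'rV[k]_r.+1) : L.@[(a *: u + b *: w) 0] = a * L.@[u 0] + b * L.@[w 0].
  rewrite !LE /Lform !mulr_sumr -big_split; apply: eq_bigr => i _ /=.
  rewrite mulmxDl -!scalemxAl mxE [X in X + _]mxE [X in _ + X]mxE; ring.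
have s_lin a b (u w : 'rV[k]_r.+1) : s.@[(a *: u + b *: w) 0] = a * s.@[u 0] + b * s.@[w 0].
  rewrite !sE mulmxDl -!scalemxAl mxE [X in X + _]mxE [X in _ + X]mxE; ring.
have L_e0 : L.@[e0 0] = (coreM D ord0).@[y] by rewrite LE Lform_row_dir0.
have rearr (a b c e : k) : a != 0 -> b * (c * e) = a * b * c * (e / a) by move=> a0; field.
(* The coefficients of [z_line] carry M_0(y)^l, so the variable of the split form is L / M_0(y)
   rather than L. *)
have gE (w : 'rV[k]_r.+1) : g.@[w 0] = lead_coef (z_line D y) *
    \prod_(x <- rs) (L.@[w 0] / (coreM D ord0).@[y] - x * s.@[w 0]).
  rewrite -Esplit raddf_sum; apply: eq_bigr => l _.
  rewrite /= mevalZ mevalM !rmorphXn /= expr_div_n.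
  by apply: rearr; rewrite expf_neq0.
have l0 : lead_coef (z_line D y) != 0 by rewrite lead_coef_eq0 -size_poly_eq0 good.1.
have g0P (w : 'rV[k]_r.+1) : zeros g w <-> exists2 x, x \in rs & L.@[w 0] = (coreM D ord0).@[y] * x * s.@[w 0].
  have eqE x : (L.@[w 0] / (coreM D ord0).@[y] - x * s.@[w 0] == 0) =
      (L.@[w 0] == (coreM D ord0).@[y] * x * s.@[w 0]).
    by rewrite subr_eq0 -(inj_eq (mulfI M0)) mulrCA divff // mulr1 mulrA.
  rewrite /zeros gE; split=> [/eqP|[x xrs E]].
    rewrite mulf_eq0 (negPf l0) /= prodf_seq_eq0 => /hasP [x xrs /=]; rewrite eqE => /eqP.
    by exists x.
  apply/eqP; rewrite mulf_eq0; apply/orP; right; rewrite prodf_seq_eq0; apply/hasP; exists x => //=.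
  by rewrite eqE E.
pose Lamc (j : 'I_mu) := Lcol y - ((coreM D ord0).@[y] * rs`_j * (y j1)^-1) *: delta_mx j1 0.
have LamcE j (w : 'rV[k]_r.+1) : (w *m (A *m Lamc j)) 0 0 = L.@[w 0] - (coreM D ord0).@[y] * rs`_j * s.@[w 0].
  rewrite mulmxA mulmxBr mxE mulmx_Lcol -LE [X in _ + X]mxE -scalemxAr [X in - X]mxE mulmx_delta_col.
  by rewrite sE !mulrA.
have e0c : e0 \in Pi by apply: row_dir0_core.
have coreW p : p \in Pi -> p \in W by rewrite EW; apply/subvP/addvSl.
have vW : v \in W by rewrite EW; apply: subvP (addvSr _ _) _ (memv_line _).
have WP w : w \in W -> exists p a, p \in Pi /\ w = p + a *: v by rewrite EW => /mem_core_line.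
have [Lam [LamP LamD]] : exists Lam : 'I_mu -> {vspace 'rV[k]_r.+1},
    (forall j w, (w \in Lam j) = (w \in W) && (L.@[w 0] == (coreM D ord0).@[y] * rs`_j * s.@[w 0])) /\
    (forall j, \dim (Lam j) = t.+1).
  exists (fun j => W :&: lker (covector (A *m Lamc j)))%VS; split=> [j w|j].
    by rewrite memv_cap mem_lker_covector LamcE subr_eq0.
  rewrite (@dim_cap_covector _ _ _ _ e0); first by rewrite EW dim_core_line.
    exact: coreW.
  by rewrite LamcE L_e0 s_core // mulr0 subr0.
have CP w : (w \in W /\ zeros g w) <-> exists j, w \in Lam j.
  split=> [[wW /g0P[x xrs E]]|[j]].
    have lt_i : (index x rs < mu)%N by rewrite -srs index_mem.
    by exists (Ordinal lt_i); rewrite LamP wW nth_index //= E.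
  rewrite LamP => /andP[wW /eqP E]; split=> //; apply/g0P; exists rs`_j => //.
  by rewrite mem_nth ?srs.
exists g, mu, Lam; split; [split=> //|split=> //|].
- exists s, (d - mu)%N; split=> //.
  + move=> w /WP[p [a [pc ->]]]; rewrite /zeros s_line //; split=> [->|].
      by rewrite scale0r addr0.
    by rewrite -{2}(s_line p a pc) => /s_core.
  + move=> w /WP[p [a [pc Ew]]]; have sw : s.@[w 0] = a by rewrite Ew s_line.
    rewrite meval_lin_change (@meval_permutti_outer k r t n d mu hn hnd hmu D XD _ y a).
      rewrite sw; congr (_ * _); rewrite /g raddf_sum; apply: eq_bigr => l _.
      by rewrite /= mevalZ mevalM !rmorphXn /= sw LE mulrC.
    move=> j lt_j; rewrite Ew mulmxDl -scalemxAl mxE [X in _ + X]mxE -Ey.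
    by rewrite coreA // add0r.
  + exists e0 => //; apply/eqP => /g0P[x _]; rewrite L_e0 s_core // mulr0 => E.
    by move: M0; rewrite E eqxx.
- apply: rpred_sum => l _; apply: dhomogZ.
  have : s ^+ (mu - l) * L ^+ l \is (1 * (mu - l) + 1 * l).-homog.
    by apply: dhomogM; apply: dhomogMn.
  by rewrite !mul1n subnK // -ltnS.
(* Any nonzero vector of Gamma is a vertex, since s and L vanish on it; one exists because t > 0. *)
- have G0 : gam_of y != 0%VS by rewrite -dimv_eq0 dim_gam_of // -lt0n.
  have [uc Lu] : vpick (gam_of y) \in Pi /\ L.@[vpick (gam_of y) 0] = 0.
    have := memv_pick (gam_of y); rewrite mem_gam_of => /andP[-> /eqP <-].
    by rewrite LE.
  exists (vpick (gam_of y)); split; first by rewrite vpick0.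
    split; first exact: coreW.
    apply/g0P; exists rs`_0; first by rewrite mem_nth ?srs.
    by rewrite Lu s_core // mulr0.
  move=> w [wW /g0P[x xrs E]] a b; split; first by rewrite memvD ?memvZ // coreW.
  apply/g0P; exists x => //; rewrite L_lin s_lin Lu s_core // !mulr0 !add0r E; ring.
- move=> j j' Ej; apply/val_inj/eqP; rewrite -(nth_uniq 0 _ _ urs) ?srs ?ltn_ord //; apply/eqP.
  (* This point has s = 1 and L equal to M_0(y) times the j-th root, so the subspace through it
     determines the root. *)
  pose w := 1 *: v + (rs`_j - L.@[v 0] / (coreM D ord0).@[y]) *: e0.
  have sw : s.@[w 0] = 1.
    by rewrite s_lin [s.@[e0 0]]s_core // mulr0 addr0 mul1r -(s_line 0 1) ?mem0v // scale1r add0r.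
  have Lw : L.@[w 0] = (coreM D ord0).@[y] * rs`_j by rewrite L_lin L_e0; field.
  have := LamP j w; rewrite Ej LamP Lw sw !mulr1 eqxx.
  have -> : w \in W by rewrite memvD ?memvZ // coreW.
  by move=> /eqP/(mulfI M0).
- move=> j; split; first exact: LamD.
  apply/subvP => u; rewrite mem_gam_of LamP => /andP[uc /eqP Lu].
  by rewrite coreW // LE Lu s_core // mulr0 eqxx.
- split; last exact: dim_gam_of.
  by apply/subvP => u; rewrite mem_gam_of => /andP[uc _]; apply: coreW.
Qed.

Lemma dense_fibres Delta b : Delta.@[b] != 0 ->
  dense_open_in (@xcoord k r.+1) (fun v => v \notin Pi) (fun v => Delta.@[(v *m A) 0] != 0).
Proof.
move=> Db; split.
  apply: zopen_neq0; apply: (polyfun_ext _ (polyfun_meval (lin_change A Delta))).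
  by move=> v; rewrite meval_lin_change.
move=> W oW [v0 [_ Wv0]]; have [w [pw w0 wW]] := zopen_polyfun oW Wv0.
have [p Ep] := polyfun_xcoordP pw.
have p0 : p != 0 by apply: contraNneq w0 => E; rewrite Ep E meval0.
have D0 : lin_change A Delta != 0.
  apply: contraNneq Db => E; rewrite meval_row.
  have -> : \row_i b i = \row_i b i *m invmx A *m A by rewrite mulmxKV.
  by rewrite -meval_lin_change E meval0.
have x0 : lin_change A 'X_ord_max != 0.
  apply/negP => /eqP E; have := meval_lin_change A 'X_ord_max (delta_mx 0 ord_max *m invmx A).
  rewrite E meval0 mulmxKV // mevalXU mxE !eqxx => /esym/eqP.
  by rewrite oner_eq0.
(* The last factor keeps v off Pi, where the outer coordinate x_r vanishes. *)
have [|v] := @mpoly_neq0P k char0 _ (p * lin_change A Delta * lin_change A 'X_ord_max).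
  by rewrite !mulf_neq0.
rewrite meval_row !mevalM !meval_lin_change mevalXU !mulf_eq0 !negb_or => /andP[/andP[pv Dv] xv].
exists (\row_i v i); split=> //; last by apply: wW; rewrite Ep.
apply/negP => /mem_core vc; by move: xv; rewrite (vc ord_max) ?eqxx //; apply: ltnW htr.
Qed.

End Fibre.

(** * Families of subspaces and their Pluecker coordinates *)

Section Rowspan.
Variables (k : fieldType) (q m : nat).
Implicit Types B : 'M[k]_(q, m).

Lemma rowspan_limg B : rowspan B = (linfun (mulmxr B) @: fullv)%VS.
Proof.
apply/eqP; rewrite eqEsubv; apply/andP; split.
  apply/span_subvP => w /mapP[i _ ->]; apply/memv_imgP; exists (delta_mx 0 i); first exact: memvf.
  by rewrite lfunE /= rowE.
apply/subvP => w /memv_imgP[u _ ->]; rewrite lfunE /= mulmx_sum_row.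
apply: rpred_sum => i _; apply/rpredZ/memv_span/mapP; exists i => //.
by rewrite mem_enum.
Qed.

Lemma mem_rowspan w B : (w \in rowspan B) = (w <= B)%MS.
Proof.
rewrite rowspan_limg; apply/memv_imgP/submxP => [[u _ ->]|[u ->]]; exists u => //.
- by rewrite lfunE.
- exact: memvf.
- by rewrite lfunE.
Qed.

Lemma rowspan_eq_mx B1 B2 : rowspan B1 = rowspan B2 -> exists P, B1 = P *m B2.
Proof.
move=> E; apply/submxP/row_subP => i; rewrite -mem_rowspan -E mem_rowspan.
exact: row_sub.
Qed.

Lemma row_free_minor B : row_free B -> exists c : 'I_q -> 'I_m, \det (colsub c B) != 0.
Proof.
move=> fB; have fT : row_full B^T by rewrite /row_full mxrank_tr.
exists (fullrankfun fT); have := fullrowsub_unit fT.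
rewrite unitmxE unitfE -det_tr; congr (\det _ != 0).
by apply/matrixP => i j; rewrite !mxE.
Qed.

End Rowspan.

Section ParametrizedFamily.
Variables (k : fieldType) (q m a : nat).
Hypothesis char0 : [pchar k] =i pred0.
Variable B : 'M[{mpoly k[a]}]_(q, m).

Definition minor_at x (c : 'I_q -> 'I_m) : k := (\det (colsub c B)).@[x].

Lemma minor_atE x c : minor_at x c = \det (colsub c (map_mx (fun p : {mpoly k[a]} => p.@[x]) B)).
Proof.
rewrite /minor_at -[LHS]/(meval x _) -det_map_mx; congr (\det _).
by apply/matrixP => i j; rewrite !mxE.
Qed.

Lemma minor_relation_everywhere s (c : 'I_s -> 'I_q -> 'I_m) (G : {mpoly k[s]}) (W : {mpoly k[a]}) :
  W != 0 -> (forall x, W.@[x] != 0 -> G.@[fun l => minor_at x (c l)] = 0) ->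
  forall x, G.@[fun l => minor_at x (c l)] = 0.
Proof.
move=> W0 H x; pose Ga := G \mPo [tuple \det (colsub (c l) B) | l < s].
have EG y : Ga.@[y] = G.@[fun l => minor_at y (c l)].
  by rewrite comp_mpoly_meval; apply: meval_eq => l; rewrite tnth_mktuple.
suff G0 : Ga = 0 by rewrite -EG G0 meval0.
have /eqP : W * Ga = 0; last by rewrite mulf_eq0 (negPf W0) => /eqP.
apply: (mpoly_ext0 char0) => y; rewrite mevalM.
have [->|Wy] := eqVneq W.@[y] 0; first by rewrite mul0r.
by rewrite EG H ?mulr0.
Qed.

(** A family inside the image of B that contains the images of a dense open set of parameters
    satisfies just the relations holding identically in the parameters. Homogeneity of G absorbs the
    choice of basis, which multiplies all minors by det P. *)
Lemma vanishes_paramP (F : {vspace 'rV[k]_m} -> Prop) (W : {mpoly k[a]}) : W != 0 ->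
  (forall G, F G -> param_family B G) ->
  (forall x, W.@[x] != 0 -> let Bx := map_mx (fun p : {mpoly k[a]} => p.@[x]) B in
     row_free Bx /\ F (rowspan Bx)) ->
  forall s (c : 'I_s -> 'I_q -> 'I_m) (G : {mpoly k[s]}) e, G \is e.-homog ->
    (vanishes_on F c G <-> forall x, G.@[fun l => minor_at x (c l)] = 0).
Proof.
move=> W0 FB WF s c G e hG; split=> [van x|H B' _ /FB[x [_ /rowspan_eq_mx[P ->]]]]; last first.
  rewrite (@meval_eq _ _ _ (fun l => \det P * minor_at x (c l))) => [|l].
    by rewrite (meval_homog _ _ hG) H mulr0.
  by rewrite minor_atE -det_mulmx; congr (\det _); apply/matrixP => i j; rewrite !mxE; apply: eq_bigr => l' _; rewrite !mxE.
apply: (minor_relation_everywhere W0) => y Wy; have [fB FBy] := WF _ Wy.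
rewrite (@meval_eq _ _ _ (fun l => \det (colsub (c l) (map_mx (fun p : {mpoly k[a]} => p.@[y]) B)))) ?van //.
by move=> l; rewrite minor_atE.
Qed.

End ParametrizedFamily.

(** * Algebraic dependence by counting *)

Section Grid.
Variables (k : fieldType) (m N : nat).
Hypothesis char0 : [pchar k] =i pred0.
Variable p : {mpoly k[m]}.
Hypothesis szp : (msize p <= N)%N.

Lemma meval_one_var (v : 'I_m -> k) i : exists2 q : {poly k}, (size q <= N)%N &
  forall c, p.@[fun j => if j == i then c else v j] = q.[c].
Proof.
exists (\sum_(mm <- msupp p) (p@_mm * \prod_(j | j != i) v j ^+ mm j) *: 'X^(mm i)).
  rewrite big_seq; apply: (big_ind (fun q : {poly k} => size q <= N)%N).
  - by rewrite size_poly0.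
  - by move=> x y Hx Hy; apply: leq_trans (size_polyD _ _) _; rewrite geq_max Hx.
  move=> mm Hm; apply: leq_trans (size_scale_leq _ _) _; rewrite size_polyXn.
  apply: leq_trans szp; apply: leq_ltn_trans (msize_mdeg_lt Hm).
  by rewrite mdegE (bigD1 i) //= leq_addr.
move=> c; rewrite mevalE -[RHS]/(horner_eval c _) raddf_sum; apply: eq_bigr => mm _.
rewrite /= /horner_eval hornerZ hornerXn -mulrA; congr (_ * _).
rewrite (bigD1 i) //= eqxx mulrC; congr (_ * _).
by apply: eq_bigr => j /negPf->.
Qed.

(** The variables in the list S are freed from the grid one at a time; in each of them p is a
    univariate polynomial of size at most N with N roots. *)
Lemma mpoly_grid0 : (forall w : 'I_m -> nat, (forall i, w i < N)%N -> p.@[fun i => (w i)%:R] = 0) -> p = 0.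
Proof.
move=> H; suff cl (S : seq 'I_m) v w : (forall i, w i < N)%N ->
    p.@[fun i => if i \in S then v i else (w i)%:R] = 0.
  apply: (mpoly_ext0 char0) => v; have [N0|N0] := posnP N.
    by move: szp; rewrite N0 leqn0 msize_poly_eq0 => /eqP->; rewrite meval0.
  rewrite -[RHS](cl (enum 'I_m) v (fun=> 0%N)) //.
  by apply: meval_eq => i; rewrite mem_enum.
elim: S v w => [|i S IH] v w Hw; first by rewrite -[RHS](H w Hw); apply: meval_eq.
have [q sq Eq] := meval_one_var (fun l => if l \in S then v l else (w l)%:R) i.
have q0 : q = 0.
  apply: (poly_grid0 char0 sq) => j lt_j; rewrite -Eq.
  rewrite -[RHS](IH (fun l => if l == i then j%:R else v l) (fun l => if l == i then j else w l)).
    by apply: meval_eq => l; case: (l == i); case: (l \in S).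
  by move=> l; case: eqP.
transitivity q.[v i]; last by rewrite q0 horner0.
rewrite -Eq; apply: meval_eq => l; rewrite inE; by case: eqP => [->|].
Qed.

End Grid.

Lemma dhomog_monomial (k : fieldType) s m E (f : 'I_m -> {mpoly k[s]}) (al : 'I_m -> nat) :
  (forall l, f l \is E.-homog) -> \prod_l f l ^+ al l \is (\sum_l E * al l).-homog.
Proof.
move=> hf; elim/big_rec2: _ => [|l c p _ hp]; first exact: dhomog1.
by apply: dhomogM => //; apply: dhomogMn.
Qed.

(* The coefficients of a relation of degree < K in each variable are K^(m+1)
   unknowns, subject to the N^m linear conditions that the relation vanishes on
   a grid fine enough for its degree. *)
Lemma alg_dependent_count (k : fieldType) r t m E (f : 'I_m.+1 -> {mpoly k[r.+1]}) :
  [pchar k] =i pred0 -> (t + m)%N = r -> (forall l, outer_vars t (f l) /\ f l \is E.-homog) ->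
  alg_dependent f.
Proof.
move=> char0 Er Hf.
(* N exceeds the degree (m + 1) E K that a relation can reach, and N^m = K^m c^m is less than K^(m +
   1) since c^m < K. *)
pose c := (m.+1 * E).+1; pose K := (c ^ m).+1; pose N := (K * c)%N.
pose I := {ffun 'I_m.+1 -> 'I_K}; pose J := {ffun 'I_m -> 'I_N}.
have cIJ : (#|J| < #|I|)%N.
  rewrite !card_ffun !card_ord /N expnMn expnS mulnC ltn_pmul2r ?expn_gt0 //.
pose pt (ph : J) (i : 'I_r.+1) : k :=
  if (i <= t)%N then 0 else if insub (i - t.+1)%N is Some j then (ph j)%:R else 0.
pose mo (al : I) : {mpoly k[r.+1]} := \prod_l f l ^+ al l.
pose T : 'M[k]_(#|I|, #|J|) := \matrix_(a, b) (mo (enum_val a)).@[pt (enum_val b)].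
have [u [u0 uT]] : exists u : 'rV[k]_#|I|, u != 0 /\ u *m T = 0.
  apply: NNPP => H; suff : row_free T.
    by rewrite /row_free => /eqP E'; have := rank_leq_col T; rewrite E' leqNgt cIJ.
  apply: inj_row_free => u uT; apply: NNPP => u0; apply: H; exists u; split=> //; exact/eqP.
pose mn (al : I) : 'X_{1..m.+1} := [multinom (al l : nat) | l < m.+1].
pose G : {mpoly k[m.+1]} := \sum_(a < #|I|) u 0 a *: 'X_[mn (enum_val a)].
have GE : G \mPo [tuple f i | i < m.+1] = \sum_(a < #|I|) u 0 a *: mo (enum_val a).
  rewrite raddf_sum; apply: eq_bigr => a _ /=; rewrite comp_mpolyZ comp_mpolyX; congr (_ *: _).
  by apply: eq_bigr => l _; rewrite tnth_mktuple mnmE.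
exists G.
  have /rV0Pn[a ua] := u0; apply: contraNneq ua => /(congr1 (mcoeff (mn (enum_val a)))).
  rewrite mcoeff0 raddf_sum /= (bigD1 a) //= big1 ?addr0 => [|b ba].
    by rewrite mcoeffZ mcoeffX eqxx mulr1 => ->.
  rewrite mcoeffZ mcoeffX; case: eqP => [E'|_]; last by rewrite mulr0.
  case/eqP: ba; apply/enum_val_inj/ffunP => l; apply/val_inj.
  by have := congr1 (fun mm : 'X_{1..m.+1} => mm l) E'; rewrite !mnmE.
apply: (@mpoly_grid0 _ _ N char0); rewrite GE.
  apply: (big_ind (fun q : {mpoly k[r.+1]} => msize q <= N)%N).
  - by rewrite mmeasure0.
  - by move=> x y Hx Hy; apply: leq_trans (mmeasureD_le _ _ _) _; rewrite geq_max Hx.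
  move=> a _; apply: leq_trans (mmeasureZ_le _ _ _) _.
  have hm : mo (enum_val a) \is (\sum_l E * (enum_val a) l)%N.-homog.
    by apply: dhomog_monomial => l; case: (Hf l).
  apply: leq_trans (dhomog_msize_le hm) _.
  have : (\sum_l E * (enum_val a) l <= \sum_(l < m.+1) E * K)%N.
    by apply: leq_sum => l _; rewrite leq_mul2l ltnW ?orbT.
  rewrite sum_nat_const card_ord mulnA mulnC /N /c mulnS => H.
  by apply: leq_ltn_trans H _; rewrite -[X in (X < _)%N]add0n ltn_add2r.
move=> w Hw; pose ph : J := [ffun j : 'I_m => Ordinal (Hw (inord (t.+1 + j)))].
have Ew a : (mo (enum_val a)).@[fun i => (w i)%:R] = (mo (enum_val a)).@[pt ph].
  rewrite !rmorph_prod; apply: eq_bigr => l _; rewrite !rmorphXn; congr (_ ^+ _).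
  have [o _] := Hf l; apply: (meval_outer o) => i lt_i; rewrite /pt leqNgt lt_i /=.
  have lt_m : (i - t.+1 < m)%N by have := ltn_ord i; move: lt_i Er; clear; lia.
  rewrite insubT ffunE /=; congr (w _)%:R; apply/val_inj.
  by rewrite /= subnKC // inord_val.
have := congr1 (fun B : 'rV[k]_#|J| => B 0 (enum_rank ph)) uT; rewrite !mxE => <-.
rewrite raddf_sum; apply: eq_bigr => a _; rewrite /= mevalZ Ew mxE enum_rankK.
by [].
Qed.

(** * The family of the subspaces Gamma *)

Lemma cofactor_row_mx0 (R : comNzRingType) t (v : 'cV[R]_(1 + t)) (W : 'M[R]_(1 + t, t)) i :
  cofactor (row_mx v W) i 0 = cofactor (row_mx 0 W) i 0.
Proof.
rewrite /cofactor; congr (_ * \det _); apply/matrixP => a b; rewrite !mxE.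
by case: splitP => // b' E; have := ord1 b' => E'; move: E; rewrite E' /= /bump /=.
Qed.

(* Clearing the column v below its entry v_0 multiplies det (row_mx v W), which
   is linear in v, by v_0 ^ t. *)
Lemma det_hyperplane_basis (R : comNzRingType) t (v : 'cV[R]_(1 + t)) (W : 'M[R]_(1 + t, t)) :
  v 0 0 * \det (v 0 0 *: dsubmx W - dsubmx v *m usubmx W) =
  v 0 0 ^+ t * \sum_i v i 0 * cofactor (row_mx 0 W) i 0.
Proof.
set a := v 0 0; set S := _ - _.
have uv : usubmx v = a%:M.
  apply/matrixP => i j; rewrite !mxE !ord1 eqxx mulr1n; congr (v _ _); exact/val_inj.
have -> : \sum_i v i 0 * cofactor (row_mx 0 W) i 0 = \det (row_mx v W).
  rewrite (expand_det_col _ 0); apply: eq_bigr => i _; rewrite cofactor_row_mx0; congr (_ * _).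
  by rewrite !mxE; case: splitP => // j _; rewrite (ord1 j).
have EN : row_mx v W = block_mx (usubmx v) (usubmx W) (dsubmx v) (dsubmx W).
  by rewrite block_mxEh !vsubmxK.
pose L : 'M[R]_(1 + t) := block_mx 1%:M 0 (- dsubmx v) a%:M.
have EL : L *m row_mx v W = block_mx (usubmx v) (usubmx W) 0 S.
  rewrite EN mulmx_block !mul1mx !mul0mx !addr0 !mul_scalar_mx uv mulNmx mul_mx_scalar addNr.
  by rewrite mulNmx addrC.
have := congr1 determinant EL; rewrite det_mulmx det_lblock det_ublock det1 mul1r det_scalar uv.
by rewrite det_scalar expr1 => <-.
Qed.

Section Minors.
Variables (k : closedFieldType) (r t n d mu : nat).
Hypothesis char0 : [pchar k] =i pred0.
Hypotheses (ht1 : (1 <= t)%N) (htr : (t.+2 <= r)%N) (hn : (1 <= n)%N) (hnd : (n < d)%N).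
Hypotheses (hmu0 : (0 < mu)%N) (hmu : (mu * n <= d)%N).
Local Notation X := (@pdata_wf k r t mu n d).
Variable D : pdata k r t mu.
Hypothesis XD : X D.
Variable A : 'M[k]_r.+1.
Hypothesis uA : A \in unitmx.
Local Notation Pi := (core t A).

Let ht : (t <= r)%N. Proof. exact: ltnW (ltnW htr). Qed.

Definition gam_coords : 'M[{mpoly k[r.+1]}]_(t, r.+1) := \matrix_(j, i)
  (coreM D ord0 *+ (i == inord (lift ord0 j)) - coreM D (lift ord0 j) *+ (i == ord0)).

Definition gam_param : 'M[{mpoly k[r.+1]}]_(t, r.+1) :=
  gam_coords *m map_mx (@mpolyC r.+1 k) (invmx A).

Definition gam_coords_at x : 'M[k]_(t, r.+1) := \matrix_(j, i)
  ((coreM D ord0).@[x] *+ (i == inord (lift ord0 j)) - (coreM D (lift ord0 j)).@[x] *+ (i == ord0)).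

Lemma gam_param_at x :
  map_mx (fun p : {mpoly k[r.+1]} => p.@[x]) gam_param = gam_coords_at x *m invmx A.
Proof.
rewrite -[LHS]/(map_mx (meval x) _) map_mxM; congr (_ *m _); apply/matrixP => i j.
  by rewrite !mxE /= mevalB !mevalMn.
by rewrite !mxE /= mevalC.
Qed.

Lemma mul_gam_coords (u : 'rV[k]_t) x i : (u *m gam_coords_at x) 0 i =
  (coreM D ord0).@[x] * (\sum_j u 0 j *+ (i == inord (lift ord0 j))) -
  (\sum_j u 0 j * (coreM D (lift ord0 j)).@[x]) *+ (i == ord0).
Proof.
rewrite mxE mulr_sumr -sumrMnl -sumrB; apply: eq_bigr => j _.
by rewrite mxE mulrBr !mulrnAr mulrC.
Qed.

Lemma inord_lift_eq (j j' : 'I_t) :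
  (inord (lift ord0 j) == inord (lift ord0 j') :> 'I_r.+1) = (j == j').
Proof.
by rewrite -!val_eqE /= !inordK ?ltnS ?(leq_trans _ ht) //.
Qed.

Lemma inord_lift_eq0 (j : 'I_t) : (inord (lift ord0 j) == ord0 :> 'I_r.+1) = false.
Proof. by rewrite -val_eqE /= inordK // ltnS (leq_trans _ ht) // ltn_ord. Qed.

Lemma mul_gam_coords_lift (u : 'rV[k]_t) x j :
  (u *m gam_coords_at x) 0 (inord (lift ord0 j)) = (coreM D ord0).@[x] * u 0 j.
Proof.
rewrite mul_gam_coords inord_lift_eq0 mulr0n subr0 (bigD1 j) //= eqxx mulr1n big1 ?addr0 //.
by move=> j' ne; rewrite inord_lift_eq eq_sym (negPf ne).
Qed.

Lemma row_free_gam_param x : (coreM D ord0).@[x] != 0 -> row_free (gam_coords_at x *m invmx A).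
Proof.
move=> M0; apply: inj_row_free => u; rewrite mulmxA => /(canRL (mulmxKV uA)); rewrite mul0mx => E.
apply/rowP => j; apply: (mulfI M0).
by rewrite -mul_gam_coords_lift E !mxE mulr0.
Qed.

Lemma Lform_recl y x : Lform D y x =
  (coreM D ord0).@[y] * x ord0 + \sum_(j < t) (coreM D (lift ord0 j)).@[y] * x (inord (lift ord0 j)).
Proof.
rewrite /Lform big_ord_recl; congr (_ * x _ + _).
by apply/val_inj; rewrite /= inordK.
Qed.

Lemma rowspan_gam_param x : (coreM D ord0).@[x] != 0 ->
  rowspan (gam_coords_at x *m invmx A) = gam_of D A x.
Proof.
move=> M0; apply/vspaceP => w; rewrite mem_rowspan mem_gam_of //; apply/submxP/andP => [[u Ew]|[/mem_core wc /eqP Lw]].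
  have EwA : w *m A = u *m gam_coords_at x by rewrite Ew mulmxA mulmxKV.
  split; rewrite ?EwA.
    apply/mem_core => i lt_i; rewrite EwA mul_gam_coords big1 => [|j _].
      rewrite mulr0 sub0r; case: eqP => [E|_]; last by rewrite mulr0n oppr0.
      by rewrite E in lt_i.
    by case: eqP => // E; move: lt_i; rewrite E ltnNge (inord_le ht).
  rewrite Lform_recl mul_gam_coords eqxx mulr1n big1 => [|j _].
    under [X in _ + X]eq_bigr => j _ do rewrite mul_gam_coords_lift mulrCA [X in _ * X]mulrC.
    by rewrite mulr0 sub0r -mulr_sumr mulrN addrC subrr.
  by rewrite eq_sym inord_lift_eq0.
(* The coordinates 1 to t of w, divided by M_0, are the coefficients; coordinate 0 then agrees
   because L = 0 on w. *)
exists (\row_j ((w *m A) 0 (inord (lift ord0 j)) / (coreM D ord0).@[x])).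
rewrite mulmxA; apply: (canRL (mulmxK uA)); apply/rowP => i.
set u := \row_j _; have Eu j : (coreM D ord0).@[x] * u 0 j = (w *m A) 0 (inord (lift ord0 j)).
  by rewrite mxE mulrC divfK.
have [le_i|lt_i] := leqP i t; last first.
  rewrite wc // mul_gam_coords big1 => [|j _].
    rewrite mulr0 sub0r; case: eqP => [E|_]; last by rewrite mulr0n oppr0.
    by rewrite E in lt_i.
  by case: eqP => // E; move: lt_i; rewrite E ltnNge (inord_le ht).
have [i0|i0] := eqVneq i ord0.
  rewrite i0 mul_gam_coords eqxx mulr1n big1 => [|j _]; last by rewrite eq_sym inord_lift_eq0.
  rewrite mulr0 sub0r; apply: (mulfI M0); move: Lw; rewrite Lform_recl => /eqP.
  rewrite addr_eq0 => /eqP->; rewrite mulrN mulr_sumr; congr (- _); apply: eq_bigr => j _.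
  by rewrite mulrA Eu mulrC.
have lt_i : (i.-1 < t)%N by rewrite prednK // lt0n.
have -> : i = inord (lift ord0 (Ordinal lt_i)).
  by apply/val_inj; rewrite /= inordK /bump /= add1n prednK ?lt0n.
by rewrite mul_gam_coords_lift Eu.
Qed.

End Minors.

Lemma det_outer_homog (k : fieldType) r t q e (B : 'M[{mpoly k[r.+1]}]_q) :
  (forall i j, outer_vars t (B i j) /\ B i j \is e.-homog) ->
  outer_vars t (\det B) /\ \det B \is (q * e).-homog.
Proof.
move=> H; have Hp (s : 'S_q) : outer_vars t ((-1) ^+ s * \prod_i B i (s i)) /\
    (-1) ^+ s * \prod_i B i (s i) \is (q * e).-homog.
  have [o h] : outer_vars t (\prod_i B i (s i)) /\ \prod_i B i (s i) \is (q * e).-homog.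
    split.
      apply: big_ind => [|x y|i _]; [exact: outer_vars1|exact: outer_varsM|by case: (H i (s i))].
    have -> : (q * e)%N = (\sum_(i < q) e)%N by rewrite sum_nat_const card_ord.
    elim/big_rec2: _ => [|i c p _ hp]; first exact: dhomog1.
    by apply: dhomogM => //; case: (H i (s i)).
  by rewrite mulr_sign -scaler_sign; split; [apply: outer_varsZ|apply: dhomogZ].
split; last by apply: rpred_sum => s _; case: (Hp s).
by apply: big_ind => [|x y|s _]; [exact: outer_vars0|exact: outer_varsD|case: (Hp s)].
Qed.

Lemma exists_threshold (P : nat -> Prop) b : P 1%N -> ~ P b.+2 ->
  exists chi, (chi <= b)%N /\ P chi.+1 /\ ~ P chi.+2.
Proof.
move=> P1; elim: b => [|b IH] nP; first by exists 0%N.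
have [Pb|nPb] := classic (P b.+2); first by exists b.+1.
by have [chi [le_c Pc]] := IH nPb; exists chi; split=> //; apply: leqW.
Qed.

Lemma sum_delta (R : pzRingType) (I : finType) (a : R) (i0 : I) (F : I -> R) :
  \sum_i (a *+ (i == i0)) * F i = a * F i0.
Proof.
rewrite (bigD1 i0) //= eqxx big1 ?addr0 // => i /negPf->.
by rewrite mulr0n mul0r.
Qed.

Section FamilyDim.
Variables (k : closedFieldType) (r t n d mu : nat).
Hypothesis char0 : [pchar k] =i pred0.
Hypotheses (ht1 : (1 <= t)%N) (htr : (t.+2 <= r)%N) (hn : (1 <= n)%N) (hnd : (n < d)%N).
Hypotheses (hmu0 : (0 < mu)%N) (hmu : (mu * n <= d)%N).
Local Notation X := (@pdata_wf k r t mu n d).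
Variable D : pdata k r t mu.
Hypothesis XD : X D.
Variable A : 'M[k]_r.+1.
Hypothesis uA : A \in unitmx.
Hypothesis M0n0 : coreM D ord0 != 0.
Local Notation Pi := (core t A).
Local Notation B := (gam_param D A).

Let ht : (t <= r)%N. Proof. exact: ltnW (ltnW htr). Qed.

Definition minor_cols (c : 'I_t -> 'I_r.+1) : 'M[k]_(1 + t, t) :=
  \matrix_(i, j) invmx A (inord i) (c j).

(** The coefficient of M_i when the determinant with first column (M_i) and remaining columns
    [minor_cols c] is expanded along that column. *)
Definition minor_coef (c : 'I_t -> 'I_r.+1) (i : 'I_t.+1) : k :=
  cofactor (row_mx (0 : 'cV[k]_(1 + t)) (minor_cols c)) i 0.

Lemma minor_linear x c : (coreM D ord0).@[x] * minor_at B x c =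
  (coreM D ord0).@[x] ^+ t * \sum_(i < t.+1) (coreM D i).@[x] * minor_coef c i.
Proof.
pose v : 'cV[k]_(1 + t) := \col_(i < t.+1) (coreM D i).@[x].
have := det_hyperplane_basis v (minor_cols c); rewrite mxE => E.
rewrite minor_atE gam_param_at; apply: etrans (etrans E _); last first.
  by congr (_ * _); apply: eq_bigr => i _; rewrite mxE.
congr (_ * \det _); apply/matrixP => j l.
have -> : (colsub c (gam_coords_at D x *m invmx A)) j l =
    \sum_i gam_coords_at D x j i * invmx A i (c l) by rewrite !mxE.
have E1 : rshift 1 j = lift ord0 j by apply/val_inj.
rewrite !mxE big_ord1 !mxE E1.
under eq_bigr => i _ do rewrite mxE mulrBl.
rewrite sumrB !sum_delta; congr (_ - _ * invmx A _ _).
by apply/val_inj; rewrite /= inordK.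
Qed.

(** Up to a common power of M_0 the t + 1 minors are the entries of (M_i) K for a constant square
    matrix K. If K is invertible, the homogeneous relation among the M_i is transported by its
    inverse; otherwise a kernel vector of K gives a linear relation. *)
Lemma minors_dependent_core (c : 'I_t.+1 -> 'I_t -> 'I_r.+1) : exists (G : {mpoly k[t.+1]}) e,
  [/\ G \is e.-homog, G != 0 & forall x, G.@[fun l => minor_at B x (c l)] = 0].
Proof.
have [HM adM _] := XD.
pose K : 'M[k]_t.+1 := \matrix_(i, l) minor_coef (c l) i.
pose ell x : 'rV[k]_t.+1 := (\row_i (coreM D i).@[x]) *m K.
suff [G [e [hG G0 GK]]] : exists (G : {mpoly k[t.+1]}) e,
    [/\ G \is e.-homog, G != 0 & forall x, G.@[ell x 0] = 0].
  exists G, e; split=> //; apply: (minor_relation_everywhere char0 M0n0) => x Mx.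
  have : (coreM D ord0).@[x] ^+ e != 0 by rewrite expf_neq0.
  move=> Me; apply: (mulfI Me); rewrite mulr0 -(meval_homog _ _ hG).
  rewrite (@meval_eq _ _ _ (fun l => (coreM D ord0).@[x] ^+ t * ell x 0 l)) => [|l].
    by rewrite (meval_homog _ _ hG) GK mulr0.
  rewrite minor_linear; congr (_ * _); rewrite mxE; apply: eq_bigr => i _.
  by rewrite !mxE.
have [uK|nuK] := boolP (K \in unitmx).
  have [R [e [hR R0 RM]]] := homog_relation char0 (fun i => (HM i).1) ht1 adM.
  exists (lin_change (invmx K) R), e; split; first exact: lin_change_homog.
    by apply: contraNneq R0 => E; rewrite -(lin_changeK char0 R uK) E /lin_change comp_mpoly0.
  move=> x; rewrite meval_lin_change mulmxK // -[RHS](RM x); apply: meval_eq => i.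
  by rewrite mxE.
have /det0P[u u0 uK] : \det K^T == 0.
  by rewrite det_tr; move: nuK; rewrite unitmxE unitfE negbK.
exists (\sum_l u 0 l *: 'X_l), 1%N; split.
- by apply: rpred_sum => l _; rewrite dhomogZ // dhomogX /= mdeg1.
- have /rV0Pn[i ui] := u0; apply: contraNneq ui => /(congr1 (mcoeff U_(i))).
  rewrite mcoeff0 raddf_sum /= (bigD1 i) //= big1 ?addr0 => [|j /negPf ji].
    by rewrite mcoeffZ mcoeffXU eqxx mulr1 => ->.
  by rewrite mcoeffZ mcoeffXU ji mulr0.
move=> x; have -> : (\sum_l u 0 l *: 'X_l).@[ell x 0] = (u *m (ell x)^T) 0 0.
  rewrite raddf_sum mxE; apply: eq_bigr => l _.
  by rewrite /= mevalZ mevalXU [(ell x)^T l 0]mxE.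
by rewrite trmx_mul mulmxA uK mul0mx mxE.
Qed.

Lemma minor_outer_homog c : outer_vars t (\det (colsub c B)) /\ \det (colsub c B) \is (t * (n - 1)).-homog.
Proof.
have [HM _ _] := XD; apply: det_outer_homog => j l.
have -> : (colsub c B) j l = \sum_i gam_coords D j i * (invmx A i (c l))%:MP.
  by rewrite !mxE; apply: eq_bigr => i _; rewrite [map_mx _ _ _ _]mxE.
have H i : outer_vars t (gam_coords D j i * (invmx A i (c l))%:MP) /\
    gam_coords D j i * (invmx A i (c l))%:MP \is (n - 1).-homog.
  rewrite mulrC mul_mpolyC mxE.
  have [[h0 o0] [h1 o1]] := (HM ord0, HM (lift ord0 j)).
  have Hb (b : bool) (p : {mpoly k[r.+1]}) : outer_vars t p -> p \is (n - 1).-homog -> outer_vars t (p *+ b) /\ p *+ b \is (n - 1).-homog.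
    by case: b => o h; split; rewrite ?mulr0n ?rpred0 //; apply: outer_vars0.
  have [o0' h0'] := Hb (i == inord (lift ord0 j)) _ o0 h0; have [o1' h1'] := Hb (i == ord0) _ o1 h1.
  split; [apply: outer_varsZ|apply: dhomogZ; apply: rpredB => //].
  by rewrite -[- _]scaleN1r; apply: outer_varsD => //; apply: outer_varsZ.
split; last by apply: rpred_sum => i _; case: (H i).
by apply: big_ind => [|x y|i _]; [exact: outer_vars0|exact: outer_varsD|case: (H i)].
Qed.

Lemma minors_dependent_outer (c : 'I_(r - t).+1 -> 'I_t -> 'I_r.+1) : exists (G : {mpoly k[(r - t).+1]}) e,
  [/\ G \is e.-homog, G != 0 & forall x, G.@[fun l => minor_at B x (c l)] = 0].
Proof.
have H l := minor_outer_homog (c l).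
have ad := alg_dependent_count char0 (subnKC ht) H.
apply: (homog_relation char0 (fun l => (H l).2) _ ad).
by rewrite subn_gt0; apply: ltnW.
Qed.

Lemma gam_of_ext x x' : x =1 x' -> gam_of D A x = gam_of D A x'.
Proof.
move=> E; rewrite /gam_of /Lcol; congr (_ :&: lker (covector (A *m _)))%VS.
by apply: eq_bigr => i _; rewrite (meval_eq _ E).
Qed.

Variables (Delta : {mpoly k[r.+1]}) (b : 'I_r.+1 -> k).
Hypotheses (Db : Delta.@[b] != 0) (Dsplit : forall y, Delta.@[y] != 0 -> z_split D y).

Definition gam_family (G : {vspace 'rV[k]_r.+1}) : Prop :=
  exists v, [/\ v \notin Pi, Delta.@[(v *m A) 0] != 0 & G = Gam D A (Pi + <[v]>)%VS].

Lemma gam_param_span x : (coreM D ord0).@[x] != 0 ->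
  let Bx := map_mx (fun p : {mpoly k[r.+1]} => p.@[x]) B in row_free Bx /\ gam_of D A x = rowspan Bx.
Proof.
move=> M0 /=; have E := gam_param_at D A x.
by split; rewrite E; [apply: row_free_gam_param|apply/esym/rowspan_gam_param].
Qed.

Lemma vanishes_gam_family s (c : 'I_s -> 'I_t -> 'I_r.+1) (G : {mpoly k[s]}) e : G \is e.-homog ->
  (vanishes_on gam_family c G <-> forall x, G.@[fun l => minor_at B x (c l)] = 0).
Proof.
(* Nonvanishing of [Delta] gives [z_split], hence M_0(x) nonzero; nonvanishing of x_r puts the point
   off Pi. *)
apply: (@vanishes_paramP _ _ _ _ char0 _ _ (Delta * 'X_ord_max)).
- rewrite mulf_neq0 //; first by apply: contraNneq Db => ->; rewrite meval0.
  apply/negP => /eqP /(congr1 (fun p : {mpoly k[r.+1]} => p.@[fun=> 1])).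
  by rewrite /= mevalXU meval0 => /eqP; rewrite oner_eq0.
- move=> G' [v [vc sv ->]]; exists ((v *m A) 0).
  have [rs [M0 _ _ _ _]] := z_splitP hmu0 (Dsplit sv).
  by rewrite (Gam_line XD vc); apply: gam_param_span.
move=> x; rewrite mevalM mevalXU mulf_eq0 negb_or => /andP[Dx xm].
have [rs [M0 _ _ _ _]] := z_splitP hmu0 (Dsplit Dx).
have [fB sB] := gam_param_span M0; split=> //; rewrite -sB.
pose v := (\row_i x i) *m invmx A; have vA : v *m A = \row_i x i by rewrite mulmxKV.
have Ev : (v *m A) 0 =1 x by move=> i; rewrite vA mxE.
have vc : v \notin Pi.
  apply/negP => /mem_core/(_ ord_max); rewrite Ev => E; move: xm; rewrite E ?eqxx //.
  exact: ltnW htr.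
exists v; split=> //; first by rewrite (meval_eq _ Ev).
by rewrite (Gam_line XD vc); apply: gam_of_ext.
Qed.

Lemma exists_nonzero_M0 : exists x, (coreM D ord0).@[x] != 0.
Proof. exact: mpoly_neq0P. Qed.

Lemma unirational_gam_family : unirational_family t gam_family.
Proof.
have [x Mx] := exists_nonzero_M0.
exists r.+1, B; split.
  by exists (gam_of D A x), x; apply: gam_param_span.
move=> s c G e hG; rewrite (vanishes_gam_family _ hG).
have HV := @vanishes_paramP _ _ _ _ char0 B (param_family B) _ M0n0.
apply: iff_sym; apply: (HV _ _ _ _ _ _ hG) => // {}x {}Mx.
have [fB sB] := gam_param_span Mx; split=> //.
by exists x; split.
Qed.

Lemma gam_family_dim :
  exists chi, family_dim t gam_family chi /\ (chi <= minn (t - 1) (r - t - 1))%N.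
Proof.
pose P s := exists c : 'I_s -> 'I_t -> 'I_r.+1, pluecker_independent gam_family c.
have P1 : P 1%N.
  (* A single minor that is not identically zero is independent: a form in one variable vanishing at
     a nonzero value is zero. *)
  have [x Mx] := exists_nonzero_M0; have [c dc] := row_free_minor (gam_param_span Mx).1.
  exists (fun=> c) => G e hG /(vanishes_gam_family _ hG) H.
  have G1 : G.@[fun=> 1] = 0.
    have := H x; rewrite (@meval_eq _ _ _ (fun l => minor_at B x c * (fun=> 1) l)) => [|l].
      rewrite (meval_homog _ _ hG) => /eqP; rewrite mulf_eq0 expf_eq0 => /orP[/andP[_]|/eqP//].
      by rewrite minor_atE (negPf dc).
    by rewrite mulr1.
  apply: (mpoly_ext0 char0) => v; rewrite (@meval_eq _ _ _ (fun l => v ord0 * (fun=> 1) l)) => [|l].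
    by rewrite (meval_homog _ _ hG) G1 mulr0.
  by rewrite mulr1 (ord1 l).
have nP1 : ~ P t.+1.
  move=> [c Hc]; have [G [e [hG G0 Gx]]] := minors_dependent_core c.
  by case/eqP: G0; apply: (Hc _ e) => //; apply/(vanishes_gam_family _ hG).
have nP2 : ~ P (r - t).+1.
  move=> [c Hc]; have [G [e [hG G0 Gx]]] := minors_dependent_outer c.
  by case/eqP: G0; apply: (Hc _ e) => //; apply/(vanishes_gam_family _ hG).
(* Here b + 2 is min (t, r - t) + 1, a number of Pluecker coordinates excluded by [nP1] or [nP2]. *)
have [|chi [le_chi [Pc nPc]]] := @exists_threshold P (minn (t - 1) (r - t - 1)) P1.
  case: leqP => _.
    by have -> : (t - 1).+2 = t.+1 by rewrite subn1 prednK.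
  by have -> : (r - t - 1).+2 = (r - t).+1 by rewrite subn1 prednK // subn_gt0 ltnW.
by exists chi.
Qed.

End FamilyDim.

(** * Cones *)

Section Cones.
Variables (k : closedFieldType) (r t n d mu : nat).
Hypothesis char0 : [pchar k] =i pred0.
Hypotheses (ht1 : (1 <= t)%N) (htr : (t.+2 <= r)%N) (hn : (1 <= n)%N) (hnd : (n < d)%N).
Hypotheses (hmu0 : (0 < mu)%N) (hmu : (mu * n <= d)%N).
Local Notation X := (@pdata_wf k r t mu n d).
Variable D : pdata k r t mu.
Hypothesis XD : X D.
Variable A : 'M[k]_r.+1.
Hypothesis uA : A \in unitmx.
Local Notation f := (lin_change A (permutti D)).

Let ht : (t <= r)%N. Proof. exact: ltnW (ltnW htr). Qed.

(** The coefficients c of the dependence are the coordinates of a point of the core at which L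
    vanishes for every y; translating by this point changes neither L nor the outer coordinates,
    hence not f. *)
Lemma lin_dependent_cone : lin_dependent (coreM D) -> is_cone (zeros f).
Proof.
move=> [c [i0 ci0] Ec].
pose cx : 'rV[k]_r.+1 := \sum_(i < t.+1) c i *: delta_mx 0 (inord i).
have cxE j : cx 0 j = \sum_(i < t.+1) c i * (j == inord i)%:R.
  by rewrite summxE; apply: eq_bigr => i _; rewrite !mxE eqxx.
have cxi (i : 'I_t.+1) : cx 0 (inord i) = c i.
  rewrite cxE (bigD1 i) //= eqxx mulr1 big1 ?addr0 // => i' /negPf ne.
  by rewrite -val_eqE /= !inordK ?(leq_trans (ltn_ord _)) // val_eqE eq_sym ne mulr0.
have cxo (j : 'I_r.+1) : (t < j)%N -> cx 0 j = 0.
  move=> lt_j; rewrite cxE big1 // => i _; case: eqP => [E|_]; last by rewrite mulr0.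
  by move: lt_j; rewrite E ltnNge (inord_le ht).
have Lc y : Lform D y (cx 0) = 0.
  have := congr1 (meval y) Ec; rewrite meval0 raddf_sum /= => <-; apply: eq_bigr => i _.
  by rewrite cxi mevalZ mulrC.
have vA : cx *m invmx A *m A = cx by rewrite mulmxKV.
exists (cx *m invmx A); split.
- apply: contraNneq ci0 => E; rewrite -cxi -vA E mul0mx mxE //.
- rewrite /zeros meval_lin_change vA (@meval_permutti_outer _ _ _ _ _ _ hn hnd hmu _ XD (cx 0) (fun=> 0) 0).
    rewrite big1 ?mulr0 // => l _; rewrite Lc; have [l0|l0] := posnP l.
      by rewrite l0 subn0 expr0n gtn_eqF ?mul0r.
    by rewrite [0 ^+ l]expr0n gtn_eqF // mulr0 mul0r.
  by move=> j lt_j; rewrite mul0r cxo.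
move=> w fw a b; rewrite /zeros in fw *; rewrite !meval_lin_change in fw *.
have Ew j : ((a *: (cx *m invmx A) + b *: w) *m A) 0 j = b * (w *m A) 0 j + a * cx 0 j.
  by rewrite mulmxDl -!scalemxAl vA addrC [LHS]mxE [X in X + _]mxE [X in _ + X]mxE.
rewrite (meval_eq _ Ew).
transitivity ((permutti D).@[fun j => b * (w *m A) 0 j]); last first.
  by rewrite (meval_homog _ _ (permutti_homog hmu XD hn)) fw mulr0.
rewrite !(@meval_permutti_outer _ _ _ _ _ _ hn hnd hmu _ XD _ ((w *m A) 0) b) //.
  by rewrite Lform_D Lc mulr0 addr0.
by move=> j lt_j; rewrite cxo // mulr0 addr0.
Qed.

Lemma cone_permutti : irreducible_elt (permutti D) -> partials_independent (permutti D) ->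
  ~ is_cone (zeros f).
Proof.
move=> fI HP [v [v0 fv Hv]].
have hf := permutti_homog hmu XD hn.
have d0 : (0 < d)%N by apply: ltn_trans hnd.
have zE w : zeros f w = zeros (permutti D) (w *m A) by rewrite /zeros meval_lin_change.
have zV w : zeros (permutti D) w = zeros f (w *m invmx A) by rewrite zE mulmxKV.
have r1 : (1 <= r)%N by apply: leq_trans htr.
have [|u [i /eqP ui] /HP] := cone_dderiv char0 r1 fI hf d0; last by move/(_ i).
exists (v *m A); split.
- by apply: contraNneq v0 => E; rewrite -(mulmxK uA v) E mul0mx.
- by rewrite -zE.
by move=> w; rewrite zV => /Hv fw a b; rewrite zV mulmxDl -!scalemxAl mulmxK.
Qed.

Lemma slice_good_irreducible_elt : slice_good d D -> irreducible_elt (permutti D).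
Proof.
move=> sg; have f0 := slice_good_neq0 char0 ht1 htr hn hnd hmu0 hmu XD sg.
have d0 : (0 < d)%N by apply: ltn_trans hnd.
split=> // [|g h E].
  by rewrite unit_msize // (dhomog_msize (permutti_homog hmu XD hn)) // -ltnNge.
have [g0 h0] : g != 0 /\ h != 0 by apply/andP; rewrite -negb_or -mulf_eq0 -E.
rewrite !unit_msize //; exact: (slice_good_irreducible char0 ht1 htr hn hnd hmu0 hmu XD sg E).
Qed.

End Cones.

Theorem proposition2p13 (k : closedFieldType) (char0 : [pchar k] =i pred0)
    (r t n d : nat) (hr : (2 <= r)%N) (ht1 : (1 <= t)%N) (ht2 : (t <= r - 2)%N)
    (hn : (1 <= n)%N) (hd : (n < d)%N) :
  let mu := (d %/ n)%N in
  generically_in (@pdata_coef k r t mu) (@pdata_wf k r t mu n d)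
    (fun D : pdata k r t mu =>
      forall A : 'M[k]_r.+1, A \in unitmx ->
      let f := lin_change A (permutti D) in
      let Pi := core t A in
      [/\ (* (i) *)
          generically_in (@xcoord k r.+1) (fun p => p \in Pi /\ p != 0)
            (fun p => multiplicity f p (d - mu)),
          (* (ii) and (iii); the general subspace Pi' through Pi is the span of
             Pi and a general point v outside Pi *)
          (exists (U : 'rV[k]_r.+1 -> Prop)
                  (Gam : {vspace 'rV[k]_r.+1} -> {vspace 'rV[k]_r.+1}),
            [/\ dense_open_in (@xcoord k r.+1) (fun v => v \notin Pi) U,
                (forall v, v \notin Pi -> U v ->
                   let Pi' := (Pi + <[v]>)%VS in
                   cuts_cone_off f Pi' Pi t mu (Gam Pi')) &
                let F := fun G : {vspace 'rV[k]_r.+1} =>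
                  exists v, [/\ v \notin Pi, U v & G = Gam (Pi + <[v]>)%VS] in
                unirational_family t F /\
                exists chi, family_dim t F chi /\
                            (chi <= minn (t - 1) (r - t - 1))%N]),
          (* (iv) *)
          ((r - t - 2 < mu)%N ->
             (is_cone (zeros f) <-> lin_dependent (coreM D))),
          ((t = 1 \/ n = 1 \/ n = 2)%N -> lin_dependent (coreM D)) &
          (* (v) *)
          irreducible_form f /\ irreducible_set (zeros f)]).
Proof.
move=> mu.
have hmu0 : (0 < mu)%N by rewrite divn_gt0 // ltnW.
have hmu : (mu * n <= d)%N by apply: leq_trunc_div.
have htr : (t.+2 <= r)%N by move: ht1 ht2; clear; lia.
have G1 := generically_slice_good char0 ht1 htr hn hd hmu0 hmu.
have G2 := generically_coreM0 char0 ht1 htr hn hd hmu0 hmu.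
have G3 := generically_partials char0 ht1 htr hn hd hmu0 hmu.
apply: generically_impl (generically_and G1 (generically_and G2 G3)) => D XD [sg [M0 HP]] A uA f Pi.
have fI := slice_good_irreducible_elt char0 ht1 htr hn hd hmu0 hmu XD sg.
have hf := permutti_homog hmu XD hn.
have d0 : (0 < d)%N by apply: ltn_trans hd.
have r1 : (1 <= r)%N by apply: ltnW.
(* The base point of the irreducible plane section has a separable z-line, so it also serves as the
   sample point for (i), (ii) and (iii). *)
have [_ [b [_ _ _ sb cb]]] := sg.
have [Delta [Db Dsplit]] := z_split_open hmu0 (conj sb cb).
split.
- apply: (generically_multiplicity char0 htr hn hd hmu XD uA); exists b.
  by have [rs [Mb Pb _ _ _]] := z_splitP hmu0 (conj sb cb).
- exists (fun v => Delta.@[(v *m A) 0] != 0), (Gam D A); split.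
  + exact: (dense_fibres char0 htr uA Db).
  + by move=> v vc Dv; apply: (cuts_cone ht1 htr hn hd hmu0 hmu XD uA vc); apply: Dsplit.
  + split; first exact: (unirational_gam_family char0 htr hmu0 XD uA M0 Db Dsplit).
    exact: (gam_family_dim char0 ht1 htr hmu0 XD uA M0 Db Dsplit).
- move=> _; split=> [fc|ld]; last by apply: (lin_dependent_cone _ _ _ _ _ XD uA ld).
  by case: HP => // HP; case: (cone_permutti char0 htr hn hd hmu XD uA fI HP).
- have [HM adM _] := XD; have hM i := (HM i).1.
  case=> [t1|[n1|n2]].
  + exact: (lin_dependent_pair char0 hM t1 adM).
  + by apply: (lin_dependent_const hM ht1); rewrite n1.
  + by apply: (lin_dependent_linear char0 hM _ adM); rewrite n2.
- have fAI : irreducible_elt f by apply: irreducible_lin_change.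
  split; first exact: fAI.
  by apply: (irreducible_zeros char0 r1 fAI _ d0); apply: lin_change_homog.
Qed.
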